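(* Let $\alpha>0$, let $X_1,X_2,\ldots$ be i.i.d. nonnegative with distribution $F$ given by $1-F(x)=e^{-x^\alpha}$, $x\ge0$, and let $\beta=1+\frac1\alpha$. Let $W=\lim_{k\to\infty}\overline{Y}_k/k^{1/\alpha}$ (this limit exists a.s. and $0<W<\infty$), and let $$T_k^*=\frac{T_k}{\sum_{j=1}^{k-1}[1-F(\beta\overline{Y}_j)]^{-1}}.$$ Then $$T_k^*\to\sum_{j=1}^\infty R_j\quad\text{in distribution as }k\to\infty,$$ where, conditionally on $W=w$, the $R_j$ are independent and exponentially distributed with means $\mu_j$, where $$\mu_j=\frac{\exp[(\beta w)^\alpha]-1}{\exp[j(\beta w)^\alpha]}.$$
   Context: Selection rule. For i.i.d. observations $X_1,X_2,\ldots$ with distribution function $F$ and fixed $\beta\ge1$, set $T_1=1$, $Y_1=X_1$, and inductively $T_{k+1}=\inf\{i>T_k: X_i>\beta\overline{Y}_k\}$, $Y_{k+1}=X_{T_{k+1}}$, where $\overline{Y}_k=\frac1k\sum_{j=1}^kY_j$ (the ''$\beta$-better than average rule''). Thus $T_k$ is the number of observations inspected until the $k$th item is retained. *)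

(* Defs.v *)
From HB Require Import structures.
From mathcomp Require Import all_boot all_order all_algebra.
From mathcomp Require Import all_classical all_reals all_analysis.

Set Implicit Arguments.
Unset Strict Implicit.
Unset Printing Implicit Defensive.

Import Order.TTheory GRing.Theory Num.Theory.
Import numFieldNormedType.Exports.

Local Open Scope classical_set_scope.
Local Open Scope ring_scope.

(* The smallest i > t satisfying p; like [inf], it is 0 when there is none.
   For observations with unbounded support that case has probability zero. *)
Definition first_after (t : nat) (p : pred nat) : nat :=
  if pselect (exists i, (t < i)%N && p i) is left h then ex_minn h else 0%N.

Definition mean (R : realType) (s : seq R) : R :=
  (\sum_(y <- s) y) / (size s)%:R.

Section better_than_average.
Variables (R : realType) (beta : R).

(* x i is the i-th observation for i >= 1; x 0 is never inspected.  The list is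
   [:: T_k; ...; T_1], latest retention time first. *)
Fixpoint retention_times (x : nat -> R) (k : nat) : seq nat :=
  if k isn't k'.+1 then [::] else
  let s := retention_times x k' in
  (if s is t :: _
   then first_after t (fun i => beta * mean [seq x j | j <- s] < x i)
   else 1%N) :: s.

Definition T_ (x : nat -> R) (k : nat) : nat := head 0%N (retention_times x k).

Definition Y_ (x : nat -> R) (k : nat) : R := x (T_ x k).

Definition Ybar (x : nat -> R) (k : nat) : R :=
  mean [seq x j | j <- retention_times x k].

(* T_k^* of the sample path x when the observations have distribution function
   F; junk for k <= 1, where the sum is empty. *)
Definition Tstar (F : R -> R) (x : nat -> R) (k : nat) : R :=
  (T_ x k)%:R / \sum_(1 <= j < k) (1 - F (beta * Ybar x j))^-1.

Lemma T_1 x : T_ x 1 = 1%N.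
Proof. by []. Qed.

Lemma T_S x k :
  T_ x k.+2 = first_after (T_ x k.+1) (fun i => beta * Ybar x k.+1 < x i).
Proof. by []. Qed.

Lemma YbarE x k : Ybar x k = k%:R^-1 * \sum_(1 <= j < k.+1) Y_ x j.
Proof.
have size_k : size (retention_times x k) = k by elim: k => //= k ->.
rewrite /Ybar /mean size_map size_k mulrC big_map; congr (_ * _); clear size_k.
elim: k => [|k IH]; first by rewrite big_nil big_geq.
by rewrite big_nat_recr//= -IH /= big_cons addrC.
Qed.

End better_than_average.

Definition mutually_independent (R : realType) (d : measure_display)
    (Omega : measurableType d) (P : probability Omega R)
    (X : nat -> {RV P >-> R}) : Prop :=
  forall (s : seq nat) (B : nat -> set R),
    uniq s -> (forall i, measurable (B i)) ->
    (P (\bigcap_(i in [set` s]) (X i @^-1` B i)) =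
     \prod_(i <- s) P (X i @^-1` B i))%E.

(* Conditionally on V = v, the variables Z_1, Z_2, ... are independent and Z_j
   is exponential with mean mu j v, i.e. the regular conditional law of
   (Z_1, ..., Z_n) given V = v is the product of these exponential laws.
   [exponential_prob] takes the rate, the inverse of the mean; Z 0 is unused. *)
Definition cond_indep_exponential (R : realType) (d : measure_display)
    (Omega : measurableType d) (P : probability Omega R)
    (V : {RV P >-> R}) (Z : nat -> {RV P >-> R}) (mu : nat -> R -> R) : Prop :=
  forall (n : nat) (A : set R) (B : nat -> set R),
    measurable A -> (forall j, measurable (B j)) ->
    (P (V @^-1` A `&` \bigcap_(j in [set j | (0 < j <= n)%N]) (Z j @^-1` B j)) =
     \int[distribution P V]_(v in A)
       \prod_(1 <= j < n.+1) exponential_prob (mu j v)^-1%R (B j))%E.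

(* The Z k and the limit may live on different probability spaces. *)
Definition cvg_in_distribution (R : realType) (d d' : measure_display)
    (Omega : measurableType d) (P : probability Omega R)
    (Omega' : measurableType d') (Q : probability Omega' R)
    (Z : nat -> Omega -> R) (Zoo : {RV Q >-> R}) : Prop :=
  (forall k, measurable_fun [set: Omega] (Z k)) /\
  (forall x : R, {for x, continuous (cdf Zoo)} ->
     P [set w | Z k w <= x] @[k --> \oo] --> cdf Zoo x).

(* Main.v *)
(* Put V_k = (beta Ybar_k)^alpha / (k + beta). Given the past, the k-th gap
   T_{k+1} - T_k is geometric with mean exp((beta Ybar_k)^alpha), and the retained
   Y_{k+1}^alpha exceeds (beta Ybar_k)^alpha by an exponential variable.
   The choice beta = 1 + 1/alpha makes V_k nondecreasing, and Borel-Cantelli bounds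
   it; so V_k converges to a positive V = (beta W)^alpha, the increments of
   (beta Ybar_k)^alpha tend to V as well, and hence the normalizing sum of T*_k is
   asymptotically geometric with ratio exp V. Only the last m gaps matter up to a
   small error; peeling them off one at a time, conditionally on the past, shows
   that E exp(- lam T*_k) tends to E prod_j (1 + lam mu_j)^-1.
   On the other space, writing exp(- lam z) as the integral of lam exp(- lam s) over
   s >= z reduces the transform of R_1 + ... + R_n to the conditional law of boxes.
   As mu_1 + mu_2 + ... <= 1, that transform is at least exp(- lam), so the series
   is almost surely finite, and its transform is the same limit. Distribution
   functions are recovered from transforms through polynomials in exp(- s T*_k)
   approximating the indicator of T*_k < x. *)
Require Import Defs.
From HB Require Import structures.
From mathcomp Require Import all_boot all_order all_algebra.
From mathcomp Require Import all_classical all_reals all_analysis.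
From mathcomp Require Import measurable_realfun.
From mathcomp Require Import ring lra.

Set Implicit Arguments.
Unset Strict Implicit.
Unset Printing Implicit Defensive.

Import Order.TTheory GRing.Theory Num.Theory.
Import numFieldNormedType.Exports.

Local Open Scope classical_set_scope.
Local Open Scope ring_scope.

(** * Limits of bounded integrals *)

(** Two features shape the argument. The limit [V] is known only from the whole path, and
    conditioning on it would destroy the geometric law of the gaps; the normalizer of [Tstar]
    likewise depends on items retained later. Both are replaced by data of an earlier index [n]:
    [V n] for the limit, and a normalizer extrapolated from [U n] and [V n]. These stay frozen while
    the last [m] gaps are peeled; the errors vanish as [n] grows with [m] fixed, and [m] is sent to
    infinity afterwards. The times [T_k] are stopping times. Instead of using stopped
    sigma-algebras, the space is cut into countably many events on which the list of retention times
    is a fixed [s]. Up to null events, such an event is decided by the observations up to the head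
    of [s], so conditioning happens at deterministic times. The bound on the waiting time before the
    last gaps needs levels growing at a uniform rate, but the lower bound [V 0] on their increments
    is random and can be arbitrarily small; hence the cutoff [fast eta]. *)

Section bounded_convergence.
Context (R : realType) (d : measure_display) (Omega : measurableType d)
  (P : probability Omega R).

Lemma integrable_bounded (f : Omega -> R) (M : R) :
  measurable_fun setT f -> (forall w, `|f w| <= M) -> P.-integrable setT (EFin \o f).
Proof.
move=> mf fM; apply: measurable_bounded_integrable => //.
  by rewrite (le_lt_trans (probability_le1 _ _)) ?ltry.
exists M; split; first exact: num_real.
by move=> x Mx w _ /=; rewrite (le_trans (fM w)) ?ltW.
Qed.

Section limit.
Variables (f_ : nat -> Omega -> R) (f : Omega -> R) (M : R).
Hypothesis mf_ : forall n, measurable_fun setT (f_ n).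
Hypothesis mf : measurable_fun setT f.
Hypothesis ff : {ae P, forall w, f_ n w @[n --> \oo] --> f w}.
Hypothesis fM : forall n w, `|f_ n w| <= M.

Let dominated : [/\ P.-integrable setT (EFin \o f),
  (\int[P]_w (`|(f_ n w)%:E - (f w)%:E|)%E)%E @[n --> \oo] --> 0%E &
  (\int[P]_w (f_ n w)%:E)%E @[n --> \oo] --> (\int[P]_w (f w)%:E)%E].
Proof.
apply: (@dominated_convergence _ _ _ P setT measurableT
  (fun n w => (f_ n w)%:E) (fun w => (f w)%:E) (cst M%:E)).
- by move=> n; exact/measurable_EFinP.
- exact/measurable_EFinP.
- by apply: filterS ff => w fw _; apply: cvg_EFin => //; exact: nearW.
- by apply: (@integrable_bounded (cst M) `|M|).
- by apply: aeW => w n _ /=; rewrite lee_fin.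
Qed.

Lemma bounded_convergence :
  (\int[P]_w (f_ n w)%:E)%E @[n --> \oo] --> (\int[P]_w (f w)%:E)%E.
Proof. by have [] := dominated. Qed.

Lemma bounded_Rconvergence :
  (\int[P]_w f_ n w) @[n --> \oo] --> \int[P]_w f w.
Proof.
have [intf _ ?] := dominated; apply: fine_cvg; rewrite fineK//.
exact: integrable_fin_num.
Qed.

End limit.
End bounded_convergence.

Section pointwise_limit.
Context (R : realType) (d : measure_display) (Omega : measurableType d).

(* A limit superior, so that it is measurable with no convergence assumption;
   0 where the limit superior is infinite. *)
Definition limit_fun (f_ : nat -> Omega -> R) (w : Omega) : R :=
  fine (limn_esup (fun n => (f_ n w)%:E)).

Lemma measurable_limit_fun (f_ : nat -> Omega -> R) :
  (forall n, measurable_fun setT (f_ n)) -> measurable_fun setT (limit_fun f_).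
Proof.
move=> mf_; apply: measurableT_comp; first exact: fine_measurable.
by apply: measurable_fun_limn_esup => n; exact/measurable_EFinP.
Qed.

Lemma limit_funE (f_ : nat -> Omega -> R) w l : f_ n w @[n --> \oo] --> l -> limit_fun f_ w = l.
Proof.
move=> fl; rewrite /limit_fun.
have fl' : (f_ n w)%:E @[n --> \oo] --> l%:E.
  by apply: cvg_EFin => //; exact: nearW.
by rewrite is_cvg_limn_esupE ?(cvg_lim _ fl')//; apply/cvg_ex; exists l%:E.
Qed.
End pointwise_limit.

Lemma ae_eq_Rintegral (R : realType) (d : measure_display) (Omega : measurableType d)
    (P : probability Omega R) (f g : Omega -> R) :
  measurable_fun setT f -> measurable_fun setT g ->
  {ae P, forall w, f w = g w} -> \int[P]_w f w = \int[P]_w g w.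
Proof.
move=> mf mg fg; congr fine; apply: ae_eq_integral => //.
- exact/measurable_EFinP.
- exact/measurable_EFinP.
- by apply: filterS fg => w -> _.
Qed.

Lemma integral_prob_cst (R : realType) (d : measure_display) (Omega : measurableType d)
  (P : probability Omega R) (c : R) : (\int[P]_w c%:E = c%:E)%E.
Proof.
rewrite (integral_cst _ measurableT) [X in (_ * X)%E](_ : _ = 1%E) ?mule1//.
exact: probability_setT.
Qed.

Lemma Rintegral_prob_cst (R : realType) (d : measure_display) (Omega : measurableType d)
  (P : probability Omega R) (c : R) : \int[P]_w c = c.
Proof. by rewrite /Rintegral integral_prob_cst. Qed.

(** * Conditioning on the past *)

Section filtration.
Context (R : realType) (d : measure_display) (Omega : measurableType d)
  (P : probability Omega R) (X : nat -> {RV P >-> R}).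

(** A pi-system of boxes in the first [t] inspected observations. Coordinate [i] of a box constrains
    [X i.+1], which leaves out the never inspected [X 0]. *)
Definition past_cylinders (t : nat) : set (set Omega) :=
  [set A | exists2 B : nat -> set R, forall i, measurable (B i) &
           A = \bigcap_(i in [set` iota 0 t]) X i.+1 @^-1` B i].

Local Notation past t := (g_sigma_algebraType (past_cylinders t)).

Lemma past_cylinders_setI t : setI_closed (past_cylinders t).
Proof.
move=> _ _ [A mA ->] [B mB ->]; exists (fun i => A i `&` B i).
  by move=> i; exact: measurableI.
apply/seteqP; split=> [w [hA hB] i it|w h].
  by split; [exact: hA|exact: hB].
by split=> i /h[].
Qed.

Lemma past_cylinders_le s t : (s <= t)%N -> past_cylinders s `<=` past_cylinders t.
Proof.
move=> st _ [B mB ->]; exists (fun i => if (i < s)%N then B i else setT).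
  by move=> i; case: ifP.
apply/seteqP; split=> w h i /=; rewrite mem_iota /= add0n => it.
  by case: ifP => // ilt; apply: h => /=; rewrite mem_iota.
by have := h i; rewrite /= mem_iota /= it (leq_trans it st); apply.
Qed.

Lemma past_cylinders_measurable t A : past_cylinders t A -> measurable A.
Proof.
move=> [B mB ->]; apply: fin_bigcap_measurable => // i _.
by rewrite -[X in measurable X]setTI; exact: measurable_funP.
Qed.

Lemma past_measurable t (A : set (past t)) : measurable A -> measurable (A : set Omega).
Proof.
apply: smallest_sub; first exact: sigma_algebra_measurable.
exact: past_cylinders_measurable.
Qed.

Lemma measurable_past_le s t (A : set (past s)) : (s <= t)%N ->
  measurable A -> measurable (A : set (past t)).
Proof.
move=> st; apply: sub_smallest2r; first exact: smallest_sigma_algebra.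
exact: past_cylinders_le.
Qed.

Lemma measurable_fun_past d' (T : measurableType d') t (A : set (past t)) (f : past t -> T) :
  measurable A -> measurable_fun A f -> measurable_fun (A : set Omega) (f : Omega -> T).
Proof. by move=> mA mf _ B mB; apply: past_measurable; exact: mf. Qed.

Lemma measurable_fun_past_le d' (T : measurableType d') s t (A : set (past s)) (f : past s -> T) :
  (s <= t)%N -> measurable A ->
  measurable_fun A f -> measurable_fun (A : set (past t)) (f : past t -> T).
Proof. by move=> st mA mf _ B mB; apply: (measurable_past_le st); exact: mf. Qed.

Lemma measurable_fun_past_X t i : (0 < i <= t)%N ->
  measurable_fun [set: past t] (X i : past t -> R).
Proof.
case: i => // i /= it _ B mB; rewrite setTI; apply: sub_sigma_algebra.
exists (fun j => if j == i then B else setT); first by move=> j; case: ifP.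
apply/seteqP; split=> w h.
  by move=> j _ /=; case: eqP => // ->.
by have := h i; rewrite /= eqxx mem_iota; exact.
Qed.

Hypothesis indepX : mutually_independent (fun i => X i.+1).

(** A pi-lambda argument in the past event: the identity holds on cylinders and survives complements
    and countable disjoint unions. *)
Lemma past_independent t (A : set (past t)) (B : set R) :
  measurable A -> measurable B ->
  P (A `&` X t.+1 @^-1` B) = (P A * P (X t.+1 @^-1` B))%E.
Proof.
move=> mA mB.
have mXB : measurable (X t.+1 @^-1` B).
  by rewrite -[Y in measurable Y]setTI; exact: measurable_funP.
apply: (@dynkin_induction _ (past t) (past_cylinders t)
  (fun A => P (A `&` X t.+1 @^-1` B) = (P A * P (X t.+1 @^-1` B))%E)) => //.
- exact: past_cylinders_setI.
- by rewrite setTI probability_setT mul1e.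
- move=> _ [C mC ->].
  (* Independence of [t + 1] and of [t] observations, with the same sets: the two products differ
     exactly by the factor of [X t.+1]. *)
  have := indepX (s := iota 0 t.+1) (B := fun i => if (i < t)%N then C i else B).
  have := indepX (s := iota 0 t) (B := fun i => if (i < t)%N then C i else B).
  have mCB i : measurable (if (i < t)%N then C i else B) by case: ifP.
  rewrite !iota_uniq => /(_ isT mCB) hC /(_ isT mCB).
  have -> : iota 0 t.+1 = iota 0 t ++ [:: t] by rewrite -addn1 iotaD.
  rewrite big_cat /= big_seq1 ltnn.
  set D := \bigcap_(i in [set` iota 0 t]) X i.+1 @^-1` C i.
  have hD : \bigcap_(i in [set` iota 0 t]) X i.+1 @^-1` (if (i < t)%N then C i else B) = D.
    by apply: eq_bigcapr => i /=; rewrite mem_iota /= => ->.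
  rewrite -hC hD => <-; congr (P _).
  apply/seteqP; split=> w.
    case=> hw hB i /=; rewrite mem_cat mem_seq1 => /orP[it|/eqP ->].
      by move: (it); rewrite mem_iota /= => ->; exact: hw.
    by rewrite ltnn.
  move=> h; split.
    by rewrite -hD => i it; apply: h; rewrite /= mem_cat it.
  by have := h t; rewrite /= mem_cat mem_seq1 eqxx orbT ltnn; exact.
- move=> S mS hS; have mS' : d.-measurable (S : set Omega) := past_measurable mS.
  have finP (C : set Omega) : measurable C -> P C \is a fin_num by exact: fin_num_measure.
  rewrite (probability_setC P mS') muleBl; last 2 first.
  + exact: finP.
  + by apply: fin_num_adde_defl; rewrite fin_numN; exact: finP.
  rewrite mul1e -hS setIC (setIC S) -setDE measureD//.
  by rewrite ltey_eq finP.
- move=> F mF tF hF.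
  have mF' n : measurable (F n : set Omega) by exact: past_measurable.
  rewrite setI_bigcupl !measure_bigcup//.
  + rewrite muleC -[P _]fineK ?fin_num_measure// -nneseriesZl//.
    by apply: eq_eseriesr => n _; rewrite fineK ?fin_num_measure// muleC; exact: hF.
  + by move=> n _; exact: measurableI.
  + exact: trivIset_setIr.
Qed.

(* Conditioning on the past freezes [Z] and [q]: this is Fubini for the joint law
   of the identity of [past t] and [X t.+1], which is a product measure. *)
Lemma integral_past t (Z : past t -> \bar R) (H : set (past t * R)) :
  measurable_fun [set: past t] Z -> (forall w, 0 <= Z w)%E -> measurable H ->
  (\int[P]_(w in [set w | H (w, X t.+1 w)]) Z w =
   \int[P]_w (Z w * distribution P (X t.+1) (xsection H w)))%E.
Proof.
move=> mZ Z0 mH.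
have mid : measurable_fun [set: Omega] (id : Omega -> past t).
  by move=> _ B mB; rewrite setTI; exact: (@past_measurable t B).
have mpair : measurable_fun [set: Omega] ((fun w => (w, X t.+1 w)) : Omega -> past t * R).
  exact: measurable_fun_pair.
pose pid : {mfun Omega >-> past t} :=
  HB.pack (id : Omega -> past t) (isMeasurableFun.Build _ _ _ _ _ mid).
pose ppair : {mfun Omega >-> (past t * R)%type} :=
  HB.pack ((fun w => (w, X t.+1 w)) : Omega -> past t * R)
    (isMeasurableFun.Build _ _ _ _ _ mpair).
have mP : forall C, measurable C ->
    (distribution P pid \x distribution P (X t.+1))%E C = distribution P ppair C.
  apply: product_measure_unique => A B mA mB.
  rewrite /distribution /pushforward /= -past_independent//.
pose f (z : past t * R) := (Z z.1 * (\1_H z)%:E)%E.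
have mf : measurable_fun [set: past t * R] f.
  apply: emeasurable_funM; first exact: measurableT_comp.
  by apply/measurable_EFinP.
have f0 z : (0 <= f z)%E by rewrite /f mule_ge0.
have mXH : measurable [set w | H (w, X t.+1 w)].
  have : measurable (ppair @^-1` H).
    by rewrite -[Y in measurable Y]setTI; exact: measurable_funP.
  by [].
transitivity (\int[distribution P ppair]_z f z)%E.
  rewrite ge0_integral_distribution// -[A in integral _ A]setTI integral_mkcondr.
  apply: eq_integral => w _; rewrite /f /= patchE indicE.
  by rewrite (_ : _ \in H = (w \in [set w | H (w, X t.+1 w)]))//; case: ifP; rewrite ?mule1 ?mule0.
rewrite -(eq_measure_integral _ (fun C mC _ => mP C mC)) fubini_tonelli1//.
rewrite ge0_integral_distribution//; last 2 first.
- exact: measurable_fun_fubini_tonelli_F.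
- by move=> y; apply: integral_ge0.
apply: eq_integral => w _ /=; rewrite /fubini_F /f /=.
rewrite ge0_integralZl//; last first.
  apply/measurable_EFinP; apply: (measurable_fun_pair2 (f := (\1_H : past t * R -> R))).
  exact: measurable_indic.
congr (_ * _)%E; rewrite (_ : (fun y => _) = (fun y => (\1_(xsection H w) y)%:E)).
  by rewrite integral_indic ?setIT//; exact: measurable_xsection.
by apply/funext => y; congr (_%:E); rewrite !indicE mem_xsection.
Qed.

Lemma measurable_past_ler t (q : past t -> R) : measurable_fun [set: past t] q ->
  measurable ([set z | (z.2 <= q z.1)%R] : set (past t * R)).
Proof.
move=> mq; rewrite -[X in measurable X]setTI; apply: measurable_fun_le => //.
exact: measurableT_comp.
Qed.

Lemma integral_past_le t (Z : past t -> \bar R) (q : past t -> R) :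
  measurable_fun [set: past t] Z -> measurable_fun [set: past t] q -> (forall w, 0 <= Z w)%E ->
  (\int[P]_(w in [set w | (X t.+1 w <= q w)%R]) Z w = \int[P]_w (Z w * cdf (X t.+1) (q w)))%E.
Proof.
move=> mZ mq Z0.
rewrite (integral_past (H := [set z | (z.2 <= q z.1)%R]))//; last exact: measurable_past_ler.
apply: eq_integral => w _; congr (_ * distribution P _ _)%E.
by apply/seteqP; split=> y; rewrite /xsection /= in_itv/=; [move/set_mem|move=> h; exact/mem_set].
Qed.

Lemma integral_past_gt t (Z : past t -> \bar R) (q : past t -> R) :
  measurable_fun [set: past t] Z -> measurable_fun [set: past t] q -> (forall w, 0 <= Z w)%E ->
  (\int[P]_(w in [set w | (q w < X t.+1 w)%R]) Z w = \int[P]_w (Z w * (1 - cdf (X t.+1) (q w))))%E.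
Proof.
move=> mZ mq Z0.
have mH := measurable_past_ler mq.
rewrite [in LHS](_ : [set w | _] = [set w | (~` [set z | (z.2 <= q z.1)%R]) ((w : past t), X t.+1 w)]); last first.
  by apply/seteqP; split=> w /=; [move=> h; apply/negP; rewrite -ltNge|move=> /negP; rewrite -ltNge].
rewrite (integral_past mZ Z0 (measurableC mH)).
apply: eq_integral => w _; congr (_ * _)%E.
rewrite /cdf -probability_setC//; congr (distribution P _ _).
apply/seteqP; split=> y; rewrite /xsection /= in_itv/=.
  by move/set_mem.
by move=> h; exact/mem_set.
Qed.

Section iterate.
Variable F : R -> R.
Hypothesis cdfX : forall (i : nat) x, (0 < i)%N -> cdf (X i) x = (F x)%:E.

Lemma common_cdf_measurable : measurable_fun [set: R] F.
Proof.
apply/measurable_EFinP; rewrite (_ : EFin \o F = cdf (X 1%N)); first exact: cdf_measurable.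
by apply/funext => x /=; rewrite cdfX.
Qed.

Lemma common_cdf_ge0 x : 0 <= F x.
Proof. by rewrite -lee_fin -(@cdfX 1%N). Qed.

Lemma common_cdf_le1 x : F x <= 1.
Proof. by rewrite -lee_fin -(@cdfX 1%N)//; exact: cdf_le1. Qed.

Lemma common_cdf_nondecreasing : {homo F : x y / x <= y}.
Proof. by move=> x y xy; rewrite -lee_fin -!(@cdfX 1%N)//; exact: cdf_nondecreasing. Qed.

Definition no_exceedance t n (q : Omega -> R) : set Omega :=
  \bigcap_(j in [set` iota t.+1 n]) [set w | X j w <= q w].

Lemma no_exceedanceE t n q : no_exceedance t n q =
  [set w | forall j, (t < j <= t + n)%N -> X j w <= q w].
Proof.
apply/seteqP; split=> w h j jtn; apply: h; move: jtn; rewrite /mkset mem_iota.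
  by rewrite addSn ltnS.
by rewrite addSn ltnS.
Qed.

Lemma no_exceedanceS t n q : no_exceedance t n.+1 q =
  no_exceedance t n q `&` [set w | X (t + n).+1 w <= q w].
Proof.
rewrite !no_exceedanceE; apply/seteqP; split=> w.
  move=> h; split=> [j /andP[tj jn]|]; apply: h.
    by rewrite tj addnS leqW.
  by rewrite ltnS leq_addr addnS leqnn.
case=> h1 h2 j /andP[tj]; rewrite addnS leq_eqVlt => /predU1P[->//|]; rewrite ltnS => jn.
by apply: h1; rewrite tj.
Qed.

Lemma measurable_no_exceedance t n (q : past t -> R) : measurable_fun [set: past t] q ->
  measurable (no_exceedance t n q : set (past (t + n))).
Proof.
move=> mq; apply: fin_bigcap_measurable => // j /=; rewrite mem_iota => /andP[tj jn].
rewrite -[A in measurable A]setTI; apply: measurable_fun_le => //.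
  by apply: measurable_fun_past_X; rewrite (leq_ltn_trans _ tj)//= -ltnS -addSn.
exact: measurable_fun_past_le (leq_addr _ _) measurableT mq.
Qed.

(** The last observation is independent of the past at [t + n], which contains the event for the
    earlier ones; it contributes one factor [F (q w)], which is absorbed into the weight [Z] before
    the induction hypothesis is applied. *)
Lemma integral_no_exceedance t n (Z : past t -> \bar R) (q : past t -> R) :
  measurable_fun [set: past t] Z -> measurable_fun [set: past t] q -> (forall w, 0 <= Z w)%E ->
  (\int[P]_(w in no_exceedance t n q) Z w = \int[P]_w (Z w * (F (q w) ^+ n)%:E))%E.
Proof.
move=> mZ mq; elim: n Z mZ => [|n IH] Z mZ Z0.
  rewrite (_ : no_exceedance t 0 q = setT); last by apply/seteqP; split.
  by under [RHS]eq_integral do rewrite expr0 mule1.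
have mD := @measurable_no_exceedance t n q mq.
rewrite no_exceedanceS.
rewrite integral_mkcondl integral_past_le; last 3 first.
- apply/(measurable_restrictT _ _).1 => //.
  by apply: measurable_funTS; exact: measurable_fun_past_le (leq_addr _ _) measurableT mZ.
- exact: measurable_fun_past_le (leq_addr _ _) measurableT mq.
- by move=> w; rewrite patchE; case: ifP.
transitivity (\int[P]_(w in no_exceedance t n q) (Z w * (F (q w))%:E))%E.
  rewrite [RHS]integral_mkcond; apply: eq_integral => w _; rewrite !patchE cdfX//.
  by case: ifP; rewrite ?mul0e.
rewrite IH.
- by apply: eq_integral => w _; rewrite exprS EFinM muleA.
- apply: emeasurable_funM => //; apply/measurable_EFinP.
  exact: measurableT_comp common_cdf_measurable mq.
- by move=> w; rewrite mule_ge0// lee_fin common_cdf_ge0.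
Qed.

(** A second level [r] is allowed for the final observation because overshoot estimates ask it to
    clear more than the threshold [q]. *)
Lemma integral_first_exceedance t n (Z : past t -> \bar R) (q r : past t -> R) :
  measurable_fun [set: past t] Z -> measurable_fun [set: past t] q ->
  measurable_fun [set: past t] r -> (forall w, 0 <= Z w)%E ->
  (\int[P]_(w in no_exceedance t n q `&` [set w : Omega | (r w < X (t + n).+1 w)%R]) Z w =
   \int[P]_w (Z w * (F (q w) ^+ n * (1 - F (r w)))%R%:E))%E.
Proof.
move=> mZ mq mr Z0; have mD := @measurable_no_exceedance t n q mq.
rewrite integral_mkcondl.
have -> := @integral_past_gt (t + n) (Z \_ (no_exceedance t n q)) r; last 3 first.
- apply/(measurable_restrictT _ _).1 => //.
  by apply: measurable_funTS; exact: measurable_fun_past_le (leq_addr _ _) measurableT mZ.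
- exact: measurable_fun_past_le (leq_addr _ _) measurableT mr.
- by move=> w; rewrite patchE; case: ifP.
transitivity (\int[P]_(w in no_exceedance t n q) (Z w * (1 - F (r w))%R%:E))%E.
  rewrite [RHS]integral_mkcond; apply: eq_integral => w _; rewrite !patchE cdfX// EFinB.
  by case: ifP; rewrite ?mul0e.
rewrite integral_no_exceedance//.
- by apply: eq_integral => w _; rewrite -muleA -EFinM mulrC.
- apply: emeasurable_funM => //; apply/measurable_EFinP; apply: measurable_funB => //.
  exact: measurableT_comp common_cdf_measurable mr.
- by move=> w; rewrite mule_ge0// lee_fin subr_ge0 common_cdf_le1.
Qed.

End iterate.
End filtration.

(** * Retention times and gaps *)

Lemma measurable_set_ltr d (T : measurableType d) (R : realType) (f g : T -> R) :
  measurable_fun setT f -> measurable_fun setT g -> measurable [set x | f x < g x].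
Proof.
move=> mf mg; rewrite (_ : [set x | _] = ~` [set x | g x <= f x]).
  by apply: measurableC; rewrite -[A in measurable A]setTI; exact: measurable_fun_le.
by apply/seteqP; split=> x /=; [rewrite ltNge => /negP|move/negP; rewrite -ltNge].
Qed.

Lemma first_afterP (t : nat) (p : pred nat) :
  [/\ (t < first_after t p)%N, p (first_after t p) &
      forall j, (t < j < first_after t p)%N -> ~~ p j] \/
  (first_after t p = 0%N /\ forall j, (t < j)%N -> ~~ p j).
Proof.
rewrite /first_after; case: pselect => [h|h].
  left; case: ex_minnP => m /andP[tm pm] hm; split=> // j /andP[tj jm].
  apply/negP => pj; have := hm j; rewrite tj pj => /(_ isT).
  by rewrite leqNgt jm.
right; split=> // j tj; apply/negP => pj; apply: h; exists j.
by rewrite tj.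
Qed.

Lemma first_after_eq (t i : nat) (p : pred nat) : (t < i)%N ->
  first_after t p = i <-> p i /\ forall j, (t < j < i)%N -> ~~ p j.
Proof.
move=> ti; case: (first_afterP t p) => [[tm pm hm]|[-> np]].
  split=> [<-//|[pi hi]]; apply/eqP; rewrite eqn_leq leqNgt [X in _ && X]leqNgt.
  apply/andP; split; apply/negP => lt.
    by have := hm i; rewrite ti lt pi => /(_ isT).
  by have := hi (first_after t p); rewrite tm lt pm => /(_ isT).
split=> [i0|[pi _]]; first by rewrite -i0 in ti.
by have := np i ti; rewrite pi.
Qed.

Lemma first_after_eq0 (t : nat) (p : pred nat) :
  first_after t p = 0%N <-> forall j, (t < j)%N -> ~~ p j.
Proof.
case: (first_afterP t p) => [[tm pm hm]|[-> np]]; split=> // h.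
  by rewrite h in tm.
by have := h _ tm; rewrite pm.
Qed.

Section retention.
Context (R : realType) (d : measure_display) (Omega : measurableType d)
  (P : probability Omega R) (X : nat -> {RV P >-> R}) (beta : R).

Local Notation past t := (g_sigma_algebraType (past_cylinders X t)).
Local Notation path w := (fun i => X i w).

(** The pieces of the partition by retention history: on each of them all retention times so far are
    deterministic. *)
Definition kept k (s : seq nat) : set Omega :=
  [set w | retention_times beta (path w) k = s].

(** For fixed [s] this depends on finitely many given observations; it is the threshold of the
    selection rule only on the history event of [s]. *)
Definition threshold (s : seq nat) (w : Omega) : R := beta * mean [seq X j w | j <- s].

(* Fails exactly when some [first_after] has returned its junk value. *)
Definition proper (s : seq nat) := sorted gtn (rcons s 0%N).

Lemma size_retention_times (x : nat -> R) k : size (retention_times beta x k) = k.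
Proof. by elim: k => //= k ->. Qed.

Lemma retention_times_drop (x : nat -> R) i k : (i <= k)%N ->
  retention_times beta x i = drop (k - i) (retention_times beta x k).
Proof.
elim: k => [|k IH]; first by rewrite leqn0 => /eqP ->.
rewrite leq_eqVlt => /predU1P[->|]; first by rewrite subnn drop0.
by rewrite ltnS => ik; rewrite subSn//= -IH.
Qed.

Lemma proper_le s j : proper s -> j \in s -> (0 < j <= head 0 s)%N.
Proof.
rewrite /proper; case: s => //= t s.
rewrite (path_sortedE (rev_trans ltn_trans)) => /andP[+ ss].
rewrite all_rcons => /andP[/= t0 ts]; rewrite inE => /predU1P[->|js].
  by rewrite t0 leqnn.
rewrite (ltnW (allP ts _ js)) andbT.
move: ss; elim: s js {ts} => //= a s IH; rewrite inE => /predU1P[->|js].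
  by rewrite (path_sortedE (rev_trans ltn_trans)) all_rcons => /andP[/andP[]].
by move/path_sorted; exact: IH.
Qed.

Lemma properS i t s : proper [:: i, t & s] = (t < i)%N && proper (t :: s).
Proof. by []. Qed.

Lemma kept0 s : kept 0 s = if s == [::] then setT else set0.
Proof. by case: s => [|a s]; apply/seteqP; split. Qed.

Lemma kept_size k s : size s != k -> kept k s = set0.
Proof.
move=> sk; apply/seteqP; split=> // w /= h; move: sk.
by rewrite -h size_retention_times eqxx.
Qed.

Lemma kept1 i : kept 1 [:: i] = if i == 1%N then setT else set0.
Proof.
case: eqP => [->|i1]; apply/seteqP; split=> w //=; rewrite /kept /=.
by case=> h; apply: i1.
Qed.

Lemma keptS k i t s : kept k.+1 [:: i, t & s] = kept k (t :: s) `&`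
  [set w | first_after t (fun j => threshold (t :: s) w < X j w) = i].
Proof.
apply/seteqP; split=> w; rewrite /kept /threshold /=.
  by case=> <- hs; rewrite hs.
by case=> -> /= ->.
Qed.

(** For [t < i] the condition on [first_after] involves no observation beyond [i]: the [i - t - 1]
    observations strictly between stay below the threshold, and [X i] exceeds it. *)
Lemma kept_next k i t s : (t < i)%N -> kept k.+1 [:: i, t & s] = kept k (t :: s) `&`
  (no_exceedance X t (i - t).-1 (threshold (t :: s)) `&`
   [set w | threshold (t :: s) w < X i w]).
Proof.
move=> ti; rewrite keptS; congr (_ `&` _); rewrite no_exceedanceE.
have tiE : (t + (i - t).-1)%N = i.-1 by rewrite -subn1 addnBA ?subn_gt0// subnKC ?subn1// ltnW.
have i0 : (0 < i)%N by exact: leq_ltn_trans ti.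
apply/seteqP; split=> w; rewrite /= tiE.
  move=> /(first_after_eq _ ti)[h1 h2]; split=> // j /andP[tj ji].
  by rewrite leNgt h2// tj -(prednK i0) ltnS.
move=> [h1 h2]; apply/(first_after_eq _ ti); split=> // j /andP[tj ji].
by rewrite -leNgt h1// tj -ltnS prednK.
Qed.

Lemma measurable_threshold t s : {in s, forall j, (0 < j <= t)%N} ->
  measurable_fun [set: past t] (threshold s : past t -> R).
Proof.
move=> hs; apply: measurable_funM => //; apply: measurable_funM => //; last first.
  by rewrite (_ : (fun _ => _) = cst (size s)%:R^-1)//; apply/funext => w /=; rewrite size_map.
elim: s hs => [|a s IH] hs.
  by rewrite (_ : (fun _ => _) = cst 0)//; apply/funext => w /=; rewrite big_nil.
rewrite (_ : (fun _ => _) = (fun w : past t => X a w + \sum_(y <- [seq X j w | j <- s]) y)).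
  apply: measurable_funD.
    by apply: measurable_fun_past_X; apply: hs; rewrite mem_head.
  by apply: IH => j js; apply: hs; rewrite inE js orbT.
by apply/funext => w /=; rewrite big_cons.
Qed.

Lemma measurable_threshold_proper t s : proper (t :: s) ->
  measurable_fun [set: past t] (threshold (t :: s) : past t -> R).
Proof.
move=> ps; apply: measurable_threshold => j js; exact: (proper_le ps js).
Qed.

(** A proper history is decided by the observations up to its latest time. This breaks down for
    improper lists, since returning the junk time 0 is an event about the whole future. *)
Lemma measurable_kept_proper k s : proper s -> measurable (kept k s : set (past (head 0%N s))).
Proof.
elim: k s => [|k IH] s ps; first by rewrite kept0; case: ifP.
case: s ps => [|i [|t s]] ps; first by rewrite kept_size.
  case: k {IH} => [|k]; last by rewrite kept_size.
  by rewrite kept1; case: ifP.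
move: ps; rewrite properS => /andP[ti ps].
have mthr := measurable_threshold_proper ps.
have tiE : (t + (i - t).-1)%N = i.-1 by rewrite -subn1 addnBA ?subn_gt0// subnKC ?subn1// ltnW.
rewrite kept_next//; apply: measurableI.
  by apply: (measurable_past_le (ltnW ti)); exact: (IH (t :: s) ps).
apply: measurableI.
  apply: (@measurable_past_le _ _ _ _ _ (t + (i - t).-1)); first by rewrite tiE leq_pred.
  exact: measurable_no_exceedance.
apply: measurable_set_ltr.
  exact: measurable_fun_past_le (ltnW ti) measurableT mthr.
by apply: measurable_fun_past_X; rewrite leqnn (leq_ltn_trans _ ti).
Qed.

Lemma measurable_threshold_ambient s : measurable_fun [set: Omega] (threshold s).
Proof.
apply: measurable_funM => //; apply: measurable_funM => //; last first.
  by rewrite (_ : (fun _ => _) = cst (size s)%:R^-1)//; apply/funext => w /=; rewrite size_map.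
elim: s => [|a s IH].
  by rewrite (_ : (fun _ => _) = cst 0)//; apply/funext => w /=; rewrite big_nil.
rewrite (_ : (fun _ => _) = (fun w => X a w + \sum_(y <- [seq X j w | j <- s]) y)).
  by apply: measurable_funD.
by apply/funext => w /=; rewrite big_cons.
Qed.

Lemma measurable_exceed s j : measurable [set w | threshold s w < X j w].
Proof. by apply: measurable_set_ltr => //; exact: measurable_threshold_ambient. Qed.

Lemma measurable_no_exceed s t i :
  measurable [set w | forall j, (t < j < i)%N -> ~~ (threshold s w < X j w)].
Proof.
rewrite (_ : [set w | _] = \bigcap_(j in [set j | (t < j < i)%N]) ~` [set w | threshold s w < X j w]).
  by apply: bigcap_measurableType => j _; exact/measurableC/measurable_exceed.
by apply/seteqP; split=> w h j /h /= /negP.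
Qed.

Lemma measurable_never_exceed s t :
  measurable [set w | forall j, (t < j)%N -> ~~ (threshold s w < X j w)].
Proof.
rewrite (_ : [set w | _] = \bigcap_(j in [set j | (t < j)%N]) ~` [set w | threshold s w < X j w]).
  by apply: bigcap_measurableType => j _; exact/measurableC/measurable_exceed.
by apply/seteqP; split=> w h j /h /= /negP.
Qed.

(** Improper lists are covered too: the junk time 0 is a countable intersection of non-exceedances,
    and a nonzero time not beyond [t] is impossible. *)
Lemma measurable_kept k s : measurable (kept k s).
Proof.
elim: k s => [|k IH] s; first by rewrite kept0; case: ifP.
case: s => [|i [|t s]]; first by rewrite kept_size.
  case: k {IH} => [|k]; last by rewrite kept_size.
  by rewrite kept1; case: ifP.
rewrite keptS; apply: measurableI; first exact: IH.
have [ti|it] := ltnP t i.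
  rewrite (_ : [set w | _] = [set w | threshold (t :: s) w < X i w] `&`
    [set w | forall j, (t < j < i)%N -> ~~ (threshold (t :: s) w < X j w)]).
    by apply: measurableI; [exact: measurable_exceed|exact: measurable_no_exceed].
  by apply/seteqP; split=> w /=; move/(first_after_eq _ ti).
have [->|i0] := eqVneq i 0%N.
  rewrite (_ : [set w | _] = [set w | forall j, (t < j)%N -> ~~ (threshold (t :: s) w < X j w)]).
    exact: measurable_never_exceed.
  by apply/seteqP; split=> w /=; move/(first_after_eq0 _ _).
rewrite (_ : [set w | _] = set0)//; apply/seteqP; split=> // w /= hi.
case: (first_afterP t (fun j => threshold (t :: s) w < X j w)).
  by rewrite hi => -[]; rewrite ltnNge it.
by rewrite hi => -[/eqP]; rewrite (negbTE i0).
Qed.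

End retention.

Section gaps.
Context (R : realType) (d : measure_display) (Omega : measurableType d)
  (P : probability Omega R) (X : nat -> {RV P >-> R}) (beta : R) (F : R -> R).

Local Notation past t := (g_sigma_algebraType (past_cylinders X t)).
Local Notation path w := (fun i => X i w).
Local Notation kept := (kept X beta).
Local Notation threshold := (threshold X beta).

Hypothesis indepX : mutually_independent (fun i => X i.+1).
Hypothesis cdfX : forall (i : nat) x, (0 < i)%N -> cdf (X i) x = (F x)%:E.
Hypothesis F_lt1 : forall x, F x < 1.

(** The countable partition by histories of length [k], numbered through [pickle]; numbers that
    encode no list give the empty set. *)
Definition kept_nth k n : set Omega := if pickle_inv n is Some s then kept k s else set0.

Lemma measurable_kept_nth k n : measurable (kept_nth k n).
Proof. by rewrite /kept_nth; case: pickle_inv => // s; exact: measurable_kept. Qed.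

Lemma bigcup_kept_nth k : \bigcup_n kept_nth k n = setT.
Proof.
apply/seteqP; split=> // w _; exists (pickle (retention_times beta (path w) k)) => //.
by rewrite /kept_nth pickleK_inv.
Qed.

Lemma trivIset_kept_nth k : trivIset setT (kept_nth k).
Proof.
move=> m n _ _ [w []]; rewrite /kept_nth.
case em: (pickle_inv m) => [s|]//; case en: (pickle_inv n) => [s'|]// ks ks'.
have ss' : s = s' by rewrite -ks -ks'.
have := @pickle_invK (seq nat) m; have := @pickle_invK (seq nat) n.
by rewrite em en /= ss' => <- <-.
Qed.

Lemma measurable_fun_kept d' (T : measurableType d') k (f : Omega -> T) :
  (forall s, measurable_fun (kept k s) f) -> measurable_fun setT f.
Proof.
move=> mf; rewrite -(bigcup_kept_nth k); apply/measurable_fun_bigcup.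
  exact: measurable_kept_nth.
move=> n; rewrite /kept_nth; case: pickle_inv => // _.
exact: measurable_fun_set0.
Qed.

Lemma integral_kept_nth k (f : Omega -> \bar R) :
  measurable_fun setT f -> (forall w, 0 <= f w)%E ->
  (\int[P]_w f w = \sum_(n <oo) \int[P]_(w in kept_nth k n) f w)%E.
Proof.
move=> mf f0; rewrite -{1}(bigcup_kept_nth k) ge0_integral_bigcup//.
- exact: measurable_kept_nth.
- by rewrite bigcup_kept_nth.
- exact: trivIset_kept_nth.
Qed.

Lemma integral_kept_no_exceedance k t s n (Z : Omega -> R) : proper (t :: s) ->
  measurable_fun (kept k (t :: s) : set (past t)) (Z : past t -> R) ->
  (forall w, 0 <= Z w) ->
  (\int[P]_(w in kept k (t :: s) `&` no_exceedance X t n (threshold (t :: s))) (Z w)%:E =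
   \int[P]_(w in kept k (t :: s)) (Z w * F (threshold (t :: s) w) ^+ n)%:E)%E.
Proof.
move=> ps mZ Z0; have mA : measurable (kept k (t :: s) : set (past t)) by exact: (measurable_kept_proper _ _ ps).
(* [Z] is measurable only on the history event; extending it by 0 gives a weight known at time
   [t]. *)
have mZ' : measurable_fun [set: past t] ((EFin \o Z) \_ (kept k (t :: s)) : past t -> \bar R).
  by apply/(measurable_restrictT _ _).1 => //; exact/measurable_EFinP.
rewrite integral_mkcondl (integral_no_exceedance indepX cdfX)//; last 2 first.
- exact: measurable_threshold_proper.
- by move=> w; rewrite patchE; case: ifP; rewrite ?lee_fin.
rewrite [RHS]integral_mkcond; apply: eq_integral => w _; rewrite !patchE.
by case: ifP; rewrite ?mul0e.
Qed.

(** For every [n] the probability is at most the integral of the [n]-th power of [F] at the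
    threshold, and this tends to 0 because [F] stays below 1. *)
Lemma never_exceed_null k t s : proper (t :: s) ->
  P (kept k (t :: s) `&`
     [set w | forall j, (t < j)%N -> ~~ (threshold (t :: s) w < X j w)]) = 0%E.
Proof.
move=> ps; set N := _ `&` _.
have mthr : measurable_fun setT (threshold (t :: s)) by exact: measurable_threshold_ambient.
have mF := common_cdf_measurable cdfX.
have mA : measurable (kept k (t :: s)) by exact: measurable_kept.
have mN : measurable N by apply: measurableI => //; exact: measurable_never_exceed.
pose f_ n w := \1_(kept k (t :: s)) w * F (threshold (t :: s) w) ^+ n.
have PN n : (P N <= \int[P]_w (f_ n w)%:E)%E.
  rewrite (_ : (\int[P]_w (f_ n w)%:E)%E =
    (\int[P]_(w in kept k (t :: s)) (1 * F (threshold (t :: s) w) ^+ n)%:E)%E); last first.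
    rewrite [RHS]integral_mkcond; apply: eq_integral => w _; rewrite patchE /f_ indicE.
    by case: ifP; rewrite ?mul0r.
  rewrite -(@integral_kept_no_exceedance _ _ _ _ (cst 1))//.
  set B := _ `&` no_exceedance _ _ _ _.
  have mB : measurable B.
    apply: measurableI => //; apply: past_measurable; apply: measurable_no_exceedance.
    exact: measurable_threshold_proper.
  have -> : (\int[P]_(w in B) (cst 1 w)%:E = P B)%E.
    by rewrite -[RHS]mul1e -integral_cst.
  apply: le_measure; rewrite ?inE//.
  apply: setIS; rewrite no_exceedanceE => w h j /andP[tj _].
  by rewrite leNgt; exact: h.
have : (\int[P]_w (f_ n w)%:E)%E @[n --> \oo] --> (\int[P]_w (cst 0 w)%:E)%E.
  apply: (@bounded_convergence _ _ _ _ _ _ 1) => //.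
  - move=> n; apply: measurable_funM; first exact: measurable_indic.
    by apply: measurable_funX; exact: measurableT_comp mthr.
  - apply: aeW => w; rewrite /f_ /=.
    rewrite -[X in _ --> X](mulr0 (\1_(kept k (t :: s)) w)); apply: cvgM; first exact: cvg_cst.
    by apply: cvg_expr; rewrite ger0_norm ?F_lt1// (common_cdf_ge0 cdfX).
  - move=> n w; rewrite normrM mulr_ile1//; first by rewrite indicE; case: (_ \in _); rewrite ?normr1 ?normr0.
    by rewrite normrX exprn_ile1// ger0_norm ?(ltW (F_lt1 _))// (common_cdf_ge0 cdfX).
rewrite (_ : (\int[P]_w (cst 0 w)%:E)%E = 0%E); last by rewrite integral0.
move=> h; apply/eqP; rewrite eq_le measure_ge0 andbT.
by apply: (@cvge_ge _ _ _ _ _ _ _ _ h); exact: nearW.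
Qed.

(** Either the earlier history is already improper, or the newest time fails to increase, which
    forces the junk value and hence a null event of never exceeding. *)
Lemma kept_improper_null k s : ~~ proper s -> P (kept k s) = 0%E.
Proof.
elim: k s => [|k IH] s ps; first by rewrite kept0; case: eqP ps => [->|]// _ _; exact: measure0.
case: s ps => [//|i [|t s]] ps.
  case: k {IH} => [|k]; last by rewrite kept_size// measure0.
  by rewrite kept1; case: eqP ps => [->|]// _ _; exact: measure0.
have sub : kept k.+1 [:: i, t & s] `<=` kept k (t :: s) by rewrite keptS => w [].
have null (N : set Omega) : measurable N -> P N = 0%E -> kept k.+1 [:: i, t & s] `<=` N -> P (kept k.+1 [:: i, t & s]) = 0%E.
  move=> mN N0 sN; apply/eqP; rewrite eq_le measure_ge0 andbT -N0.
  by apply: le_measure; rewrite ?inE//; exact: measurable_kept.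
have [pts|npts] := boolP (proper (t :: s)); last first.
  by apply: (null (kept k (t :: s))) => //; [exact: measurable_kept|exact: IH].
move: ps; rewrite properS pts andbT -leqNgt => it.
apply: null (never_exceed_null k pts) _.
  by apply: measurableI; [exact: measurable_kept|exact: measurable_never_exceed].
rewrite keptS; apply: setIS => w /=.
case: (first_afterP t (fun j => threshold (t :: s) w < X j w)) => [[h1 _ _] h2|[_ //]].
by move: h1; rewrite h2 ltnNge it.
Qed.

(** Reduces a comparison of integrals to one history at a time; improper histories are null and drop
    out. *)
Lemma le_integral_kept k (f g : Omega -> \bar R) :
  measurable_fun setT f -> measurable_fun setT g ->
  (forall w, 0 <= f w)%E -> (forall w, 0 <= g w)%E ->
  (forall s, proper s -> size s = k ->
     \int[P]_(w in kept k s) f w <= \int[P]_(w in kept k s) g w)%E ->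
  (\int[P]_w f w <= \int[P]_w g w)%E.
Proof.
move=> mf mg f0 g0 fg; rewrite (integral_kept_nth k mf)// (integral_kept_nth k mg)//.
apply: lee_nneseries => [n _ _|n _]; first exact: integral_ge0.
rewrite /kept_nth; case: pickle_inv => [s|]; last by rewrite !integral_set0.
have [ps|nps] := boolP (proper s).
  have [/fg|/kept_size ->] := eqVneq (size s) k; first exact.
  by rewrite !integral_set0.
by rewrite !null_set_integral//; try exact: measurable_kept; try exact: measurable_funTS;
  exact: kept_improper_null.
Qed.

Lemma eq_integral_kept k (f g : Omega -> \bar R) :
  measurable_fun setT f -> measurable_fun setT g ->
  (forall w, 0 <= f w)%E -> (forall w, 0 <= g w)%E ->
  (forall s, proper s -> size s = k ->
     \int[P]_(w in kept k s) f w = \int[P]_(w in kept k s) g w)%E ->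
  (\int[P]_w f w = \int[P]_w g w)%E.
Proof.
move=> mf mg f0 g0 fg; apply/eqP; rewrite eq_le.
by apply/andP; split; apply: (@le_integral_kept k) => // s ps sk; rewrite fg.
Qed.

End gaps.

Lemma nneseries_geometric (R : realType) (z x : R) : 0 <= x < 1 ->
  (\sum_(n <oo) (z * x ^+ n)%:E)%E = (z / (1 - x))%:E.
Proof.
move=> /andP[x0 x1]; apply/cvg_lim => //.
under eq_fun do rewrite sumEFin.
apply: cvg_EFin; first exact: nearW.
have := @cvg_geometric_series R z x; rewrite ger0_norm// => /(_ x1).
by [].
Qed.

Lemma nneseries_lt (R : realType) (h : nat -> R) (g : nat) : (forall n, 0 <= h n) ->
  (\sum_(n <oo) (h n * (n < g)%N%:R)%:E)%E = (\sum_(0 <= n < g) h n)%:E.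
Proof.
move=> h0; rewrite (nneseries_split 0%N g); last first.
  by move=> k _; rewrite lee_fin mulr_ge0.
rewrite add0n eseries0 ?adde0 ?sumEFin.
  by congr (_%:E); apply: eq_big_nat => n /andP[_ ->]; rewrite mulr1.
by move=> i gi _; rewrite ltnNge gi mulr0.
Qed.

(** * Conditional law of the gaps and of the overshoot *)

Section gap_laws.
Context (R : realType) (d : measure_display) (Omega : measurableType d)
  (P : probability Omega R) (X : nat -> {RV P >-> R}) (beta : R) (F : R -> R).

Local Notation past t := (g_sigma_algebraType (past_cylinders X t)).
Local Notation path w := (fun i => X i w).
Local Notation kept := (kept X beta).
Local Notation threshold := (threshold X beta).
Local Notation T k w := (T_ beta (path w) k).
Local Notation Yb k w := (Ybar beta (path w) k).

Hypothesis indepX : mutually_independent (fun i => X i.+1).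
Hypothesis cdfX : forall (i : nat) x, (0 < i)%N -> cdf (X i) x = (F x)%:E.
Hypothesis F_lt1 : forall x, F x < 1.

Let F_ge0 x : 0 <= F x. Proof. exact: common_cdf_ge0 cdfX x. Qed.
Let mF : measurable_fun setT F. Proof. exact: common_cdf_measurable cdfX. Qed.

(** The subtraction is truncated: where nothing exceeds the threshold again, the next time is 0 and
    so is the gap. *)
Definition gap k w : nat := (T k.+1 w - T k w)%N.

(** Stands for measurability with respect to the observations up to the stopping time [T_k], stated
    history by history. Measurability on the whole space is a separate clause since improper
    histories are not constrained by the second one. *)
Definition adapted k (Z : Omega -> R) := measurable_fun [set: Omega] Z /\
  forall t s, proper (t :: s) -> size s = k.-1 ->
    measurable_fun (kept k (t :: s) : set (past t)) (Z : past t -> R).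

Lemma adapted_cst k c : adapted k (cst c).
Proof. by split. Qed.

Lemma adapted_comp k (f : R -> R) Z : measurable_fun setT f ->
  adapted k Z -> adapted k (fun w => f (Z w)).
Proof.
move=> mf [mZ aZ]; split=> [|t s ps sk]; first exact: measurableT_comp.
by apply: measurableT_comp => //; exact: aZ.
Qed.

Lemma adaptedM k Z Z' : adapted k Z -> adapted k Z' -> adapted k (fun w => Z w * Z' w).
Proof.
move=> [mZ aZ] [mZ' aZ']; split=> [|t s ps sk]; first exact: measurable_funM.
by apply: measurable_funM; [exact: aZ|exact: aZ'].
Qed.

Lemma adaptedB k Z Z' : adapted k Z -> adapted k Z' -> adapted k (fun w => Z w - Z' w).
Proof.
move=> [mZ aZ] [mZ' aZ']; split=> [|t s ps sk]; first exact: measurable_funB.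
by apply: measurable_funB; [exact: aZ|exact: aZ'].
Qed.

Lemma keptE k s w : kept k s w -> retention_times beta (path w) k = s.
Proof. by []. Qed.

Lemma kept_T k s w i : (i <= k)%N -> kept k s w -> T i w = head 0%N (drop (k - i) s).
Proof. by move=> ik ks; rewrite /T_ (retention_times_drop _ _ ik) (keptE ks). Qed.

Lemma kept_threshold k s w i : (i <= k)%N -> kept k s w -> beta * Yb i w = threshold (drop (k - i) s) w.
Proof. by move=> ik ks; rewrite /Ybar (retention_times_drop _ _ ik) (keptE ks). Qed.

Lemma measurable_T k : measurable_fun setT (fun w => T k w).
Proof.
apply: (@measurable_fun_kept _ _ _ P X beta _ _ k) => s.
apply: (eq_measurable_fun (cst (head 0%N s))) => // w; rewrite inE => ks.
by rewrite (kept_T (leqnn k) ks) subnn drop0.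
Qed.

Lemma measurable_betaYb k : measurable_fun setT (fun w => beta * Yb k w).
Proof.
apply: (@measurable_fun_kept _ _ _ P X beta _ _ k) => s.
apply: (eq_measurable_fun (threshold s)) => // [w|]; last first.
  by apply: measurable_funTS; exact: measurable_threshold_ambient.
by rewrite inE => ks; rewrite (kept_threshold (leqnn k) ks) subnn drop0.
Qed.

Lemma proper_drop n s : proper s -> proper (drop n s).
Proof.
rewrite /proper => ps; have [ns|sn] := leqP n (size s); last by rewrite drop_oversize // ltnW.
have := drop_sorted n ps; rewrite drop_rcons//.
Qed.

Lemma proper_head_drop n s : proper s -> (head 0 (drop n s) <= head 0 s)%N.
Proof.
move=> ps; have [ns|sn] := ltnP n (size s); last by rewrite drop_oversize.
have : head 0%N (drop n s) \in s.
  by apply: (mem_drop (n0 := n)); rewrite (drop_nth 0%N ns) mem_head.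
by move/(proper_le ps)/andP => [].
Qed.

Lemma adapted_T k i : (i <= k)%N -> adapted k (fun w => (T i w)%:R).
Proof.
move=> ik; split.
  by apply: (measurableT_comp (f := fun n : nat => n%:R : R)); [|exact: measurable_T].
move=> t s ps sk.
apply: (eq_measurable_fun (cst ((head 0%N (drop (k - i) (t :: s)))%:R : R) : past t -> R)) => // w.
by rewrite inE => ks /=; rewrite (kept_T ik ks).
Qed.

Lemma adapted_betaYb k i : (i <= k)%N -> adapted k (fun w => beta * Yb i w).
Proof.
move=> ik; split; first exact: measurable_betaYb.
move=> t s ps sk.
apply: (eq_measurable_fun (threshold (drop (k - i) (t :: s)) : past t -> R)) => [w|].
  by rewrite inE => ks /=; rewrite (kept_threshold ik ks).
apply: measurable_funTS; apply: measurable_threshold => j js.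
have := proper_le (proper_drop (k - i) ps) js => /andP[-> /= jh].
by rewrite (leq_trans jh)//; exact: proper_head_drop.
Qed.


Lemma kept_S_T k s w : kept k.+1 s w -> T k w = head 0%N (behead s).
Proof. by move=> ks; rewrite (kept_T (leqnSn k) ks) subSnn drop1. Qed.

Lemma measurable_gap k : measurable_fun setT (gap k).
Proof.
apply: (@measurable_fun_kept _ _ _ P X beta _ _ k.+1) => s.
apply: (eq_measurable_fun (cst (head 0%N s - head 0%N (behead s))%N)) => // w; rewrite inE => ks.
by rewrite /gap (kept_T (leqnn _) ks) subnn drop0 (kept_S_T ks).
Qed.

Lemma measurable_gap_gt k n : measurable_fun setT (fun w => (n < gap k w)%N%:R : R).
Proof.
exact: (measurableT_comp (f := fun m : nat => (n < m)%N%:R : R) _ (measurable_gap k)).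
Qed.

Lemma kept_next_T k t s w : kept k.+1 (t :: s) w ->
  T k.+2 w = first_after t (fun j => threshold (t :: s) w < X j w).
Proof.
move=> ks; rewrite T_S (kept_threshold (leqnn _) ks) subnn drop0.
by rewrite (kept_T (leqnn _) ks) subnn drop0.
Qed.

Definition never_exceed t s : set Omega :=
  [set w | forall j, (t < j)%N -> ~~ (threshold (t :: s) w < X j w)].

(** The event of never exceeding has to be removed: there the gap is 0, although the next [n]
    observations stay below the threshold. *)
Lemma gap_gt_no_exceedance k t s n :
  kept k.+1 (t :: s) `&` [set w | (n < gap k.+1 w)%N] =
  (kept k.+1 (t :: s) `&` no_exceedance X t n (threshold (t :: s))) `\`
  (kept k.+1 (t :: s) `&` never_exceed t s).
Proof.
apply/seteqP; split=> w.
  move=> [ks]; rewrite /= /gap (kept_next_T ks) (kept_T (leqnn _) ks) subnn drop0 /=.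
  case: (first_afterP t (fun j => threshold (t :: s) w < X j w)) => [[h1 h2 h3]|[-> _]]; last by rewrite sub0n.
  move=> ng; split.
    split=> //; rewrite no_exceedanceE => j /andP[tj jn]; rewrite leNgt; apply: h3.
    by rewrite tj /=; apply: (leq_ltn_trans jn); rewrite -ltn_subRL.
  by case=> _ /(_ _ h1); rewrite h2.
move=> [[ks hn] hN]; split=> //=.
rewrite /gap (kept_next_T ks) (kept_T (leqnn _) ks) subnn drop0 /=.
case: (first_afterP t (fun j => threshold (t :: s) w < X j w)) => [[h1 h2 h3]|[_ h]]; last first.
  by exfalso; apply: hN; split.
rewrite ltn_subRL ltnNge; apply/negP => le; move: hn; rewrite no_exceedanceE => /(_ _ _).
by move/(_ (first_after t (fun j => threshold (t :: s) w < X j w))); rewrite h1 le => /(_ isT); rewrite leNgt h2.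
Qed.

Lemma measurable_kept_no_exceedance k t s n : proper (t :: s) ->
  measurable (kept k (t :: s) `&` no_exceedance X t n (threshold (t :: s))).
Proof.
move=> ps; apply: measurableI; first exact: measurable_kept.
apply: past_measurable; apply: measurable_no_exceedance.
exact: measurable_threshold_proper.
Qed.

Lemma measurable_kept_never k t s : measurable (kept k (t :: s) `&` never_exceed t s).
Proof. by apply: measurableI; [exact: measurable_kept|exact: measurable_never_exceed]. Qed.

(** The conditional geometric tail of the gap, expressed by testing against all nonnegative adapted
    weights. *)
Lemma integral_gap_gt k n Z : adapted k.+1 Z -> (forall w, 0 <= Z w) ->
  (\int[P]_w (Z w * (n < gap k.+1 w)%N%:R)%:E =
   \int[P]_w (Z w * F (beta * Yb k.+1 w) ^+ n)%:E)%E.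
Proof.
move=> [mZ aZ] Z0; apply: (@eq_integral_kept _ _ _ P X beta F indepX cdfX F_lt1 k.+1).
- by apply/measurable_EFinP; apply: measurable_funM => //; exact: measurable_gap_gt.
- apply/measurable_EFinP; apply: measurable_funM => //; apply: measurable_funX.
  by apply: measurableT_comp => //; exact: measurable_betaYb.
- by move=> w; rewrite lee_fin mulr_ge0.
- by move=> w; rewrite lee_fin mulr_ge0// exprn_ge0.
move=> [//|t s] ps [sk].
rewrite (_ : (\int[P]_(w in _) (Z w * (n < gap k.+1 w)%N%:R)%:E)%E =
  (\int[P]_(w in kept k.+1 (t :: s) `&` [set w | (n < gap k.+1 w)%N]) (Z w)%:E)%E); last first.
  rewrite integral_mkcondr; apply: eq_integral => w _; rewrite patchE.
  case: ifPn => [/set_mem /= ->|/negP h]; first by rewrite mulr1.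
  by rewrite (_ : (n < _)%N = false) ?mulr0//; apply/negP => ?; apply: h; exact/mem_set.
rewrite gap_gt_no_exceedance -(ge0_negligible_integral (measurable_kept_never _ _ _)
  (measurable_kept_no_exceedance _ _ ps)); last 3 first.
- by apply/measurable_EFinP; exact: measurable_funTS.
- by move=> w _; rewrite lee_fin.
- exact: (never_exceed_null beta indepX cdfX F_lt1 k.+1 ps).
rewrite (integral_kept_no_exceedance indepX cdfX)//; last exact: aZ.
apply: eq_integral => w; rewrite inE => ks.
by rewrite (kept_threshold (leqnn _) ks) subnn drop0.
Qed.

(** A sum up to the random gap is a series weighted by the indicators of [n < gap], to which the
    geometric tail applies term by term. Choices of [h] yield both the mean and the transform of the
    gap. *)
Lemma integral_gap_sum k (h : nat -> Omega -> R) :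
  (forall n, adapted k.+1 (h n)) -> (forall n w, 0 <= h n w) ->
  (\int[P]_w (\sum_(0 <= n < gap k.+1 w) h n w)%:E =
   \int[P]_w (\sum_(n <oo) (h n w * F (beta * Yb k.+1 w) ^+ n)%:E))%E.
Proof.
move=> ah h0.
transitivity (\int[P]_w (\sum_(n <oo) (h n w * (n < gap k.+1 w)%N%:R)%:E))%E.
  by apply: eq_integral => w _; rewrite nneseries_lt.
rewrite integral_nneseries//; last 2 first.
- move=> n; apply/measurable_EFinP; apply: measurable_funM; first exact: (ah n).1.
  exact: measurable_gap_gt.
- by move=> n w _; rewrite lee_fin mulr_ge0.
rewrite integral_nneseries//; last 2 first.
- move=> n; apply/measurable_EFinP; apply: measurable_funM; first exact: (ah n).1.
  apply: measurable_funX.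
  by apply: measurableT_comp => //; exact: measurable_betaYb.
- by move=> n w _; rewrite lee_fin mulr_ge0// exprn_ge0.
by apply: eq_eseriesr => n _; exact: integral_gap_gt.
Qed.

Lemma integral_gap k Z : adapted k.+1 Z -> (forall w, 0 <= Z w) ->
  (\int[P]_w (Z w * (gap k.+1 w)%:R)%:E =
   \int[P]_w (Z w / (1 - F (beta * Yb k.+1 w)))%:E)%E.
Proof.
move=> aZ Z0; transitivity (\int[P]_w (\sum_(0 <= n < gap k.+1 w) Z w)%:E)%E.
  by apply: eq_integral => w _; rewrite sumr_const_nat subn0 mulr_natr.
rewrite (@integral_gap_sum k (fun=> Z))//; apply: eq_integral => w _.
by rewrite nneseries_geometric// F_ge0 F_lt1.
Qed.

(** With [q = expR (- c)], the complement [1 - q ^+ g] is the sum of [q ^+ n * (1 - q)] over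
    [n < g], a sum of nonnegative adapted terms. The argument [c] may be random because the scaling
    of the gaps is. *)
Lemma integral_gap_exp k Z c : adapted k.+1 Z -> (forall w, 0 <= Z w) ->
  adapted k.+1 c -> (forall w, 0 <= c w) ->
  (\int[P]_w (Z w * (1 - expR (- c w * (gap k.+1 w)%:R)))%:E =
   \int[P]_w (Z w * ((1 - expR (- c w)) / (1 - F (beta * Yb k.+1 w) * expR (- c w))))%:E)%E.
Proof.
move=> aZ Z0 ac c0.
pose h n w := Z w * (expR (- c w) ^+ n * (1 - expR (- c w))).
have ec1 w : expR (- c w) <= 1 by rewrite -expR0 ler_expR oppr_le0.
have ae : adapted k.+1 (fun w => expR (- c w)).
  by apply: (adapted_comp (f := fun x : R => expR (- x))) => //; apply: measurableT_comp.
transitivity (\int[P]_w (\sum_(0 <= n < gap k.+1 w) h n w)%:E)%E.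
  apply: eq_integral => w _; rewrite -mulr_sumr; congr ((_ * _)%:E).
  rewrite expRM_natr.
  elim: (gap k.+1 w) => [|n IH]; first by rewrite big_geq// expr0 subrr.
  by rewrite big_nat_recr//= -IH exprS; ring.
rewrite integral_gap_sum; last 2 first.
- move=> n; apply: adaptedM => //; apply: adaptedM.
    by apply: (adapted_comp (f := fun x : R => x ^+ n)) => //; exact: exprn_measurable.
  by apply: adaptedB => //; exact: adapted_cst.
- by move=> n w; rewrite /h !mulr_ge0// ?exprn_ge0 ?expR_ge0// subr_ge0.
apply: eq_integral => w _.
transitivity (\sum_(n <oo) ((Z w * (1 - expR (- c w))) *
    (F (beta * Yb k.+1 w) * expR (- c w)) ^+ n)%:E)%E.
  by apply: eq_eseriesr => n _; rewrite /h exprMn; congr (_%:E); ring.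
rewrite nneseries_geometric; first by rewrite -mulrA.
apply/andP; split; first by rewrite mulr_ge0 ?expR_ge0.
apply: (le_lt_trans _ (F_lt1 (beta * Yb k.+1 w))).
by rewrite ler_piMr.
Qed.

Lemma measurable_next k : measurable_fun setT (fun w => X (T k w) w).
Proof.
apply: (@measurable_fun_kept _ _ _ P X beta _ _ k) => s.
apply: (eq_measurable_fun (X (head 0%N s))) => // [w|]; last exact: measurable_funTS.
by rewrite inE => ks; rewrite (kept_T (leqnn _) ks) subnn drop0.
Qed.

(** Split by the number [n] of rejected observations before the next retained one: each case weighs
    at most [e] times a geometric probability, and these sum to 1 on every history. *)
Lemma overshoot k (r : Omega -> R) (e : R) : adapted k.+1 r -> 0 <= e ->
  (forall w, 1 - F (r w) <= e * (1 - F (beta * Yb k.+1 w))) ->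
  (P [set w | (r w < X (T k.+2 w) w)%R] <= e%:E)%E.
Proof.
move=> [mr ar] e0 re; set E := [set w | _].
have mE : measurable E by apply: measurable_set_ltr => //; exact: measurable_next.
have <- : (\int[P]_w (\1_E w)%:E)%E = P E by rewrite integral_indic// setIT.
have <- : (\int[P]_w (cst e%:E w))%E = e%:E.
  rewrite integral_cst// [X in (_ * X)%E](_ : _ = 1%E) ?mule1//; exact: probability_setT.
apply: (@le_integral_kept _ _ _ P X beta F indepX cdfX F_lt1 k.+1) => //.
  by apply/measurable_EFinP; exact: measurable_indic.
move=> [//|t s] ps [sk].
set K := kept k.+1 (t :: s); set thr := threshold (t :: s).
have mK : measurable K by exact: measurable_kept.
have mK' : measurable (K : set (past t)) by exact: (measurable_kept_proper beta k.+1 ps).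
rewrite integral_indic// integral_cst//.
set N := K `&` never_exceed t s.
have mN : measurable N by exact: measurable_kept_never.
have mEK : measurable (E `&` K) by exact: measurableI.
rewrite (measureDI P mEK mN) [X in (_ + X)%E](_ : _ = 0%E) ?adde0; last first.
  apply: (subset_measure0 _ mN); [exact: measurableI|exact: subIsetr|].
  exact: (never_exceed_null beta indepX cdfX F_lt1 k.+1 ps).
(* An adapted [r] is known at time [t] only on the history event, so it is set to 0 elsewhere. *)
pose r' : Omega -> R := r \_ K.
have mr' : measurable_fun [set: past t] (r' : past t -> R).
  by apply/(measurable_restrictT _ _).1 => //; exact: ar.
have mthr : measurable_fun [set: past t] (thr : past t -> R).
  exact: measurable_threshold_proper.
have mthr' : measurable_fun [set: Omega] thr by exact: measurable_threshold_ambient.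
(* Outside the null event, the next retained observation sits at some [t + n + 1]; the sets [B n]
   therefore cover the event to be bounded. *)
pose B n := K `&` (no_exceedance X t n thr `&` [set w | r' w < X (t + n).+1 w]).
have mr'' : measurable_fun [set: Omega] r' by exact: measurable_fun_past mr'.
have mB0 n : measurable (no_exceedance X t n thr `&` [set w | r' w < X (t + n).+1 w]).
  apply: measurableI; first by apply: past_measurable; exact: measurable_no_exceedance.
  exact: measurable_set_ltr.
have mB n : measurable (B n) by exact: measurableI.
have PB n : (P (B n) <= \int[P]_w ((e * \1_K w * (1 - F (thr w))) * F (thr w) ^+ n)%:E)%E.
  rewrite /B -[X in (P X <= _)%E]/(K `&` _) -integral_indic//.
  rewrite (@integral_first_exceedance _ _ _ _ _ indepX F cdfX t n (fun w => (\1_K w)%:E) thr r')//.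
    apply: ge0_le_integral => //.
    - by move=> w _; rewrite -EFinM lee_fin !mulr_ge0// ?exprn_ge0// subr_ge0 ltW.
    - apply: emeasurable_funM; first by apply/measurable_EFinP; exact: measurable_indic.
      apply/measurable_EFinP; apply: measurable_funM.
        by apply: measurable_funX; exact: measurableT_comp mthr'.
      by apply: measurable_funB => //; exact: measurableT_comp mr''.
    - apply/measurable_EFinP; apply: measurable_funM.
        apply: measurable_funM; first by apply: measurable_funM => //; exact: measurable_indic.
        by apply: measurable_funB => //; exact: measurableT_comp mthr'.
      by apply: measurable_funX; exact: measurableT_comp mthr'.
    move=> w _; rewrite -EFinM lee_fin indicE; case: (boolP (w \in K)) => wK; last by rewrite !(mul0r,mulr0).
    rewrite mul1r mulr1 mulrC ler_wpM2r ?exprn_ge0// /r' patchE wK.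
    by move: wK (re w); rewrite inE => wK; rewrite (kept_threshold (leqnn _) wK) subnn drop0.
  by apply/measurable_EFinP; exact: measurable_indic.
apply: (@le_trans _ _ (\sum_(n <oo) P (B n))%E).
  apply: measure_sigma_subadditive => //; first exact: measurableD.
  move=> w [[Ew Kw] nN].
  have := kept_next_T Kw.
  case: (first_afterP t (fun j => threshold (t :: s) w < X j w)) => [[h1 h2 h3]|[_ h]]; last first.
    by exfalso; apply: nN; split.
  set m := first_after _ _ in h1 h2 h3 *; move=> Tm.
  have tm : ((t + (m - t).-1).+1 = m)%N by rewrite -addnS prednK ?subn_gt0// subnKC// ltnW.
  exists (m - t).-1 => //; split=> //; split.
    rewrite no_exceedanceE => j /andP[tj jm]; rewrite leNgt; apply: h3.
    by rewrite tj -tm ltnS.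
  by rewrite /= tm /r' patchE mem_set//; move: Ew; rewrite /E /= Tm.
apply: (@le_trans _ _ (\sum_(n <oo) \int[P]_w ((e * \1_K w * (1 - F (thr w))) * F (thr w) ^+ n)%:E)%E).
  by apply: lee_nneseries => n _.
rewrite -integral_nneseries//; last 2 first.
- move=> n; apply/measurable_EFinP; apply: measurable_funM.
    apply: measurable_funM; first by apply: measurable_funM => //; exact: measurable_indic.
    by apply: measurable_funB => //; exact: measurableT_comp mthr'.
  by apply: measurable_funX; exact: measurableT_comp mthr'.
- by move=> n w _; rewrite lee_fin !mulr_ge0// ?exprn_ge0// subr_ge0 ltW.
rewrite (_ : (\int[P]_w _)%E = (\int[P]_w (e%:E * (\1_K w)%:E))%E).
  by rewrite ge0_integralZl_EFin// ?integral_indic ?setIT//; apply/measurable_EFinP; exact: measurable_indic.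
apply: eq_integral => w _; rewrite nneseries_geometric ?F_ge0 ?F_lt1//.
by rewrite mulfK ?EFinM// gt_eqF// subr_gt0.
Qed.

End gap_laws.

(** * Growth of the mean *)

Lemma gt0_powRE (R : realType) (x p : R) : 0 < x -> x `^ p = expR (p * ln x).
Proof. by move=> x0; rewrite /powR gt_eqF. Qed.

Lemma ln1Dx_ge (R : realType) (x : R) : 0 <= x -> x / (1 + x) <= ln (1 + x).
Proof.
move=> x0; have x1 : 0 < 1 + x by lra.
rewrite -lerN2 -lnV ?posrE//.
have -> : ln (1 + x)^-1 = ln (1 + - (x / (1 + x))) by congr ln; field; lra.
apply: le_ln1Dx; rewrite ltrN2 ltr_pdivrMr//; lra.
Qed.

Lemma expR_le1D2x (R : realType) (x : R) : 0 <= x <= 1 / 2 -> expR x <= 1 + 2 * x.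
Proof.
move=> /andP[x0 x1]; have h := expR_ge1Dx (- x).
have : expR x <= (1 - x)^-1.
  by rewrite -[x in leLHS]opprK expRN lef_pV2 ?posrE ?expR_gt0//; lra.
move/le_trans; apply; rewrite -[leLHS]mul1r ler_pdivrMr; last lra.
by nra.
Qed.

Lemma expRB1_le (R : realType) (x : R) : expR x - 1 <= x * expR x.
Proof.
have h := expR_ge1Dx (- x); have e0 := expR_gt0 x.
have : expR x * (1 + - x) <= expR x * expR (- x) by rewrite ler_pM2l.
by rewrite expRxMexpNx_1; lra.
Qed.

Section mean_growth.
Variables (R : realType) (alpha beta : R) (y Y : nat -> R).
Hypotheses (alpha0 : 0 < alpha) (betaE : beta = 1 + 1 / alpha).
Hypothesis y1 : 0 < y 1.
Hypothesis yS : forall k, y k.+2 = (k.+1%:R * y k.+1 + Y k.+2) / k.+2%:R.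
Hypothesis Yge : forall k, beta * y k.+1 <= Y k.+2.

Let a := 1 / alpha.
(** The exponent of the tail: on positive means, [1 - F] at the threshold is [expR] of minus the
    level, so the next mean gap is [expR] of it. The notation [U k] is shifted by one, [U 0] being
    the level after the first item. *)
Definition level k : R := (beta * y k) `^ alpha.
Local Notation U k := (level k.+1).
Local Notation V k := (U k / (k.+1%:R + beta)).
(** This is [V 0], the least of the nondecreasing ratios and hence a lower bound for all increments
    of the level. *)
Definition min_increment := level 1 / (1 + beta).
Local Notation delta := min_increment.

Let a0 : 0 < a. Proof. by rewrite divr_gt0. Qed.
Let beta1 : 1 < beta. Proof. by rewrite betaE ltrDl. Qed.
Let beta0 : 0 < beta. Proof. exact: lt_trans ltr01 beta1. Qed.
Let k1 k : 0 < k.+1%:R :> R. Proof. exact: ltr0Sn. Qed.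
Let kb k : 0 < k.+1%:R + beta :> R. Proof. by rewrite addr_gt0. Qed.

Lemma mean_gt0 k : 0 < y k.+1.
Proof.
elim: k => [//|k IH]; rewrite yS divr_gt0// addr_gt0 ?mulr_gt0//.
by apply: lt_le_trans (Yge k); rewrite mulr_gt0.
Qed.

Lemma level_gt0 k : 0 < U k.
Proof. by rewrite powR_gt0// mulr_gt0// mean_gt0. Qed.

(* The power of the worst-case growth factor of the mean is at least the ratio
   of two shifted indices, which telescopes. *)
Lemma growth_factor_ge k :
  (k.+2%:R + beta) / (k.+1%:R + beta) <= ((k.+1%:R + beta) / k.+2%:R) `^ alpha :> R.
Proof.
have := k1 k; rewrite -(natr1 k.+1); move: k.+1%:R => n n0.
have nb : 0 < n + beta by rewrite addr_gt0.
pose x : R := a / (n + 1).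
have x0 : 0 <= x by rewrite divr_ge0// ltW// addr_gt0.
have -> : (n + beta) / (n + 1) = 1 + x :> R.
  by rewrite /x /a betaE; field; rewrite !lt0r_neq0//; lra.
rewrite gt0_powRE; last lra.
have -> : (n + 1 + beta) / (n + beta) = 1 + 1 / (n + beta) :> R by field; lra.
apply: (le_trans (expR_ge1Dx _)); rewrite ler_expR.
(* Here [beta = 1 + 1 / alpha] makes the exponential bound on the left and the logarithmic bound on
   the right meet exactly. *)
have -> : 1 / (n + beta) = alpha * (x / (1 + x)).
  by rewrite /x /a betaE; field; rewrite !lt0r_neq0// ?addr_gt0 ?mulr_gt0 ?addr_gt0.
by rewrite ler_pM2l//; exact: ln1Dx_ge.
Qed.

Lemma level_growth k : U k * ((k.+2%:R + beta) / (k.+1%:R + beta)) <= U k.+1.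
Proof.
have h : beta * y k.+1 * ((k.+1%:R + beta) / k.+2%:R) <= beta * y k.+2.
  rewrite -mulrA ler_pM2l// yS mulrA ler_pM2r ?invr_gt0//.
  by have := Yge k; lra.
apply: (@le_trans _ _ ((beta * y k.+1 * ((k.+1%:R + beta) / k.+2%:R)) `^ alpha)).
  rewrite powRM; last 2 first.
  - by rewrite ltW// mulr_gt0// mean_gt0.
  - by rewrite divr_ge0// ltW.
  by rewrite ler_pM2l ?level_gt0// growth_factor_ge.
apply: ge0_ler_powR => //; first exact: ltW.
- by rewrite nnegrE mulr_ge0// ?divr_ge0// ?ltW// ?mulr_gt0// mean_gt0.
- by rewrite nnegrE ltW// mulr_gt0// mean_gt0.
Qed.

Lemma level_ratio_le k : V k <= V k.+1.
Proof.
rewrite ler_pdivlMr//; apply: le_trans (level_growth k).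
by rewrite -mulrA (mulrC _^-1).
Qed.

Lemma level_ratio_homo : nondecreasing_seq (fun k => V k).
Proof. exact/nondecreasing_seqP/level_ratio_le. Qed.

Lemma level_ratio_ge_delta k : delta <= V k.
Proof. exact: (level_ratio_homo (leq0n k)). Qed.

Lemma delta_gt0 : 0 < delta.
Proof. by rewrite divr_gt0 ?level_gt0// addr_gt0. Qed.

Lemma level_increment_ge k : V k <= U k.+1 - U k.
Proof.
have := level_growth k; rewrite (_ : U k * _ = U k + V k); first lra.
have := kb k; rewrite -(natr1 k.+1); move: k.+1%:R => n nb; field; lra.
Qed.

Lemma level_increment_ge_delta k : delta <= U k.+1 - U k.
Proof. exact: le_trans (level_ratio_ge_delta k) (level_increment_ge k). Qed.


(** The slack [Num.sqrt k.+1%:R] is large enough for the probabilities of violation to be summable,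
    and small compared with the level, which grows at least linearly. *)
Hypothesis Yle : \forall k \near \oo, Y k.+2 <= (U k + Num.sqrt k.+1%:R) `^ a.

(** Comes from [2 * beta * e], where the relative slack [e] is at most
    [1 / (delta * Num.sqrt k.+1%:R)]; [z k] is the resulting bound on the logarithmic growth of the
    level. *)
Let C := 2 * beta / delta.
Let z k : R := (1 + C / Num.sqrt k.+1%:R) / k.+2%:R.

Let C0 : 0 < C. Proof. by rewrite divr_gt0 ?delta_gt0// mulr_gt0. Qed.
Let s0 k : 0 < Num.sqrt k.+1%:R :> R. Proof. by rewrite sqrtr_gt0. Qed.

Lemma level_powa k : U k `^ a = beta * y k.+1.
Proof.
rewrite /level -powRrM (_ : alpha * a = 1) ?powRr1//; last by rewrite /a mulrC divfK// gt_eqF.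
by rewrite ltW// mulr_gt0// mean_gt0.
Qed.

Let sqrt_cvgy : (Num.sqrt k.+1%:R : R) @[k --> \oo] --> +oo.
Proof.
apply/cvgryPge => M; near=> k.
rewrite (le_trans (ler_norm M))// -sqrtr_sqr ler_wsqrtr//.
apply: (@le_trans _ _ k%:R); last by rewrite ler_nat.
by near: k; exact: nbhs_infty_ger.
Unshelve. all: by end_near. Qed.

(** First-order expansion in the relative slack [e = Num.sqrt k.+1%:R / U k], first of the power [a]
    bounding the new item, then of the updated mean; raising to the power [alpha] returns to
    levels. *)
Lemma level_growth_le : \forall k \near \oo, U k.+1 <= U k * expR (z k).
Proof.
have dl := delta_gt0.
near=> k.
(* Ensures [a * e <= 1 / 2], the range in which [expR_le1D2x] applies. *)
have sk : 2 * a / delta <= Num.sqrt k.+1%:R.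
  by near: k; move/cvgryPge : sqrt_cvgy; exact.
have Yk : Y k.+2 <= (U k + Num.sqrt k.+1%:R) `^ a by near: k.
have Uk := level_gt0 k.
pose e := Num.sqrt k.+1%:R / U k.
have e0 : 0 < e by rewrite divr_gt0.
have yk := mean_gt0 k.
have ds := mulr_gt0 dl (s0 k).
have eb : e <= 1 / (delta * Num.sqrt k.+1%:R).
  rewrite /e mul1r ler_pdivrMr// mulrC ler_pdivlMr//.
  rewrite mulrCA -expr2 sqr_sqrtr ?ler0n//.
  have := level_ratio_ge_delta k; rewrite ler_pdivlMr// mulrDr.
  by have := mulr_gt0 dl beta0; lra.
have ae : 0 <= a * e <= 1 / 2.
  apply/andP; split; first by rewrite ltW// mulr_gt0.
  apply: (@le_trans _ _ (a * (1 / (delta * Num.sqrt k.+1%:R)))).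
    by rewrite ler_pM2l.
  rewrite mulrA mulr1 ler_pdivrMr//.
  by move: sk; rewrite ler_pdivrMr// => ?; lra.
have Yk2 : Y k.+2 <= beta * y k.+1 * (1 + 2 * (a * e)).
  apply: le_trans Yk _.
  have -> : U k + Num.sqrt k.+1%:R = U k * (1 + e) by rewrite /e; field; rewrite gt_eqF.
  rewrite powRM; [|exact: ltW|lra].
  rewrite level_powa ler_pM2l ?mulr_gt0// gt0_powRE; last lra.
  apply: le_trans (expR_le1D2x ae); rewrite ler_expR ler_pM2l// le_ln1Dx//; lra.
(* Since [beta - 1 = a], the bound on the new item multiplies the mean by at most [1 + x]. *)
pose x := (a + 2 * (a * e) * beta) / k.+2%:R.
have by2 : beta * y k.+2 <= beta * y k.+1 * expR x.
  apply: (@le_trans _ _ (beta * y k.+1 * (1 + x))); last first.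
    by rewrite ler_pM2l ?mulr_gt0// expR_ge1Dx.
  rewrite -!mulrA ler_pM2l// yS ler_pdivrMr// -mulrA.
  have -> : (1 + x) * k.+2%:R = k.+1%:R + beta * (1 + 2 * (a * e)).
    rewrite /x mulrDl divfK ?gt_eqF// -(natr1 k.+1) betaE /a; ring.
  by lra.
apply: (@le_trans _ _ ((beta * y k.+1 * expR x) `^ alpha)).
  apply: ge0_ler_powR => //; first exact: ltW.
  - by rewrite nnegrE ltW// mulr_gt0// mean_gt0.
  - by rewrite nnegrE mulr_ge0// ?expR_ge0// ltW// mulr_gt0.
rewrite powRM ?expR_ge0//; last by rewrite ltW// mulr_gt0.
rewrite ler_pM2l// -expRM ler_expR /x /z mulrAC ler_pM2r ?invr_gt0//.
have -> : (a + 2 * (a * e) * beta) * alpha = 1 + 2 * beta * e.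
  by rewrite /a; field; rewrite gt_eqF.
rewrite lerD2l /C -[leRHS]mulrA ler_pM2l ?mulr_gt0//.
by apply: le_trans eb _; rewrite invfM mul1r.
Unshelve. all: by end_near. Qed.


(** The first term pays for the differences of [1 / (k + 2)] and [1 / (k + 2 + beta)], the second
    for the terms [C / (Num.sqrt k.+1%:R * k.+2%:R)]; both telescope. *)
Let b k : R := beta / k.+1%:R + 2 * C / Num.sqrt k.+1%:R.

Let b_ge0 k : 0 <= b k.
Proof. by rewrite ltW// addr_gt0// divr_gt0// mulr_gt0. Qed.

(* [b] dominates the sum of the growth rates still to come. *)
Let b_step k : z k - (k.+2%:R + beta)^-1 + b k.+1 <= b k.
Proof.
have sK : Num.sqrt k.+1%:R * Num.sqrt k.+1%:R = k.+1%:R :> R by rewrite -expr2 sqr_sqrtr.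
have sK' : Num.sqrt k.+2%:R * Num.sqrt k.+2%:R = k.+1%:R + 1 :> R by rewrite natr1 -expr2 sqr_sqrtr.
have ss' : Num.sqrt k.+1%:R <= Num.sqrt k.+2%:R :> R by rewrite ler_wsqrtr// ler_nat.
rewrite /z /b; move: sK sK' ss' (s0 k) (s0 k.+1) (k1 k).
move: C C0 => c c0.
move: (Num.sqrt k.+1%:R) (Num.sqrt k.+2%:R) => s s'.
rewrite -(natr1 k.+1); move: k.+1%:R => n sK sK' ss' s_gt0 s'_gt0 n0.
have h1 : (n + 1)^-1 - (n + 1 + beta)^-1 <= beta / n - beta / (n + 1).
  have -> : (n + 1)^-1 - (n + 1 + beta)^-1 = beta / ((n + 1) * (n + 1 + beta)).
    by field; rewrite !lt0r_neq0// ?addr_gt0.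
  have -> : beta / n - beta / (n + 1) = beta / ((n + 1) * n).
    by field; rewrite !lt0r_neq0// ?addr_gt0.
  rewrite ler_pM2l// lef_pV2 ?posrE ?mulr_gt0 ?addr_gt0//.
  by rewrite ler_pM2l ?addr_gt0//; have := beta0; lra.
have h2 : (s * (n + 1))^-1 <= 2 / s - 2 / s'.
  rewrite -sK' ; have -> : 2 / s - 2 / s' = (2 * s' * (s' - s)) / (s * (s' * s')).
    by field; rewrite !lt0r_neq0.
  rewrite -[leLHS]mul1r ler_pM2r ?invr_gt0 ?mulr_gt0//; nra.
have -> : (1 + c / s) / (n + 1) = (n + 1)^-1 + c * (s * (n + 1))^-1.
  by field; rewrite !lt0r_neq0// ?addr_gt0.
have : c * (s * (n + 1))^-1 <= c * (2 / s - 2 / s') by rewrite ler_pM2l.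
have -> : c * (2 / s - 2 / s') = 2 * c / s - 2 * c / s' by ring.
by lra.
Qed.

(** The factor [expR (b k)] turns the upper growth estimate into an eventually nonincreasing
    sequence lying above the nondecreasing [V k], which is therefore bounded. *)
Lemma level_ratio_step : \forall k \near \oo, V k.+1 * expR (b k.+1) <= V k * expR (b k).
Proof.
near=> k.
have Uk : U k.+1 <= U k * expR (z k) by near: k; exact: level_growth_le.
have U0 := level_gt0 k.
apply: (@le_trans _ _ (V k * expR (z k - (k.+2%:R + beta)^-1 + b k.+1))); last first.
  rewrite ler_pM2l ?divr_gt0// ler_expR; exact: b_step.
rewrite expRD mulrA ler_pM2r ?expR_gt0// expRD.
(* The factor [1 - 1 / (k + 2 + beta)] is exactly the quotient of the two denominators in [V k] and
   [V k.+1]. *)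
apply: (@le_trans _ _ (V k * (expR (z k) * (1 - (k.+2%:R + beta)^-1)))); last first.
  rewrite ler_pM2l ?divr_gt0// ler_pM2l ?expR_gt0//; exact: expR_ge1Dx.
rewrite ler_pdivrMr//; apply: le_trans Uk _.
rewrite le_eqVlt; apply/orP; left; apply/eqP.
have := kb k; rewrite -(natr1 k.+1); move: k.+1%:R => n n0.
by field; rewrite !lt0r_neq0//; lra.
Unshelve. all: by end_near. Qed.

Lemma level_ratio_is_cvg : cvgn (fun k => V k).
Proof.
have [N _ hN] := level_ratio_step.
have VN k : (N <= k)%N -> V k * expR (b k) <= V N * expR (b N).
  elim: k => [|k IH]; first by rewrite leqn0 => /eqP ->.
  rewrite leq_eqVlt => /predU1P[->//|]; rewrite ltnS => Nk.
  by apply: le_trans (IH Nk); exact: hN.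
apply: (@near_nondecreasing_is_cvgn _ _ (V N * expR (b N))).
  by apply: nearW => n m nm; exact: level_ratio_homo.
exists N => // k /= Nk; apply: le_trans (VN k Nk).
rewrite ler_peMr//; first by rewrite ltW// divr_gt0// level_gt0.
by rewrite -[leLHS]expR0 ler_expR.
Qed.

Let v := limn (fun k => V k).

Lemma level_ratio_cvg : V k @[k --> \oo] --> v.
Proof. exact: level_ratio_is_cvg. Qed.

Lemma level_limit_gt0 : 0 < v.
Proof.
apply: (lt_le_trans delta_gt0); apply: limr_ge; first exact: level_ratio_is_cvg.
by apply: nearW => k; exact: level_ratio_ge_delta.
Qed.

Let sV0 : (Num.sqrt k.+1%:R)^-1 @[k --> \oo] --> (0 : R).
Proof. by apply/gtr0_cvgV0 => //; exact: nearW. Qed.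

Let kV0 : k.+1%:R^-1 @[k --> \oo] --> (0 : R).
Proof. exact: cvg_harmonic. Qed.

Let kV0' : k.+2%:R^-1 @[k --> \oo] --> (0 : R).
Proof. by rewrite (cvg_shiftS (fun k => k.+1%:R^-1 : R)). Qed.

Let z0 : z k @[k --> \oo] --> 0.
Proof.
rewrite -[X in _ --> X](mulr0 (1 + C * 0)); apply: cvgM => //.
by apply: cvgD; [exact: cvg_cst|apply: cvgM; [exact: cvg_cst|]].
Qed.

Let kz1 : (k.+1%:R + beta) * z k @[k --> \oo] --> (1 : R).
Proof.
rewrite (_ : (fun k => _) = (fun k => (1 + (beta - 1) * k.+2%:R^-1) * (1 + C * (Num.sqrt k.+1%:R)^-1))).
  rewrite -[X in _ --> X](_ : (1 + (beta - 1) * 0) * (1 + C * 0) = _); last by ring.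
  apply: cvgM; apply: cvgD; try exact: cvg_cst; apply: cvgM => //; exact: cvg_cst.
apply/funext => k; rewrite /z -(natr1 k.+1); have := k1 k; have := s0 k.
move: (Num.sqrt k.+1%:R) => s; move: k.+1%:R => n n0 sn; field.
by rewrite !lt0r_neq0// addr_gt0.
Qed.

(** The increment is at least [V k], and at most [U k * z k * expR (z k)]; the latter also tends to
    [v] because [z k] is asymptotic to [1 / (k + 1 + beta)]. *)
Lemma level_increment_cvg : U k.+1 - U k @[k --> \oo] --> v.
Proof.
apply: (@squeeze_cvgr _ _ _ _ (fun k => V k) (fun k => V k * ((k.+1%:R + beta) * z k) * expR (z k))).
- near=> k; rewrite level_increment_ge/=.
  have Uk : U k.+1 <= U k * expR (z k) by near: k; exact: level_growth_le.
  have -> : V k * ((k.+1%:R + beta) * z k) = U k * z k by rewrite mulrA divfK ?gt_eqF.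
  have := expRB1_le (z k); have := level_gt0 k; nra.
- exact: level_ratio_cvg.
- rewrite -[X in _ --> X]mulr1; apply: cvgM.
    rewrite -[X in _ --> X]mulr1; apply: cvgM => //; exact: level_ratio_cvg.
  by rewrite -expR0; apply: continuous_cvg => //; exact: continuous_expR.
Unshelve. all: by end_near. Qed.

End mean_growth.

Lemma cvg_powR (R : realType) (x : nat -> R) (l p : R) :
  0 < l -> (forall k, 0 < x k) -> x k @[k --> \oo] --> l ->
  x k `^ p @[k --> \oo] --> l `^ p.
Proof.
move=> l0 x0 xl; rewrite gt0_powRE//.
under eq_fun do rewrite gt0_powRE//.
apply: continuous_cvg; first exact: continuous_expR.
apply: cvgM; first exact: cvg_cst.
by apply: continuous_cvg => //; exact: continuous_ln.
Qed.

Lemma cvg_expR_seq (R : realType) (x : nat -> R) (l : R) :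
  x k @[k --> \oo] --> l -> expR (x k) @[k --> \oo] --> expR l.
Proof. by move=> xl; apply: continuous_cvg => //; exact: continuous_expR. Qed.

(** Once [eta k] is at most [(1 - rho) * (eps / 2)], the excess of [e k] over [eps / 2] shrinks by
    the factor [rho]. *)
Lemma contraction_cvg0 (R : realType) (rho : R) (e eta : nat -> R) :
  0 <= rho < 1 -> (forall k, 0 <= e k) ->
  (\forall k \near \oo, e k.+1 <= rho * e k + eta k) ->
  eta k @[k --> \oo] --> 0 -> e k @[k --> \oo] --> 0.
Proof.
move=> /andP[rho0 rho1] e0 eS eta0; apply/cvgr0Pnorm_le => eps eps0.
have r1 : 0 < (1 - rho) * (eps / 2) by rewrite mulr_gt0 ?subr_gt0 ?divr_gt0.
have := cvgr0_norm_le _ eta0 _ r1 => hr.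
have [N _ hN] : \forall k \near \oo, e k.+1 - eps / 2 <= rho * (e k - eps / 2).
  near=> k; have h1 : e k.+1 <= rho * e k + eta k by near: k.
  have : `|eta k| <= (1 - rho) * (eps / 2) by near: k; exact: hr.
  by have := ler_norm (eta k); lra.
have iterN j : e (N + j)%N - eps / 2 <= rho ^+ j * e N.
  elim: j => [|j IH]; first by rewrite addn0 expr0 mul1r; lra.
  rewrite addnS; apply: (le_trans (hN _ (leq_addr _ _))).
  by rewrite exprS -mulrA ler_wpM2l.
have pow0 : rho ^+ j * e N @[j --> \oo] --> 0.
  rewrite -[X in _ --> X](mul0r (e N)); apply: cvgM; last exact: cvg_cst.
  by apply: cvg_expr; rewrite ger0_norm.
have eps20 : 0 < eps / 2 by rewrite divr_gt0.
have [M _ hM] := cvgr0_norm_le _ pow0 _ eps20.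
exists (N + M)%N => // k /= Nk; rewrite ger0_norm//.
have := iterN (k - N)%N; rewrite subnKC; last exact: leq_trans (leq_addr _ _) Nk.
have := hM (k - N)%N; rewrite /= leq_subRL; last exact: leq_trans (leq_addr _ _) Nk.
move=> /(_ Nk); have := ler_norm (rho ^+ (k - N) * e N); lra.
Unshelve. all: by end_near. Qed.

(** The limit is the fixed point [L = (L + 1) * l]. The distance to it eventually contracts by the
    midpoint of [l] and 1, up to an error proportional to [c k - l]. *)
Lemma affine_recursion_cvg (R : realType) (x c : nat -> R) (l : R) :
  (forall k, x k.+1 = (x k + 1) * c k) -> (forall k, 0 <= c k) ->
  0 <= l < 1 -> c k @[k --> \oo] --> l -> x k @[k --> \oo] --> l / (1 - l).
Proof.
move=> xS c0 /andP[l0 l1] cl; set L := l / (1 - l).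
have LE : L = (L + 1) * l by rewrite /L; field; rewrite lt0r_neq0//; lra.
have L0 : 0 <= L by rewrite divr_ge0//; lra.
suff : `|x k - L| @[k --> \oo] --> 0.
  move/cvgr0Pnorm_le => h; apply/cvgrPdist_le => eps eps0.
  by apply: filterS (h _ eps0) => k; rewrite normr_id distrC.
apply: (@contraction_cvg0 _ ((1 + l) / 2) _ (fun k => (L + 1) * `|c k - l|)) => //.
- by apply/andP; split; lra.
- near=> k.
  have ck : c k <= (1 + l) / 2 by near: k; apply: (cvgr_le _ cl); lra.
  have -> : x k.+1 - L = (x k - L) * c k + (L + 1) * (c k - l) by rewrite xS {1}LE; ring.
  apply: (le_trans (ler_normD _ _)); apply: lerD.
    by rewrite normrM mulrC ler_wpM2r// ger0_norm.
  by rewrite normrM ger0_norm//; lra.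
- rewrite -[X in _ --> X](mulr0 (L + 1)); apply: cvgM; first exact: cvg_cst.
  by rewrite -(normr0 R) -(subrr l); apply: cvg_norm; apply: cvgB => //; exact: cvg_cst.
Unshelve. all: by end_near. Qed.

(** * Asymptotics of sums with nearly geometric terms *)

Section limits.
Variables (R : realType) (u : nat -> R) (v : R).
Hypothesis v0 : 0 < v.
Hypothesis du : u k.+1 - u k @[k --> \oo] --> v.

Lemma cvg_increments i : u (k + i)%N - u k @[k --> \oo] --> i%:R * v.
Proof.
elim: i => [|i IH].
  by rewrite mul0r; under eq_fun do rewrite addn0 subrr; exact: cvg_cst.
rewrite -natr1 mulrDl mul1r.
rewrite (_ : (fun _ => _) = (fun k => (u (k + i)%N - u k) + (u (k + i).+1 - u (k + i)%N))).
  apply: cvgD => //.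
  by have := du; rewrite -(cvg_shiftn i).
by apply/funext => k; rewrite addnS; ring.
Qed.

Lemma increments_cvgy : u k @[k --> \oo] --> +oo.
Proof.
have [N _ hN] : \forall k \near \oo, v / 2 <= u k.+1 - u k.
  by apply: (cvgr_ge _ du); move: v0; lra.
have uN j : u N + j%:R * (v / 2) <= u (N + j)%N.
  elim: j => [|j IH]; first by rewrite mul0r addr0 addn0.
  rewrite addnS -natr1 mulrDl mul1r addrA; have := hN (N + j)%N (leq_addr _ _).
  by move=> /=; move: IH; move: (j%:R * (v / 2)) (v / 2) => x y; lra.
apply/cvgryPge => M.
have v20 : 0 < v / 2 by rewrite divr_gt0.
have [K _ hK] : \forall j \near \oo, (M - u N) / (v / 2) <= j%:R.
  exact: nbhs_infty_ger.
exists (N + K)%N => // k /= NK; have := uN (k - N)%N.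
rewrite subnKC; last exact: leq_trans (leq_addr _ _) NK.
apply: le_trans; have := hK (k - N)%N; rewrite /= leq_subRL; last exact: leq_trans (leq_addr _ _) NK.
by move=> /(_ NK); rewrite ler_pdivrMr//; lra.
Qed.

(** Advancing the index adds 1 to the scaled sum and multiplies by the exponential of minus the
    increment, an affine recursion whose coefficient tends to [expR (- v)]. *)
Lemma scaled_sum_cvg : (\sum_(0 <= j < k) expR (u j)) * expR (- u k) @[k --> \oo] --> (expR v - 1)^-1.
Proof.
have ev : 1 < expR v by rewrite expR_gt1.
rewrite (_ : (expR v - 1)^-1 = expR (- v) / (1 - expR (- v))); last first.
  by rewrite expRN; field; rewrite !lt0r_neq0//; lra.
apply: (@affine_recursion_cvg _ _ (fun k => expR (- (u k.+1 - u k)))) => //.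
- move=> k; rewrite big_nat_recr//= -[1 in RHS](expRxMexpNx_1 (u k)).
  by rewrite -mulrDl -mulrA -expRD; congr (_ * expR _); ring.
- by apply/andP; split => //; rewrite expR_lt1 oppr_lt0.
- by apply: cvg_expR_seq; exact: cvgN.
Qed.


Variable V : nat -> R.
Hypothesis V0 : forall n, 0 < V n.
Hypothesis Vv : V n @[n --> \oo] --> v.

(** The inverse of the sum of [expR (u j)] over [j < n + m] as predicted at index [n]: extrapolating
    [m] increments equal to [V n] and summing the geometric series gives [expR (u n + m%:R * V n) /
    (expR (V n) - 1)]. *)
Definition scale m n : R := expR (- u n) * ((expR (V n) - 1) * expR (- (m%:R * V n))).

Lemma scale_gt0 m n : 0 < scale m n.
Proof. by rewrite /scale !mulr_gt0 ?expR_gt0// subr_gt0 expR_gt1. Qed.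

Let g_cvg m : (expR (V n) - 1) * expR (- (m%:R * V n)) @[n --> \oo] -->
  (expR v - 1) * expR (- (m%:R * v)).
Proof.
apply: cvgM; first by apply: cvgB; [exact: cvg_expR_seq|exact: cvg_cst].
by apply: cvg_expR_seq; apply: cvgN; apply: cvgM => //; exact: cvg_cst.
Qed.

Lemma scale_cvg0 m : scale m n @[n --> \oo] --> 0.
Proof.
rewrite -[X in _ --> X](mul0r ((expR v - 1) * expR (- (m%:R * v)))).
apply: cvgM => //; apply: (@cvg_comp _ _ _ u (fun x => expR (- x)) _ _ _ increments_cvgy).
exact: cvgr_expR.
Qed.

Lemma scale_ratio_cvg m i : scale m n * expR (u (n + i)%N) @[n --> \oo] -->
  (expR v - 1) * expR (- (m%:R * v)) * expR (i%:R * v).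
Proof.
rewrite (_ : (fun _ => _) = (fun n => ((expR (V n) - 1) * expR (- (m%:R * V n))) * expR (u (n + i)%N - u n))).
  by apply: cvgM => //; apply: cvg_expR_seq; exact: cvg_increments.
by apply/funext => n; rewrite /scale expRD; ring.
Qed.

(** The scale tends to 0 while [expR (u (n + i))] grows at the inverse rate, so [expR x - 1] may be
    replaced by [x]; it lies between [x] and [x * expR x]. *)
Lemma scale_exp_cvg lam m i : 0 <= lam ->
  (expR (lam * scale m n) - 1) * expR (u (n + i)%N) @[n --> \oo] -->
  lam * ((expR v - 1) * expR (- (m%:R * v)) * expR (i%:R * v)).
Proof.
move=> lam0; set l := _ * expR (i%:R * v).
have h : lam * (scale m n * expR (u (n + i)%N)) @[n --> \oo] --> lam * l.
  by apply: cvgM; [exact: cvg_cst|exact: scale_ratio_cvg].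
have c0 : expR (lam * scale m n) @[n --> \oo] --> (1 : R).
  rewrite -expR0; apply: cvg_expR_seq; rewrite -[X in _ --> X](mulr0 lam).
  by apply: cvgM; [exact: cvg_cst|exact: scale_cvg0].
apply: (@squeeze_cvgr _ _ _ _ (fun n => lam * (scale m n * expR (u (n + i)%N)))
  (fun n => lam * (scale m n * expR (u (n + i)%N)) * expR (lam * scale m n))) => //.
  apply: nearW => n; rewrite mulrA ler_pM2r ?expR_gt0//; apply/andP; split.
    by have := expR_ge1Dx (lam * scale m n); lra.
  by rewrite mulrAC ler_pM2r ?expR_gt0// expRB1_le.
by rewrite -[X in _ --> X]mulr1; exact: cvgM.
Qed.

(** Justifies the extrapolated normalizer: its ratio to the true one tends to 1. *)
Lemma scale_sum_cvg m :
  scale m n * (\sum_(0 <= j < n + m) expR (u j)) @[n --> \oo] --> (1 : R).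
Proof.
have ev : 1 < expR v by rewrite expR_gt1.
have -> : 1 = ((expR v - 1) * expR (- (m%:R * v)) * expR (m%:R * v)) * (expR v - 1)^-1 :> R.
  by rewrite expRN; field; rewrite !lt0r_neq0 ?expR_gt0//; lra.
rewrite (_ : (fun _ => _) = (fun n => (scale m n * expR (u (n + m)%N)) *
  ((\sum_(0 <= j < n + m) expR (u j)) * expR (- u (n + m)%N)))).
  apply: cvgM; first exact: scale_ratio_cvg.
  by have := scaled_sum_cvg; rewrite -(cvg_shiftn m).
by apply/funext => n; rewrite expRN; field; rewrite lt0r_neq0// expR_gt0.
Qed.

End limits.

Section mean_limit.
Variables (R : realType) (alpha beta : R) (y : nat -> R) (v : R).
Hypotheses (alpha0 : 0 < alpha) (beta0 : 0 < beta) (y0 : forall k, 0 < y k.+1).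
Hypothesis v0 : 0 < v.
Hypothesis yv : level alpha beta y k.+1 / (k.+1%:R + beta) @[k --> \oo] --> v.

Lemma mean_cvg : y k / k%:R `^ (1 / alpha) @[k --> \oo] --> v `^ (1 / alpha) / beta.
Proof.
rewrite -(cvg_shiftS (fun k => y k / k%:R `^ (1 / alpha))).
have k0 k : 0 < k.+1%:R :> R by exact: ltr0Sn.
have by0 k : 0 < beta * y k.+1 by rewrite mulr_gt0.
pose q k := level alpha beta y k.+1 / k.+1%:R.
have q0 k : 0 < q k by rewrite divr_gt0// powR_gt0.
rewrite (_ : (fun _ => _) = (fun k => q k `^ (1 / alpha) / beta)); last first.
  apply/funext => k /=.
  have -> : y k.+1 = level alpha beta y k.+1 `^ (1 / alpha) / beta.
    rewrite /level -powRrM (_ : alpha * (1 / alpha) = 1); last by field; rewrite gt_eqF.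
    by rewrite powRr1 ?(ltW (by0 k))// mulrAC divff ?mul1r// gt_eqF.
  have {1}-> : level alpha beta y k.+1 = q k * k.+1%:R by rewrite /q divfK// gt_eqF.
  rewrite powRM; [|exact: ltW|exact: ltW].
  by rewrite mulrAC mulfK// gt_eqF// powR_gt0.
apply: cvgM; last exact: cvg_cst.
apply: cvg_powR => //.
rewrite (_ : q = fun k => level alpha beta y k.+1 / (k.+1%:R + beta) * (1 + beta * k.+1%:R^-1)).
  rewrite -[X in _ --> X](mulr1 v); apply: cvgM => //.
  rewrite -[X in _ --> X](addr0 1); apply: cvgD; first exact: cvg_cst.
  rewrite -[X in _ --> X](mulr0 beta); apply: cvgM; first exact: cvg_cst.
  exact: cvg_harmonic.
apply/funext => k; rewrite /q; have := k0 k; move: k.+1%:R (level _ _ _ _) => n l n0.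
by field; rewrite !lt0r_neq0// addr_gt0.
Qed.

Lemma level_of_limit : (beta * (v `^ (1 / alpha) / beta)) `^ alpha = v.
Proof.
rewrite mulrCA divff ?gt_eqF// mulr1 -powRrM divfK ?gt_eqF// powRr1//.
exact: ltW.
Qed.

End mean_limit.

(** The fourth-order term of [expR] at [Num.sqrt n] bounds the summand by [24 / n ^+ 2], hence by
    [48 * (n^-1 - (n + 1)^-1)], which telescopes to at most 48. *)
Lemma expR_opp_sqrt_summable (R : realType) :
  (\sum_(n <oo) (expR (- Num.sqrt n.+1%:R) : R)%:E < +oo)%E.
Proof.
apply: (@le_lt_trans _ _ 48%:E); last exact: ltry.
have e0 n : (0 <= (expR (- Num.sqrt n.+1%:R) : R)%:E)%E by rewrite lee_fin expR_ge0.
apply: lime_le; first by apply: is_cvg_nneseries => n _ _.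
apply: nearW => n; rewrite sumEFin lee_fin.
apply: (@le_trans _ _ (48 * (1 - n.+1%:R^-1))); last first.
  by rewrite ler_piMr// gerBl invr_ge0.
elim: n => [|n IH]; first by rewrite big_geq// invr1 subrr mulr0.
rewrite big_nat_recr//=; apply: (le_trans (lerD IH (lexx _))).
have k0 : 0 < n.+1%:R :> R by exact: ltr0Sn.
have s0 : 0 <= Num.sqrt n.+1%:R :> R by exact: sqrtr_ge0.
have : 1 + Num.sqrt n.+1%:R ^+ 4 / 24%:R <= expR (Num.sqrt n.+1%:R) :> R.
  by have := expR_ge1Dxn 3 s0; rewrite (_ : 4`! = 24%N).
rewrite (exprM _ 2 2) sqr_sqrtr; last exact: ltW.
move=> h.
have : expR (- Num.sqrt n.+1%:R) <= 24 / n.+1%:R ^+ 2 :> R.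
  rewrite expRN -[leRHS]invrK lef_pV2 ?posrE ?expR_gt0 ?invr_gt0 ?divr_gt0 ?exprn_gt0//.
  by rewrite invf_div; lra.
have : 24 / n.+1%:R ^+ 2 <= 48 * (n.+1%:R^-1 - n.+2%:R^-1) :> R.
  have k1 : 1 <= n.+1%:R :> R by rewrite ler1n.
  rewrite -(natr1 n.+1); move: k0 k1; move: n.+1%:R => k k0 k1.
  have -> : k^-1 - (k + 1)^-1 = (k * (k + 1))^-1.
    by field; rewrite !lt0r_neq0// addr_gt0.
  rewrite ler_pdivrMr ?exprn_gt0// mulrAC ler_pdivlMr ?mulr_gt0 ?addr_gt0//; nra.
move: (n.+1%:R^-1) (n.+2%:R^-1) (24 / _) (expR _) => x y z t; lra.
Qed.

(** * Almost sure regularity of the sample path *)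

Section almost_sure_path.
Context (R : realType) (d : measure_display) (Omega : measurableType d)
  (P : probability Omega R) (X : nat -> {RV P >-> R}) (alpha beta : R) (F : R -> R).

Local Notation path w := (fun i => X i w).
Local Notation T k w := (T_ beta (path w) k).
Local Notation Yb k w := (Ybar beta (path w) k).

Hypothesis alpha0 : 0 < alpha.
Hypothesis betaE : beta = 1 + 1 / alpha.
Hypothesis indepX : mutually_independent (fun i => X i.+1).
Hypothesis X_ge0 : forall i : nat, (0 < i)%N -> {ae P, forall w, 0 <= X i w}.
Hypothesis cdfX : forall (i : nat) x, (0 < i)%N -> cdf (X i) x = (F x)%:E.
Hypothesis tailF : forall x : R, 0 <= x -> 1 - F x = expR (- (x `^ alpha)).

Let beta0 : 0 < beta. Proof. by rewrite betaE addr_gt0// divr_gt0. Qed.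

Lemma weibull_lt1 x : F x < 1.
Proof.
have h : F x <= F (Num.max x 0) by apply: (common_cdf_nondecreasing cdfX); rewrite le_max lexx.
apply: (le_lt_trans h); rewrite -subr_gt0 tailF ?expR_gt0//.
by rewrite le_max lexx orbT.
Qed.

Let F_lt1 := weibull_lt1.

Definition U n w : R := level alpha beta (fun k => Yb k w) n.+1.
Definition V n w : R := U n w / (n.+1%:R + beta).

Lemma ae_proper : {ae P, forall w, forall k, proper (retention_times beta (path w) k)}.
Proof.
apply: ae_foralln => k.
pose B n := if pickle_inv n is Some s then if proper s then set0 else kept X beta k s else set0.
have mB n : measurable (B n).
  by rewrite /B; case: pickle_inv => // s; case: ifP => // _; exact: measurable_kept.
have mUB : measurable (\bigcup_n B n) by exact: bigcupT_measurable.
exists (\bigcup_n B n); split => //.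
  apply/eqP; rewrite eq_le measure_ge0 andbT.
  have PUB : (P (\bigcup_n B n) <= \sum_(n <oo) P (B n))%E.
    by apply: measure_sigma_subadditive.
  apply: (le_trans PUB).
  rewrite eseries0// => n _ _; rewrite /B; case: pickle_inv => [s|]; last by rewrite measure0.
  case: ifPn => ps; first by rewrite measure0.
  exact: (kept_improper_null beta indepX cdfX F_lt1).
move=> w /= /negP nps; exists (pickle (retention_times beta (path w) k)) => //.
by rewrite /B pickleK_inv (negbTE nps).
Qed.

Lemma ae_X1_gt0 : {ae P, forall w, 0 < X 1 w}.
Proof.
exists (X 1%N @^-1` `]-oo, 0%R]); split.
- by rewrite -[A in measurable A]setTI; exact: measurable_funP.
- have : cdf (X 1%N) 0 = 0%E.
    rewrite cdfX//; have := tailF (lexx 0); rewrite powR0 ?gt_eqF// oppr0 expR0 => h.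
    by congr (_%:E); lra.
  by [].
by move=> w /= /negP; rewrite -leNgt in_itv.
Qed.

(** The memoryless form of the tail in the variable [x ^ alpha] gives conditional probability at
    most [expR (- Num.sqrt k.+1%:R)] to a violation; Borel-Cantelli concludes. *)
Lemma ae_overshoot : {ae P, forall w, \forall k \near \oo,
  X (T k.+2 w) w <= (U k w + Num.sqrt k.+1%:R) `^ (1 / alpha)}.
Proof.
pose E k := [set w | (U k w + Num.sqrt k.+1%:R) `^ (1 / alpha) < X (T k.+2 w) w].
have aU k : adapted X beta k.+1 (fun w => (U k w + Num.sqrt k.+1%:R) `^ (1 / alpha)).
  apply: (adapted_comp (f := fun x : R => (x `^ alpha + Num.sqrt k.+1%:R) `^ (1 / alpha))).
    apply: (measurableT_comp (measurable_powR (1 / alpha))).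
    by apply: measurable_funD => //; exact: measurable_powR.
  exact: adapted_betaYb.
have mE k : measurable (E k).
  by apply: measurable_set_ltr; [exact: (aU k).1|exact: measurable_next].
have PE k : (P (E k) <= (expR (- Num.sqrt k.+1%:R))%:E)%E.
  apply: (overshoot indepX cdfX F_lt1 (aU k)) => [|w]; first exact: expR_ge0.
  have s0 : 0 <= Num.sqrt k.+1%:R :> R by exact: sqrtr_ge0.
  have U0 : 0 <= U k w by exact: powR_ge0.
  rewrite tailF ?powR_ge0// -powRrM divfK ?gt_eqF// powRr1 ?addr_ge0//.
  rewrite opprD expRD mulrC ler_pM2l ?expR_gt0//.
  (* The comparison of tails is required at every point, including null paths with negative mean:
     there [F] is at most [F 0 = 0]. *)
  have [y0|y0] := leP 0 (beta * Yb k.+1 w); first by rewrite tailF.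
  apply: (@le_trans _ _ 1); first by rewrite -[leRHS]expR0 ler_expR oppr_le0.
  have := tailF (lexx 0); rewrite powR0 ?gt_eqF// oppr0 expR0 => F0.
  by have := common_cdf_nondecreasing cdfX (ltW y0); lra.
have Elim : P (lim_sup_set E) = 0%E.
  apply: lim_sup_set_cvg0 => //; apply: (le_lt_trans _ (expR_opp_sqrt_summable R)).
  by apply: lee_nneseries => [n _ _|n _]; [exact: measure_ge0|exact: PE].
exists (lim_sup_set E); split => //.
  apply: bigcapT_measurable => k; apply: bigcup_measurable => j _; exact: mE.
move=> w /= h n _; apply: contrapT => nE; apply: h; exists n => // k /= nk.
by rewrite leNgt; apply/negP => lt; apply: nE; exists k.
Qed.

(** Collects what later arguments use about a path, so that each of them discards a single null
    set. *)
Record regular_path (w : Omega) (v : R) : Prop := RegularPath {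
  regular_T : forall k, (T k.+1 w < T k.+2 w)%N ;
  regular_mean : forall k, 0 < Yb k.+1 w ;
  regular_V0 : 0 < V 0 w ;
  regular_increment : forall n, V 0 w <= U n.+1 w - U n w ;
  regular_limit_gt0 : 0 < v ;
  regular_ratio : V n w @[n --> \oo] --> v ;
  regular_increment_cvg : U n.+1 w - U n w @[n --> \oo] --> v }.

Lemma YbarS (x : nat -> R) k : Ybar beta x k.+2 = (k.+1%:R * Ybar beta x k.+1 + Y_ beta x k.+2) / k.+2%:R.
Proof.
rewrite !YbarE mulrA divff ?mul1r ?pnatr_eq0// big_nat_recr//= mulrC.
by [].
Qed.

Lemma ae_regular_path : {ae P, forall w, exists v, regular_path w v}.
Proof.
have aeX : {ae P, forall w, forall i, 0 <= X i.+1 w} by apply: ae_foralln => i; exact: X_ge0.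
apply: filterS3 ae_proper ae_X1_gt0 ae_overshoot => w prop X1 over.
have Tlt k : (T k.+1 w < T k.+2 w)%N.
  by have := prop k.+2; rewrite /= /T_ /=; case: (retention_times _ _ k) => [|t s] /andP[].
have Ygt k : beta * Yb k.+1 w <= X (T k.+2 w) w.
  rewrite T_S; case: (first_afterP (T k.+1 w) (fun i => beta * Yb k.+1 w < X i w)) => [[_ /ltW//]|[h _]].
  by have := Tlt k; rewrite T_S h.
have y1 : 0 < Yb 1 w by rewrite YbarE big_nat1 invr1 mul1r /Y_ T_1.
have yS k := YbarS (path w) k.
have Vlim := level_ratio_cvg alpha0 betaE y1 yS Ygt over.
exists (limn (fun k => V k w)); split => //.
- by move=> k; exact: (mean_gt0 alpha0 betaE y1 yS Ygt).
- exact: (delta_gt0 alpha0 betaE y1).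
- by move=> n; exact: (level_increment_ge_delta alpha0 betaE y1 yS Ygt).
- exact: (level_limit_gt0 alpha0 betaE y1 yS Ygt over).
- exact: (level_increment_cvg alpha0 betaE y1 yS Ygt over).
Qed.

End almost_sure_path.

(** * Laplace transform of the rescaled waiting time *)

Lemma measurable_invr (R : realType) : measurable_fun [set: R] (fun x : R => x^-1).
Proof.
rewrite (_ : (fun x : R => x^-1) = (fun x => x * (x ^+ 2) `^ (- 1))).
  apply: measurable_funM => //; apply: (measurableT_comp (measurable_powR (-1))).
  exact: exprn_measurable.
apply/funext => x; rewrite powR_inv1 ?sqr_ge0// expr2.
have [->|x0] := eqVneq x 0; first by rewrite invr0 mul0r.
by rewrite invfM mulrA divff// mul1r.
Qed.

Section exponential_transform.
Variable R : realType.

(* The mean of R_j in terms of v = (beta w)^alpha, and the Laplace transform at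
   [lam] of the exponential law with that mean. *)
Definition exp_mean (j : nat) (v : R) : R := (expR v - 1) / expR (j%:R * v).
Definition exp_transform (lam : R) (j : nat) (v : R) : R := (1 + lam * exp_mean j v)^-1.

Lemma exp_mean_ge0 j v : 0 <= v -> 0 <= exp_mean j v.
Proof. by move=> v0; rewrite divr_ge0 ?expR_ge0// subr_ge0 -[leLHS]expR0 ler_expR. Qed.

Lemma exp_transform_itv lam j v : 0 <= lam -> 0 <= v -> 0 <= exp_transform lam j v <= 1.
Proof.
move=> l0 v0; have h : 0 <= lam * exp_mean j v by rewrite mulr_ge0// exp_mean_ge0.
have h1 : 0 < 1 + lam * exp_mean j v by rewrite ltr_pwDl.
by rewrite invr_ge0 (ltW h1)/= invf_le1// lerDl.
Qed.

Lemma measurable_exp_mean j : measurable_fun setT (exp_mean j).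
Proof.
apply: measurable_funM; first by apply: measurable_funB => //; exact: measurable_expR.
apply: (measurableT_comp (@measurable_invr R)); apply: (measurableT_comp (@measurable_expR R)).
exact: measurable_funM.
Qed.

Lemma measurable_exp_transform lam j : measurable_fun setT (exp_transform lam j).
Proof.
apply: (measurableT_comp (@measurable_invr R)); apply: measurable_funD => //.
by apply: measurable_funM => //; exact: measurable_exp_mean.
Qed.

Lemma exp_transform_cvg (lam : R) j (x : nat -> R) (v : R) : 0 <= lam -> 0 <= v -> x n @[n --> \oo] --> v ->
  exp_transform lam j (x n) @[n --> \oo] --> exp_transform lam j v.
Proof.
move=> l0 v0 xv; apply: cvgV.
  by rewrite lt0r_neq0// ltr_pwDl// mulr_ge0// exp_mean_ge0.
apply: cvgD; first exact: cvg_cst.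
apply: cvgM; first exact: cvg_cst.
apply: cvgM; first by apply: cvgB; [exact: cvg_expR_seq|exact: cvg_cst].
apply: cvgV; first by rewrite lt0r_neq0// expR_gt0.
by apply: cvg_expR_seq; apply: cvgM => //; exact: cvg_cst.
Qed.

End exponential_transform.

Lemma normr_le1 (R : realDomainType) (x : R) : 0 <= x <= 1 -> `|x| <= 1.
Proof. by move=> /andP[x0 x1]; rewrite ger0_norm. Qed.

Section laplace_gaps.
Context (R : realType) (d : measure_display) (Omega : measurableType d)
  (P : probability Omega R) (X : nat -> {RV P >-> R}) (alpha beta : R) (F : R -> R).

Local Notation path w := (fun i => X i w).
Local Notation T k w := (T_ beta (path w) k).
Local Notation Yb k w := (Ybar beta (path w) k).

Hypothesis alpha0 : 0 < alpha.
Hypothesis betaE : beta = 1 + 1 / alpha.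
Hypothesis indepX : mutually_independent (fun i => X i.+1).
Hypothesis X_ge0 : forall i : nat, (0 < i)%N -> {ae P, forall w, 0 <= X i w}.
Hypothesis cdfX : forall (i : nat) x, (0 < i)%N -> cdf (X i) x = (F x)%:E.
Hypothesis tailF : forall x : R, 0 <= x -> 1 - F x = expR (- (x `^ alpha)).

Let beta0 : 0 < beta. Proof. by rewrite betaE addr_gt0// divr_gt0. Qed.
Let F_lt1 x : F x < 1. Proof. exact: (weibull_lt1 cdfX tailF). Qed.
Let F_ge0 x : 0 <= F x. Proof. exact: (common_cdf_ge0 cdfX). Qed.
Let mF : measurable_fun setT F. Proof. exact: (common_cdf_measurable cdfX). Qed.

Local Notation U := (U X alpha beta).
Local Notation V := (V X alpha beta).
Local Notation regular := (regular_path X alpha beta).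

Let V_ge0 n w : 0 <= V n w.
Proof. by rewrite divr_ge0 ?powR_ge0// addr_ge0// ltW. Qed.

Let aU k n : (n < k)%N -> adapted X beta k (U n).
Proof.
move=> nk; apply: (adapted_comp (f := fun x : R => x `^ alpha)).
  exact: measurable_powR.
exact: adapted_betaYb.
Qed.

Let aV k n : (n < k)%N -> adapted X beta k (V n).
Proof. by move=> nk; apply: adaptedM; [exact: aU|exact: adapted_cst]. Qed.

Let mV n : measurable_fun setT (V n). Proof. exact: (aV (ltnSn n)).1. Qed.

Definition gap_scale m n w : R := scale (fun k => U k w) (fun k => V k w) m n.

Lemma gap_scale_ge0 m n w : 0 <= gap_scale m n w.
Proof.
rewrite /gap_scale /scale !mulr_ge0 ?expR_ge0// subr_ge0 -[leLHS]expR0 ler_expR.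
exact: V_ge0.
Qed.

Let a_scale k m n : (n < k)%N -> adapted X beta k (gap_scale m n).
Proof.
move=> nk; apply: adaptedM.
  apply: (adapted_comp (f := fun x : R => expR (- x))); last exact: aU.
  exact: measurableT_comp.
apply: adaptedM.
  apply: (adapted_comp (f := fun x : R => expR x - 1)); last exact: aV.
  by apply: measurable_funB => //; exact: measurable_expR.
apply: (adapted_comp (f := fun x : R => expR (- (m%:R * x)))); last exact: aV.
apply: (measurableT_comp (@measurable_expR R)); apply: measurableT_comp => //.
Qed.

(** The maximum with 0 acts only where retention times fail to increase; it keeps the transforms in
    the unit interval at every point. *)
Definition waited n i w : R := Num.max ((T (n + i).+1 w)%:R - (T n.+1 w)%:R) 0.

Lemma waited_ge0 n i w : 0 <= waited n i w.
Proof. by rewrite /waited le_max lexx orbT. Qed.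

Let a_waited n i : adapted X beta (n + i).+1 (waited n i).
Proof.
apply: (adapted_comp (f := fun x : R => Num.max x 0)).
  exact: (@measurable_maxr _ _ _ _ (fun x : R => x) (cst 0)).
by apply: adaptedB; apply: adapted_T => //; rewrite ltnS leq_addr.
Qed.

Lemma regular_T_le w v n i : regular w v -> (T n.+1 w <= T (n + i).+1 w)%N.
Proof.
move=> /regular_T h; elim: i => [|i IH]; first by rewrite addn0.
by rewrite addnS (leq_trans IH)// ltnW.
Qed.

Lemma waited0 n w : waited n 0 w = 0.
Proof. by rewrite /waited addn0 subrr maxxx. Qed.

Lemma waitedS n i w v : regular w v ->
  waited n i.+1 w = waited n i w + (gap X beta (n + i).+1 w)%:R.
Proof.
move=> reg; have h := regular_T_le n i reg; have h' := regular_T_le n i.+1 reg.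
have h2 := regular_T_le (n + i) 1 reg; rewrite addn1 in h2.
rewrite /waited !max_l ?subr_ge0 ?ler_nat// /gap addnS natrB//; ring.
Qed.

Lemma regular_tail w v n : regular w v -> 1 - F (beta * Yb n.+1 w) = expR (- U n w).
Proof.
move=> reg; rewrite tailF// ltW// mulr_gt0//; exact: (regular_mean reg).
Qed.


Let intb (f : Omega -> R) : measurable_fun setT f -> (forall w, 0 <= f w <= 1) ->
  P.-integrable setT (EFin \o f).
Proof. by move=> mf f01; apply: (@integrable_bounded _ _ _ P f 1 mf) => w; exact: normr_le1. Qed.

(** The Laplace transform at [c] of the geometric law on the positive integers with failure
    probability [p]. *)
Definition gap_factor (p c : R) : R := 1 - (1 - expR (- c)) / (1 - p * expR (- c)).

Lemma gap_factor_itv p c : 0 <= p < 1 -> 0 <= c -> 0 <= gap_factor p c <= 1.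
Proof.
move=> /andP[p0 p1] c0; rewrite /gap_factor.
have e0 := expR_gt0 (- c).
have e1 : expR (- c) <= 1 by rewrite -[leRHS]expR0 ler_expR oppr_le0.
have q0 : 0 < 1 - p * expR (- c) by nra.
have h0 : 0 <= (1 - expR (- c)) / (1 - p * expR (- c)) by rewrite divr_ge0 ?(ltW q0)// subr_ge0.
have h1 : (1 - expR (- c)) / (1 - p * expR (- c)) <= 1 by rewrite ler_pdivrMr//; nra.
by apply/andP; split; lra.
Qed.

(** When the geometric mean is [expR u], the transform is already that of an exponential variable
    with this mean, evaluated at [expR c - 1] instead of [c]. *)
Lemma gap_factorE u c : 0 <= c ->
  gap_factor (1 - expR (- u)) c = (1 + (expR c - 1) * expR u)^-1.
Proof.
move=> c0; rewrite /gap_factor !expRN.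
have x1 : 1 <= expR c by rewrite -[leLHS]expR0 ler_expR.
have u0 := expR_gt0 u.
move: (expR c) (expR u) x1 u0 => x y x1 y0.
have h : 0 < 1 + (x - 1) * y by nra.
by field; rewrite !lt0r_neq0//; nra.
Qed.

Lemma integral_gap_transform k Z c : adapted X beta k.+1 Z -> (forall w, 0 <= Z w <= 1) ->
  adapted X beta k.+1 c -> (forall w, 0 <= c w) ->
  \int[P]_w (Z w * expR (- c w * (gap X beta k.+1 w)%:R)) =
  \int[P]_w (Z w * gap_factor (F (beta * Yb k.+1 w)) (c w)).
Proof.
move=> aZ Z01 ac c0.
have Z0 w : 0 <= Z w by have /andP[] := Z01 w.
have e01 w : 0 <= 1 - expR (- c w * (gap X beta k.+1 w)%:R) <= 1.
  have := expR_gt0 (- c w * (gap X beta k.+1 w)%:R).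
  have : expR (- c w * (gap X beta k.+1 w)%:R) <= 1.
    by rewrite -[leRHS]expR0 ler_expR mulNr oppr_le0 mulr_ge0.
  by move=> *; apply/andP; split; lra.
have me : measurable_fun setT (fun w => 1 - expR (- c w * (gap X beta k.+1 w)%:R)).
  apply: measurable_funB => //; apply: (measurableT_comp (@measurable_expR R)).
  apply: measurable_funM; first by apply: measurableT_comp => //; exact: ac.1.
  exact: (measurableT_comp (f := fun m : nat => m%:R : R) _ (measurable_gap X beta k.+1)).
have mphi : measurable_fun setT (fun w => 1 - gap_factor (F (beta * Yb k.+1 w)) (c w)).
  apply: measurable_funB => //; apply: measurable_funB => //.
  have mec : measurable_fun setT (fun w => expR (- c w)).
    by apply: (measurableT_comp (@measurable_expR R)); apply: measurableT_comp => //; exact: ac.1.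
  apply: measurable_funM; first exact: measurable_funB.
  apply: (measurableT_comp (@measurable_invr R)); apply: measurable_funB => //.
  by apply: measurable_funM => //; apply: measurableT_comp => //; exact: (adapted_betaYb X beta (leqnn _)).1.
have phi01 w : 0 <= 1 - gap_factor (F (beta * Yb k.+1 w)) (c w) <= 1.
  have : 0 <= gap_factor (F (beta * Yb k.+1 w)) (c w) <= 1.
    by apply: gap_factor_itv => //; rewrite F_ge0 F_lt1.
  by move=> /andP[? ?]; apply/andP; split; lra.
have Zf01 (f : Omega -> R) : (forall w, 0 <= f w <= 1) -> forall w, 0 <= Z w * f w <= 1.
  move=> f01 w; have /andP[z0 z1] := Z01 w; have /andP[f0 f1] := f01 w.
  by rewrite mulr_ge0// mulr_ile1.
(* The geometric computation concerns [1 - expR], so both sides are passed to complements;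
   boundedness makes the subtraction legitimate. *)
have compl (f : Omega -> R) : measurable_fun setT f -> (forall w, 0 <= f w <= 1) ->
    \int[P]_w (Z w * (1 - f w)) = \int[P]_w Z w - \int[P]_w (Z w * f w).
  move=> mf f01; rewrite -RintegralB//; last 2 first.
  - by apply: intb => //; exact: aZ.1.
  - by apply: intb; [apply: measurable_funM => //; exact: aZ.1|exact: Zf01].
  by apply: eq_Rintegral => w _; rewrite mulrBr mulr1.
transitivity (\int[P]_w (Z w * (1 - (1 - expR (- c w * (gap X beta k.+1 w)%:R))))).
  by apply: eq_Rintegral => w _; rewrite subKr.
rewrite compl// /Rintegral (integral_gap_exp indepX cdfX F_lt1 aZ Z0 ac c0) -/(Rintegral _ _ _).
transitivity (\int[P]_w Z w - \int[P]_w (Z w * (1 - gap_factor (F (beta * Yb k.+1 w)) (c w)))).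
  congr (_ - _); apply: eq_Rintegral => w _; rewrite /gap_factor subKr.
  by [].
by rewrite -compl//; apply: eq_Rintegral => w _; rewrite subKr.
Qed.


Definition Vlim : Omega -> R := limit_fun (fun n => V n).

Lemma measurable_Vlim : measurable_fun setT Vlim.
Proof. exact: measurable_limit_fun. Qed.

Lemma ae_regular : {ae P, forall w, regular w (Vlim w)}.
Proof.
apply: filterS (ae_regular_path alpha0 betaE indepX X_ge0 cdfX tailF) => w [v reg].
by rewrite /Vlim (limit_funE (regular_ratio reg)).
Qed.

(** The limiting means are numbered backwards: the gap started after [i] of the [m] steps has mean
    number [m - i], and the last one, [i = m - 1], has mean number 1. *)
Lemma gap_factor_cvg (lam : R) m i w v : 0 <= lam -> (i <= m)%N -> regular w v ->
  gap_factor (F (beta * Yb (n + i).+1 w)) (lam * gap_scale m n w) @[n --> \oo] -->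
  exp_transform lam (m - i) v.
Proof.
move=> lam0 im reg; have v0 := regular_limit_gt0 reg.
rewrite (_ : (fun _ => _) = (fun n => (1 + (expR (lam * gap_scale m n w) - 1) * expR (U (n + i) w))^-1)); last first.
  apply/funext => n; rewrite -gap_factorE; last exact: mulr_ge0 (gap_scale_ge0 _ _ _).
  by rewrite -(regular_tail _ reg) subKr.
rewrite /exp_transform; apply: cvgV.
  by rewrite lt0r_neq0// ltr_pwDl// mulr_ge0// exp_mean_ge0// ltW.
apply: cvgD; first exact: cvg_cst.
rewrite (_ : exp_mean (m - i) v = (expR v - 1) * expR (- (m%:R * v)) * expR (i%:R * v)).
  by apply: scale_exp_cvg => //; [exact: (regular_increment_cvg reg)|exact: (regular_ratio reg)].
rewrite /exp_mean -expRN -mulrA -expRD natrB//; congr (_ * expR _); ring.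
Qed.

Let mwaited n i : measurable_fun setT (waited n i). Proof. exact: (a_waited n i).1. Qed.
Let mscale m n : measurable_fun setT (gap_scale m n). Proof. exact: (a_scale m (ltnSn n)).1. Qed.

(** The test function [g] makes the induction close. Conditioning replaces the newest gap by its
    factor [phi n], which depends on recent items; replacing that by its limit evaluated at [V n]
    leaves a function of index [n] data, which is absorbed into [g] when one gap fewer is
    treated. *)
Lemma laplace_waited (lam : R) m i (g : R -> R) : 0 <= lam -> (i <= m)%N ->
  measurable_fun setT g -> (forall x, 0 <= x -> 0 <= g x <= 1) ->
  (forall (x_ : nat -> R) (v : R), 0 < v -> x_ n @[n --> \oo] --> v -> g (x_ n) @[n --> \oo] --> g v) ->
  \int[P]_w (expR (- (lam * gap_scale m n w) * waited n i w) * g (V n w)) @[n --> \oo] -->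
  \int[P]_w (\prod_(0 <= j < i) exp_transform lam (m - j) (Vlim w) * g (Vlim w)).
Proof.
move=> lam0; elim: i g => [|i IH] g im mg g01 gc.
  apply: (@bounded_Rconvergence _ _ _ _ _ _ 1).
  - move=> n; apply: measurable_funM; last exact: measurableT_comp.
    apply: (measurableT_comp (@measurable_expR R)); apply: measurable_funM => //.
    by apply: measurableT_comp => //; exact: measurable_funM.
  - apply: measurable_funM; last exact: measurableT_comp measurable_Vlim.
    by rewrite (_ : (fun _ => _) = cst 1)//; apply/funext => w; rewrite big_geq.
  - apply: filterS ae_regular => w reg; rewrite big_geq// mul1r.
    under eq_fun do rewrite waited0 mulr0 expR0 mul1r.
    by apply: gc; [exact: (regular_limit_gt0 reg)|exact: (regular_ratio reg)].
  - by move=> n w; rewrite waited0 mulr0 expR0 mul1r; apply: normr_le1; exact: g01.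
have ltim : (i < m)%N := im.
pose th := exp_transform lam (m - i).
pose Z n w := expR (- (lam * gap_scale m n w) * waited n i w) * g (V n w).
pose phi n w := gap_factor (F (beta * Yb (n + i).+1 w)) (lam * gap_scale m n w).
have th01 x : 0 <= x -> 0 <= th x <= 1 by exact: exp_transform_itv.
have Z01 n w : 0 <= Z n w <= 1.
  have /andP[g0 g1] := g01 _ (V_ge0 n w).
  rewrite mulr_ge0 ?expR_ge0//= mulr_ile1 ?expR_ge0//.
  rewrite -[leRHS]expR0 ler_expR mulNr oppr_le0; apply: mulr_ge0 (waited_ge0 _ _ _).
  exact: mulr_ge0 (gap_scale_ge0 _ _ _).
have phi01 n w : 0 <= phi n w <= 1.
  by apply: gap_factor_itv; [rewrite F_ge0 F_lt1|exact: mulr_ge0 (gap_scale_ge0 _ _ _)].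
have ac n : adapted X beta (n + i).+1 (fun w => lam * gap_scale m n w).
  by apply: adaptedM; [exact: adapted_cst|apply: a_scale; rewrite ltnS leq_addr].
have aZ n : adapted X beta (n + i).+1 (Z n).
  apply: adaptedM.
    apply: (adapted_comp (f := expR) (Z := fun w => - (lam * gap_scale m n w) * waited n i w)) => //.
    apply: adaptedM => //.
    by apply: (adapted_comp (f := fun x : R => - x)); [exact: measurableT_comp|exact: ac].
  by apply: (adapted_comp mg); apply: aV; rewrite ltnS leq_addr.
have mth : measurable_fun setT th by exact: measurable_exp_transform.
have mphi n : measurable_fun setT (phi n).
  have mec : measurable_fun setT (fun w => expR (- (lam * gap_scale m n w))).
    by apply: (measurableT_comp (@measurable_expR R)); apply: measurableT_comp => //; exact: (ac n).1.
  apply: measurable_funB => //; apply: measurable_funM; first exact: measurable_funB.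
  apply: (measurableT_comp (@measurable_invr R)); apply: measurable_funB => //.
  by apply: measurable_funM => //; apply: measurableT_comp => //; exact: (adapted_betaYb X beta (leqnn _)).1.
have mZ n : measurable_fun setT (Z n) := (aZ n).1.
have mthV n : measurable_fun setT (fun w => th (V n w)) by exact: measurableT_comp.
(* The main term has the shape of the induction hypothesis for [th * g]; the second integral is the
   error of replacing the conditional factor by [th (V n w)]. *)
have stepE n : \int[P]_w (expR (- (lam * gap_scale m n w) * waited n i.+1 w) * g (V n w)) =
    \int[P]_w (Z n w * th (V n w)) + \int[P]_w (Z n w * (phi n w - th (V n w))).
  transitivity (\int[P]_w (Z n w * phi n w)); last first.
    rewrite -RintegralD//; last 2 first.
    - apply: intb => [|w]; first exact: measurable_funM.
      have /andP[? ?] := Z01 n w; have /andP[? ?] := th01 _ (V_ge0 n w).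
      by rewrite mulr_ge0// mulr_ile1.
    - apply: (@integrable_bounded _ _ _ P _ 1) => [|w].
        by apply: measurable_funM => //; exact: measurable_funB.
      rewrite normrM mulr_ile1//; first exact: normr_le1.
      have /andP[? ?] := phi01 n w; have /andP[? ?] := th01 _ (V_ge0 n w).
      by rewrite ler_norml; apply/andP; split; lra.
    by apply: eq_Rintegral => w _; ring.
  rewrite -(integral_gap_transform (aZ n) (Z01 n) (ac n)); last first.
    by move=> w; exact: mulr_ge0 (gap_scale_ge0 _ _ _).
  apply: ae_eq_Rintegral.
  - apply: measurable_funM; last exact: measurableT_comp.
    apply: (measurableT_comp (@measurable_expR R)); apply: measurable_funM => //.
    by apply: measurableT_comp => //; exact: (ac n).1.
  - apply: measurable_funM => //; apply: (measurableT_comp (@measurable_expR R)).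
    apply: measurable_funM; first by apply: measurableT_comp => //; exact: (ac n).1.
    exact: (measurableT_comp (f := fun m : nat => m%:R : R) _ (measurable_gap X beta _)).
  apply: filterS ae_regular => w reg.
  by rewrite (waitedS _ _ reg) mulrDr expRD /Z; ring.
rewrite (funext stepE) -[X in _ --> X]addr0; apply: cvgD.
  have := IH (fun x => th x * g x) (ltnW im).
  rewrite (_ : \int[P]_w _ = \int[P]_w (\prod_(0 <= j < i.+1) exp_transform lam (m - j) (Vlim w) * g (Vlim w))); last first.
    by apply: eq_Rintegral => w _; rewrite big_nat_recr//= -mulrA.
  rewrite (_ : (fun n => \int[P]_w _) = (fun n => \int[P]_w (Z n w * th (V n w)))); last first.
    by apply/funext => n; apply: eq_Rintegral => w _; rewrite /Z; ring.
  apply.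
  - exact: measurable_funM.
  - move=> x x0; have /andP[? ?] := th01 x x0; have /andP[? ?] := g01 x x0.
    by rewrite mulr_ge0// mulr_ile1.
  - move=> x_ v v0 xv; apply: cvgM; last exact: gc.
    by apply: exp_transform_cvg => //; exact: ltW.
have -> : 0 = \int[P]_w (cst 0 w) :> R by rewrite Rintegral_cst// mul0r.
apply: (@bounded_Rconvergence _ _ _ _ _ _ 1) => //.
- by move=> n; apply: measurable_funM => //; exact: measurable_funB.
- apply: filterS ae_regular => w reg; have v0 := regular_limit_gt0 reg.
  have d0 : phi n w - th (V n w) @[n --> \oo] --> 0.
    rewrite -(subrr (th (Vlim w))); apply: cvgB; first exact: (gap_factor_cvg lam0 (ltnW im) reg).
    by apply: exp_transform_cvg; [|exact: ltW|exact: (regular_ratio reg)].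
  apply/cvgr0Pnorm_le => e e0; apply: filterS (cvgr0_norm_le _ d0 _ e0) => n.
  apply: le_trans; rewrite normrM ler_piMl//; exact: normr_le1.
- move=> n w; rewrite normrM mulr_ile1//; first exact: normr_le1.
  have /andP[? ?] := phi01 n w; have /andP[? ?] := th01 _ (V_ge0 n w).
  by rewrite ler_norml; apply/andP; split; lra.
Qed.

End laplace_gaps.

Lemma expR_opp_lipschitz (R : realType) (x y : R) : 0 <= x -> 0 <= y ->
  `|expR (- (x + y)) - expR (- y)| <= Num.min 1 x.
Proof.
move=> x0 y0; have e1 : expR (- y) <= 1 by rewrite -[leRHS]expR0 ler_expR oppr_le0.
have e2 : expR (- x) <= 1 by rewrite -[leRHS]expR0 ler_expR oppr_le0.
have h := expR_ge1Dx (- x); have h1 := expR_gt0 (- x); have h2 := expR_gt0 (- y).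
rewrite opprD expRD -[X in _ - X]mul1r -mulrBl normrM (ger0_norm (ltW h2)).
rewrite ler0_norm ?subr_le0// opprB le_min; apply/andP; split; nra.
Qed.

(** The mean value bound leaves a factor of the form [y * expR (- s)], with [s] the smaller of [y]
    and [rho * y]; as [s * expR (- s) <= 1] and [rho >= 1 / 2], it is at most 2. *)
Lemma expR_opp_scale (R : realType) (rho y : R) : 1 / 2 <= rho -> 0 <= y ->
  `|expR (- (rho * y)) - expR (- y)| <= 2 * `|rho - 1|.
Proof.
move=> r2 y0.
have aux (s t : R) : 0 <= s <= t -> `|expR (- t) - expR (- s)| <= (t - s) * expR (- s).
  move=> /andP[s0 st]; have h := expR_ge1Dx (- (t - s)); have h1 := expR_gt0 (- s).
  have -> : expR (- t) = expR (- (t - s)) * expR (- s) by rewrite -expRD; congr expR; ring.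
  rewrite -[X in _ - X]mul1r -mulrBl normrM (ger0_norm (ltW h1)) ler_pM2r// ler0_norm; first lra.
  by rewrite subr_le0 -[leRHS]expR0 ler_expR oppr_le0 subr_ge0.
have aux2 (s : R) : 0 <= s -> s * expR (- s) <= 1.
  move=> s0; rewrite expRN ler_pdivrMr ?expR_gt0// mul1r.
  by have := expR_ge1Dx s; lra.
have [r1|r1] := leP 1 rho.
  apply: (le_trans (aux y (rho * y) _)); first by apply/andP; split; nra.
  rewrite (ger0_norm _); last lra.
  have -> : (rho * y - y) * expR (- y) = (rho - 1) * (y * expR (- y)) by ring.
  by have := aux2 y y0; nra.
rewrite distrC; apply: (le_trans (aux (rho * y) y _)); first by apply/andP; split; nra.
rewrite (ler0_norm _); last lra.
have -> : (y - rho * y) * expR (- (rho * y)) = (1 - rho) * (y * expR (- (rho * y))) by ring.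
have := aux2 (rho * y); have := expR_gt0 (- (rho * y)); move: (expR _) => e e0.
have ry : 0 <= rho * y by nra.
move=> /(_ ry) h; have : y * e <= 2 by nra.
by nra.
Qed.

Lemma dist_chain (R : realDomainType) (l x1 x2 x3 x4 e1 e2 e3 e4 : R) :
  `|l - x1| <= e1 -> `|x1 - x2| <= e2 -> `|x3 - x2| <= e3 -> `|x4 - x3| <= e4 ->
  `|l - x4| <= e1 + e2 + e3 + e4.
Proof.
move=> h1 h2 h3 h4; have -> : l - x4 = (l - x1) + (x1 - x2) + (x2 - x3) + (x3 - x4) by ring.
apply: (le_trans (ler_normD _ _)); apply: lerD; last by rewrite distrC.
apply: (le_trans (ler_normD _ _)); apply: lerD; last by rewrite distrC.
by apply: (le_trans (ler_normD _ _)); exact: lerD.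
Qed.

(** * Reduction of the normalized waiting time to its last gaps *)

Section laplace_Tstar.
Context (R : realType) (d : measure_display) (Omega : measurableType d)
  (P : probability Omega R) (X : nat -> {RV P >-> R}) (alpha beta : R) (F : R -> R).

Local Notation path w := (fun i => X i w).
Local Notation T k w := (T_ beta (path w) k).
Local Notation Yb k w := (Ybar beta (path w) k).

Hypothesis alpha0 : 0 < alpha.
Hypothesis betaE : beta = 1 + 1 / alpha.
Hypothesis indepX : mutually_independent (fun i => X i.+1).
Hypothesis X_ge0 : forall i : nat, (0 < i)%N -> {ae P, forall w, 0 <= X i w}.
Hypothesis cdfX : forall (i : nat) x, (0 < i)%N -> cdf (X i) x = (F x)%:E.
Hypothesis tailF : forall x : R, 0 <= x -> 1 - F x = expR (- (x `^ alpha)).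

Let beta0 : 0 < beta. Proof. by rewrite betaE addr_gt0// divr_gt0. Qed.
Let F_lt1 x : F x < 1. Proof. exact: (weibull_lt1 cdfX tailF). Qed.
Let F_ge0 x : 0 <= F x. Proof. exact: (common_cdf_ge0 cdfX). Qed.
Let mF : measurable_fun setT F. Proof. exact: (common_cdf_measurable cdfX). Qed.

Local Notation U := (U X alpha beta).
Local Notation V := (V X alpha beta).
Local Notation regular := (regular_path X alpha beta).
Local Notation Vlim := (Vlim X alpha beta).
Local Notation gap_scale := (gap_scale X alpha beta).
Local Notation waited := (waited X beta).

Let aereg : {ae P, forall w, regular w (Vlim w)}.
Proof. exact: (ae_regular alpha0 betaE indepX X_ge0 cdfX tailF). Qed.

Let aU k n : (n < k)%N -> adapted X beta k (U n).
Proof.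
move=> nk; apply: (adapted_comp (f := fun x : R => x `^ alpha)).
  exact: measurable_powR.
exact: adapted_betaYb.
Qed.
Let mU n : measurable_fun setT (U n). Proof. exact: (aU (ltnSn n)).1. Qed.
Let mT n : measurable_fun setT (fun w => (T n w)%:R : R).
Proof. exact: (adapted_T X beta (leqnn n)).1. Qed.

Lemma measurable_Tstar k : measurable_fun setT (fun w => Tstar beta F (path w) k).
Proof.
apply: measurable_funM; first exact: mT.
apply: (measurableT_comp (@measurable_invr R)); apply: measurable_sum => j.
apply: (measurableT_comp (@measurable_invr R)); apply: measurable_funB => //.
by apply: (measurableT_comp mF); exact: (adapted_betaYb X beta (leqnn j)).1.
Qed.

Lemma Tstar_ge0 k w : 0 <= Tstar beta F (path w) k.
Proof.
rewrite divr_ge0// sumr_ge0// => j _.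
by rewrite invr_ge0 subr_ge0 ltW.
Qed.

(* The waiting time [T n.+1] in units of the current mean gap. *)
Definition scaled_start n w : R := (T n.+1 w)%:R * expR (- U n w).

Lemma scaled_start_ge0 n w : 0 <= scaled_start n w.
Proof. by rewrite mulr_ge0 ?expR_ge0. Qed.

Let mstart n : measurable_fun setT (scaled_start n).
Proof.
apply: measurable_funM => //; apply: (measurableT_comp (@measurable_expR R)).
exact: measurableT_comp.
Qed.

(** Indicator of the paths whose levels are guaranteed to grow by more than [eta] per step, apart
    from a null set. It is known after the first observation, so it may weight every later
    conditioning. *)
Definition fast (eta : R) (w : Omega) : R := (eta < V 0%N w)%R%:R.

Let afast eta k : adapted X beta k.+1 (fast eta).
Proof.
apply: (adapted_comp (f := fun x : R => (eta < x)%R%:R)).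
  rewrite (_ : (fun x : R => _) = \1_[set x : R | eta < x]).
    by apply: measurable_indic; exact: measurable_set_ltr.
  apply/funext => x; rewrite indicE; congr ((_ : bool)%:R).
  by apply/idP/idP; rewrite inE.
by apply: adaptedM; [exact: aU|exact: adapted_cst].
Qed.

(** In units of [expR (U n)] the next gap has conditional mean 1, and on fast paths changing units
    gains the factor [q = expR (- eta)]. So the bound passes from [c] to [q * (c + 1)], which stays
    below [c = (1 - q)^-1] because [(1 - q) ^+ 2 >= 0]. *)
Lemma integral_scaled_start eta n : 0 < eta ->
  (\int[P]_w (fast eta w * scaled_start n w)%:E <= ((1 - expR (- eta))^-1)%:E)%E.
Proof.
move=> eta0; have q1 : expR (- eta) < 1 by rewrite expR_lt1 oppr_lt0.
have q0 := expR_gt0 (- eta); set q := expR (- eta) in q0 q1 *.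
have PT c : (\int[P]_w (cst c%:E w) = c%:E)%E.
  rewrite integral_cst// [X in (_ * X)%E](_ : _ = 1%E) ?mule1//; exact: probability_setT.
have f01 w : 0 <= fast eta w <= 1 by rewrite /fast; case: (_ < _); rewrite lexx ler01.
have mfast : measurable_fun setT (fast eta) := (afast eta 0).1.
elim: n => [|n IH].
  apply: (@le_trans _ _ (\int[P]_w (cst 1 w)%:E)%E).
    apply: ge0_le_integral => //.
    - move=> w _; have /andP[? ?] := f01 w; by rewrite lee_fin mulr_ge0// scaled_start_ge0.
    - by apply/measurable_EFinP; exact: measurable_funM.
    - exact/measurable_EFinP.
    move=> w _; rewrite lee_fin /scaled_start T_1 mul1r; have /andP[? ?] := f01 w.
    by rewrite mulr_ile1// ?expR_ge0// -[leRHS]expR0 ler_expR oppr_le0 powR_ge0.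
  rewrite PT lee_fin -[leLHS]invr1 lef_pV2 ?posrE//; first lra.
  by rewrite subr_gt0.
have agap : adapted X beta n.+1 (fun w => fast eta w * expR (- U n w)).
  apply: adaptedM => //; apply: (adapted_comp (f := fun x : R => expR (- x))); last exact: aU.
  exact: measurableT_comp.
have gap_le1 : (\int[P]_w (fast eta w * expR (- U n w) * (gap X beta n.+1 w)%:R)%:E <= 1%:E)%E.
  rewrite (integral_gap indepX cdfX F_lt1 agap); last first.
    by move=> w; rewrite mulr_ge0 ?expR_ge0//; have /andP[] := f01 w.
  rewrite -(PT 1); apply: ae_ge0_le_integral => //.
  - move=> w _; rewrite lee_fin; apply: divr_ge0; last by rewrite subr_ge0 ltW.
    by apply: mulr_ge0; [have /andP[] := f01 w|exact: expR_ge0].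
  - apply/measurable_EFinP; apply: measurable_funM; first exact: agap.1.
    apply: (measurableT_comp (@measurable_invr R)); apply: measurable_funB => //.
    by apply: (measurableT_comp mF); exact: (adapted_betaYb X beta (leqnn _)).1.
  apply: filterS aereg => w reg _; rewrite lee_fin (regular_tail alpha0 betaE tailF _ reg).
  by rewrite mulfK ?gt_eqF ?expR_gt0//; have /andP[] := f01 w.
pose a w : R := fast eta w * scaled_start n w.
pose b w : R := fast eta w * expR (- U n w) * (gap X beta n.+1 w)%:R.
have a0 w : 0 <= a w by have /andP[? ?] := f01 w; rewrite mulr_ge0// scaled_start_ge0.
have b0 w : 0 <= b w by have /andP[? ?] := f01 w; rewrite !mulr_ge0// expR_ge0.
have ma : measurable_fun setT a by exact: measurable_funM.
have mb : measurable_fun setT b.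
  apply: measurable_funM; first exact: agap.1.
  exact: (measurableT_comp (f := fun m : nat => m%:R : R) _ (measurable_gap X beta _)).
apply: (@le_trans _ _ (\int[P]_w (q * (a w + b w))%:E)%E).
  apply: ae_ge0_le_integral => //.
  - by move=> w _; have /andP[? ?] := f01 w; rewrite lee_fin mulr_ge0// scaled_start_ge0.
  - by apply/measurable_EFinP; exact: measurable_funM.
  - by move=> w _; rewrite lee_fin mulr_ge0 ?(ltW q0)// addr_ge0.
  - by apply/measurable_EFinP; apply: measurable_funM => //; exact: measurable_funD.
  apply: filterS aereg => w reg _; rewrite lee_fin /a /b /fast.
  case: ltP => [eta_V|_]; last by rewrite !mul0r addr0 mulr0.
  rewrite !mul1r /scaled_start.
  have Tlt := regular_T reg n.
  have -> : (T n.+2 w)%:R = (T n.+1 w)%:R + (gap X beta n.+1 w)%:R :> R.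
    by rewrite /gap -natrD subnKC// ltnW.
  have h : expR (- U n.+1 w) <= q * expR (- U n w).
    rewrite /q -expRD ler_expR; have := regular_increment reg n; lra.
  apply: (le_trans (ler_wpM2l _ h)); first by rewrite addr_ge0.
  by rewrite le_eqVlt; apply/orP; left; apply/eqP; ring.
under eq_integral do rewrite EFinM EFinD.
rewrite ge0_integralZl_EFin//; last 3 first.
- by move=> w _; rewrite -EFinD lee_fin addr_ge0.
- by apply: emeasurable_funD; exact/measurable_EFinP.
- exact: ltW.
rewrite ge0_integralD//; last 4 first.
- by move=> w _; rewrite lee_fin.
- exact/measurable_EFinP.
- by move=> w _; rewrite lee_fin.
- exact/measurable_EFinP.
apply: (@le_trans _ _ (q%:E * ((1 - q)^-1%:E + 1%:E))%E).
  by rewrite lee_wpmul2l ?lee_fin ?(ltW q0)//; exact: leeD.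
rewrite -EFinD -EFinM lee_fin -(ler_pM2r (x := 1 - q)) ?subr_gt0// mulVf; last lra.
rewrite -mulrA mulrDl mulVf; last lra.
by nra.
Qed.


Definition mean_gaps k w : R := \sum_(0 <= j < k) expR (U j w).

Let mS k : measurable_fun setT (mean_gaps k).
Proof. by apply: measurable_sum => j; exact: measurableT_comp. Qed.

Let S_gt0 k w : 0 < mean_gaps k.+1 w.
Proof.
by rewrite /mean_gaps big_nat_recr//= ltr_wpDl ?expR_gt0// sumr_ge0// => j _; exact: expR_ge0.
Qed.

Lemma Tstar_regular w v n m : regular w v ->
  Tstar beta F (path w) (n + m).+1 = ((T n.+1 w)%:R + waited n m w) / mean_gaps (n + m) w.
Proof.
move=> reg; rewrite /Tstar; congr (_ / _).
  rewrite /waited max_l; first by rewrite addrC subrK.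
  by rewrite subr_ge0 ler_nat; exact: (regular_T_le n m reg).
rewrite big_add1 /=; apply: eq_bigr => j _.
by rewrite (regular_tail alpha0 betaE tailF _ reg) expRN invrK.
Qed.

(** Only the last term of the normalizer is kept; its index is [n + m], whence [m] increments of at
    least [V 0] in the exponent. *)
Lemma regular_start w v n m : regular w v ->
  (T n.+1 w)%:R / mean_gaps (n + m.+1) w <= expR (- (m%:R * V 0 w)) * scaled_start n w.
Proof.
move=> reg; rewrite ler_pdivrMr; last by rewrite addnS.
have h : expR (U n w) * expR (m%:R * V 0 w) <= mean_gaps (n + m.+1) w.
  rewrite -expRD; apply: (@le_trans _ _ (expR (U (n + m) w))).
    rewrite ler_expR; elim: m => [|m IH]; first by rewrite mul0r addr0 addn0.
    rewrite addnS -natr1 mulrDl mul1r addrA.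
    have := regular_increment reg (n + m); lra.
  by rewrite /mean_gaps addnS big_nat_recr//= lerDr sumr_ge0// => j _; exact: expR_ge0.
apply: (@le_trans _ _ (expR (- (m%:R * V 0 w)) * scaled_start n w * (expR (U n w) * expR (m%:R * V 0 w)))).
  rewrite le_eqVlt; apply/orP; left; apply/eqP; rewrite /scaled_start !expRN; field.
  by rewrite !lt0r_neq0// expR_gt0.
by rewrite ler_wpM2l// mulr_ge0 ?expR_ge0// scaled_start_ge0.
Qed.

(** Discarding the time before the last gaps costs at most 1 on slow paths, and at most [lam] times
    the discarded quantity on fast ones. The bound is uniform in [n]. *)
Lemma laplace_start (lam eta : R) n m : 0 <= lam -> 0 < eta ->
  `|\int[P]_w expR (- (lam * Tstar beta F (path w) (n + m.+1).+1)) -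
    \int[P]_w expR (- (lam * (waited n m.+1 w / mean_gaps (n + m.+1) w)))| <=
  \int[P]_w (1 - fast eta w) + lam * expR (- (m%:R * eta)) / (1 - expR (- eta)).
Proof.
move=> lam0 eta0.
have f01 w : 0 <= fast eta w <= 1 by rewrite /fast; case: (_ < _); rewrite lexx ler01.
have mfast : measurable_fun setT (fast eta) := (afast eta 0).1.
have W0 k w : 0 <= waited n k w / mean_gaps (n + k) w.
  rewrite divr_ge0//; first exact: waited_ge0.
  by rewrite sumr_ge0// => j _; exact: expR_ge0.
have mW : measurable_fun setT (fun w => waited n m.+1 w / mean_gaps (n + m.+1) w).
  apply: measurable_funM; last exact: (measurableT_comp (@measurable_invr R)).
  apply: (@measurable_maxr _ _ _ _ _ (cst 0)) => //; exact: measurable_funB.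
have mexp (f : Omega -> R) : measurable_fun setT f -> measurable_fun setT (fun w => expR (- (lam * f w))).
  by move=> mf; apply: (measurableT_comp (@measurable_expR R)); apply: measurableT_comp => //; exact: measurable_funM.
have iexp (f : Omega -> R) : measurable_fun setT f -> (forall w, 0 <= f w) ->
    P.-integrable setT (EFin \o (fun w => expR (- (lam * f w)))).
  move=> mf f0; apply: (@integrable_bounded _ _ _ P _ 1); first exact: mexp.
  move=> w; rewrite ger0_norm ?expR_ge0// -[leRHS]expR0 ler_expR oppr_le0.
  exact: mulr_ge0.
have i1 := iexp _ (measurable_Tstar (n + m.+1).+1) (Tstar_ge0 _).
have i2 := iexp _ mW (W0 _).
rewrite -RintegralB//; apply: (le_trans (le_normr_Rintegral measurableT _)).
  exact: (integrableB measurableT i1 i2).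
have mdiff : measurable_fun setT (fun w => `|expR (- (lam * Tstar beta F (path w) (n + m.+1).+1)) -
    expR (- (lam * (waited n m.+1 w / mean_gaps (n + m.+1) w)))|).
  apply: measurableT_comp => //; apply: measurable_funB; apply: mexp => //.
  exact: measurable_Tstar.
set C := lam * expR (- (m%:R * eta)).
have C0 : 0 <= C by rewrite mulr_ge0// expR_ge0.
have i1f : P.-integrable setT (EFin \o (fun w => 1 - fast eta w)).
  apply: (@integrable_bounded _ _ _ P _ 1); first exact: measurable_funB.
  by move=> w; have /andP[? ?] := f01 w; rewrite ler_norml; apply/andP; split; lra.
rewrite -lee_fin /Rintegral EFinD !fineK; last 2 first.
- exact: integrable_fin_num.
- by apply: integrable_fin_num => //; exact: (integrable_abse (integrableB measurableT i1 i2)).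
apply: (@le_trans _ _ (\int[P]_w ((1 - fast eta w)%:E + (C * (fast eta w * scaled_start n w))%:E))%E).
  apply: ae_ge0_le_integral => //.
  - by apply/measurable_EFinP.
  - move=> w _; have /andP[? ?] := f01 w; rewrite -EFinD lee_fin addr_ge0 ?subr_ge0//.
    by rewrite !mulr_ge0// scaled_start_ge0.
  - apply: emeasurable_funD; apply/measurable_EFinP; first exact: measurable_funB.
    by apply: measurable_funM => //; exact: measurable_funM.
  apply: filterS aereg => w reg _; rewrite -EFinD lee_fin (Tstar_regular _ _ reg).
  rewrite mulrDl mulrDr.
  have a0 : 0 <= lam * ((T n.+1 w)%:R / mean_gaps (n + m.+1) w).
    by rewrite mulr_ge0// divr_ge0// ltW// addnS.
  have b0 : 0 <= lam * (waited n m.+1 w / mean_gaps (n + m.+1) w) by exact: mulr_ge0.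
  apply: (le_trans (expR_opp_lipschitz a0 b0)).
  rewrite /fast; case: ltP => [etaV|_]; last by rewrite mul0r mulr0 subr0 addr0 ge_min lexx.
  rewrite subrr add0r mul1r ge_min; apply/orP; right.
  rewrite /C -mulrA ler_wpM2l//; apply: (le_trans (regular_start n m reg)).
  rewrite ler_wpM2r ?scaled_start_ge0// ler_expR lerN2 ler_wpM2l//; exact: ltW.
rewrite ge0_integralD//; last 4 first.
- by move=> w _; have /andP[? ?] := f01 w; rewrite lee_fin subr_ge0.
- by apply/measurable_EFinP; exact: measurable_funB.
- by move=> w _; have /andP[? ?] := f01 w; rewrite lee_fin !mulr_ge0// scaled_start_ge0.
- by apply/measurable_EFinP; apply: measurable_funM => //; exact: measurable_funM.
apply: leeD => //; under eq_integral do rewrite EFinM.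
rewrite ge0_integralZl_EFin//; last 2 first.
- by move=> w _; have /andP[? ?] := f01 w; rewrite lee_fin mulr_ge0// scaled_start_ge0.
- by apply/measurable_EFinP; exact: measurable_funM.
rewrite [leRHS]EFinM; apply: lee_wpmul2l; first by rewrite lee_fin.
exact: integral_scaled_start.
Qed.

Lemma slow_cvg0 : \int[P]_w (1 - fast k.+1%:R^-1 w) @[k --> \oo] --> 0.
Proof.
have -> : 0 = \int[P]_w (cst 0 w) :> R by rewrite Rintegral_cst// mul0r.
apply: (@bounded_Rconvergence _ _ _ _ _ _ 1) => //.
- by move=> k; apply: measurable_funB => //; exact: (afast _ 0).1.
- apply: filterS aereg => w reg; apply: cvg_near_cst; near=> k.
  rewrite /fast (_ : _ < _)%R ?subrr//.
  near: k; apply: (cvgr_lt 0); first exact: cvg_harmonic.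
  exact: (regular_V0 reg).
- by move=> k w; rewrite /fast; case: (_ < _); rewrite ?subrr ?subr0 ?normr0 ?normr1.
Unshelve. all: by end_near. Qed.


Let W_ge0 n m w : 0 <= waited n m w / mean_gaps (n + m) w.
Proof.
rewrite divr_ge0//; first exact: waited_ge0.
by rewrite sumr_ge0// => j _; exact: expR_ge0.
Qed.

Let mwaited n m : measurable_fun setT (waited n m).
Proof. by apply: (@measurable_maxr _ _ _ _ _ (cst 0)) => //; exact: measurable_funB. Qed.

Let mscale m n : measurable_fun setT (gap_scale m n).
Proof.
have mV : measurable_fun setT (V n) by exact: measurable_funM.
apply: measurable_funM.
  by apply: (measurableT_comp (@measurable_expR R)); exact: measurableT_comp.
apply: measurable_funM; first by apply: measurable_funB => //; exact: (measurableT_comp (@measurable_expR R)).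
apply: (measurableT_comp (@measurable_expR R)); apply: measurableT_comp => //.
exact: measurable_funM.
Qed.

Let mexp (lam : R) (f : Omega -> R) : measurable_fun setT f ->
  measurable_fun setT (fun w => expR (- (lam * f w))).
Proof.
move=> mf; apply: (measurableT_comp (@measurable_expR R)).
by apply: measurableT_comp => //; exact: measurable_funM.
Qed.

Let iexp (lam : R) (f : Omega -> R) : 0 <= lam -> measurable_fun setT f -> (forall w, 0 <= f w) ->
  P.-integrable setT (EFin \o (fun w => expR (- (lam * f w)))).
Proof.
move=> lam0 mf f0; apply: (@integrable_bounded _ _ _ P _ 1); first exact: mexp.
move=> w; rewrite ger0_norm ?expR_ge0// -[leRHS]expR0 ler_expR oppr_le0.
exact: mulr_ge0.
Qed.

(** Exchanges the true normalizer, which depends on the last gaps, for the extrapolated one, which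
    is fixed at index [n]. The ratio [rho n] tends to 1, and the change of transform is controlled
    by [rho n - 1] however long the wait. *)
Lemma laplace_rescale (lam : R) m : 0 <= lam -> (0 < m)%N ->
  \int[P]_w expR (- (lam * (waited n m w / mean_gaps (n + m) w))) -
  \int[P]_w expR (- (lam * gap_scale m n w) * waited n m w) @[n --> \oo] --> 0.
Proof.
move=> lam0 m0.
have mW n : measurable_fun setT (fun w => waited n m w / mean_gaps (n + m) w).
  by apply: measurable_funM => //; exact: (measurableT_comp (@measurable_invr R)).
have c0 n w : 0 <= gap_scale m n w by exact: (gap_scale_ge0 X alpha0 betaE).
have cW0 n w : 0 <= gap_scale m n w * waited n m w by rewrite mulr_ge0// waited_ge0.
rewrite (_ : (fun _ => _) = (fun n => \int[P]_w (expR (- (lam * (waited n m w / mean_gaps (n + m) w))) -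
    expR (- (lam * (gap_scale m n w * waited n m w)))))); last first.
  apply/funext => n; rewrite RintegralB//; last 2 first.
  - by apply: iexp.
  - by apply: iexp => //; exact: measurable_funM.
  by congr (_ - _); apply: eq_Rintegral => w _; rewrite mulNr mulrA.
have -> : 0 = \int[P]_w (cst 0 w) :> R by rewrite Rintegral_cst// mul0r.
apply: (@bounded_Rconvergence _ _ _ _ _ _ 1) => //.
- by move=> n; apply: measurable_funB; apply: mexp => //; exact: measurable_funM.
- apply: filterS aereg => w reg.
  have v0 := regular_limit_gt0 reg.
  have V_gt0 n : 0 < V n w.
    rewrite divr_gt0//; last by rewrite addr_gt0.
    by rewrite powR_gt0// mulr_gt0// (regular_mean reg).
  have cS := scale_sum_cvg v0 (regular_increment_cvg reg) (regular_ratio reg) m.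
  pose rho n := (gap_scale m n w * mean_gaps (n + m) w)^-1.
  have rho1 : rho n @[n --> \oo] --> (1 : R).
    by rewrite -[X in _ --> X]invr1; apply: cvgV => //; exact: oner_neq0.
  have d0 : 2 * `|rho n - 1| @[n --> \oo] --> 0.
    rewrite -[X in _ --> X](mulr0 2); apply: cvgM; first exact: cvg_cst.
    by rewrite -(normr0 R) -(subrr 1); apply: cvg_norm; apply: cvgB => //; exact: cvg_cst.
  apply/cvgr0Pnorm_le => e e0; near=> n.
  have r2 : 1 / 2 <= rho n by near: n; apply: (cvgr_ge _ rho1); lra.
  have c_gt0 : 0 < gap_scale m n w by exact: scale_gt0.
  have S0 : 0 < mean_gaps (n + m) w by rewrite -(prednK m0) addnS.
  rewrite (_ : waited n m w / mean_gaps (n + m) w = rho n * (gap_scale m n w * waited n m w)); last first.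
    by rewrite /rho; field; rewrite !lt0r_neq0.
  rewrite mulrCA; apply: (le_trans (expR_opp_scale r2 _)); first exact: mulr_ge0.
  rewrite -[leLHS]ger0_norm ?mulr_ge0//.
  by near: n; apply: (cvgr0_norm_le _ d0).
- move=> n w.
  have h1 : 0 <= lam * (waited n m w / mean_gaps (n + m) w) by exact: mulr_ge0.
  have h2 : 0 <= lam * (gap_scale m n w * waited n m w) by exact: mulr_ge0.
  have e1 : expR (- (lam * (waited n m w / mean_gaps (n + m) w))) <= 1.
    by rewrite -[leRHS]expR0 ler_expR oppr_le0.
  have e2 : expR (- (lam * (gap_scale m n w * waited n m w))) <= 1.
    by rewrite -[leRHS]expR0 ler_expR oppr_le0.
  have := expR_gt0 (- (lam * (waited n m w / mean_gaps (n + m) w))).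
  have := expR_gt0 (- (lam * (gap_scale m n w * waited n m w))).
  by move=> *; rewrite ler_norml; apply/andP; split; lra.
Unshelve. all: by end_near. Qed.

(** The order of choices is [eta] for the slow paths, then [m] for the discarded start and for the
    product over means, and only then a large [n]. *)
Lemma laplace_Tstar (lam L : R) : 0 <= lam ->
  \int[P]_w (\prod_(0 <= j < m) exp_transform lam (m - j) (Vlim w)) @[m --> \oo] --> L ->
  \int[P]_w expR (- (lam * Tstar beta F (path w) k)) @[k --> \oo] --> L.
Proof.
move=> lam0 cvgL; apply/cvgrPdist_le => e e0.
(* One fifth each for slow paths, discarded start, truncated product, peeling and change of
   normalizer. *)
have e4 : 0 < e / 5 by rewrite divr_gt0.
have [N _ hN] := cvgr0_norm_le _ slow_cvg0 _ e4.
pose eta : R := N.+1%:R^-1.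
have eta0 : 0 < eta by rewrite invr_gt0.
have slow : \int[P]_w (1 - fast eta w) <= e / 5.
  by have := hN N (leqnn N); exact: le_trans (ler_norm _).
have tail0 : lam * expR (- (m%:R * eta)) / (1 - expR (- eta)) @[m --> \oo] --> 0.
  rewrite (_ : (fun _ => _) = (fun m => lam * expR (- eta) ^+ m / (1 - expR (- eta)))).
    rewrite -[X in _ --> X](mul0r (1 - expR (- eta))^-1); apply: cvgM; last exact: cvg_cst.
    rewrite -[X in _ --> X](mulr0 lam); apply: cvgM; first exact: cvg_cst.
    by apply: cvg_expr; rewrite ger0_norm ?expR_ge0// expR_lt1 oppr_lt0.
  by apply/funext => m; rewrite -expRM_natl mulrN.
have [m [m_tail m_L]] : exists m, lam * expR (- (m%:R * eta)) / (1 - expR (- eta)) <= e / 5 /\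
    `|L - \int[P]_w (\prod_(0 <= j < m.+1) exp_transform lam (m.+1 - j) (Vlim w))| <= e / 5.
  have [M1 _ h1] := cvgr0_norm_le _ tail0 _ e4.
  have [M2 _ h2] := proj1 (cvgrPdist_le _ _) cvgL _ e4.
  exists (maxn M1 M2); split.
    by apply: le_trans (ler_norm _) (h1 _ (leq_maxl _ _)).
  by apply: h2; rewrite /= leqW// leq_maxr.
have waitL : \int[P]_w expR (- (lam * gap_scale m.+1 n w) * waited n m.+1 w) @[n --> \oo] -->
    \int[P]_w (\prod_(0 <= j < m.+1) exp_transform lam (m.+1 - j) (Vlim w)).
  rewrite (_ : (fun n => _) = (fun n => \int[P]_w (expR (- (lam * gap_scale m.+1 n w) * waited n m.+1 w) * cst 1 (V n w)))); last first.
    by apply/funext => n; apply: eq_Rintegral => w _; rewrite mulr1.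
  rewrite (_ : \int[P]_w _ = \int[P]_w (\prod_(0 <= j < m.+1) exp_transform lam (m.+1 - j) (Vlim w) * cst 1 (Vlim w))); last first.
    by apply: eq_Rintegral => w _; rewrite mulr1.
  apply: (laplace_waited alpha0 betaE indepX X_ge0 cdfX tailF) => //.
    by move=> x _; rewrite lexx ler01.
  by move=> *; exact: cvg_cst.
have [N1 _ h1] := proj1 (cvgrPdist_le _ _) waitL _ e4.
have [N2 _ h2] := cvgr0_norm_le _ (laplace_rescale lam0 (ltn0Sn m)) _ e4.
exists (maxn N1 N2 + m.+2)%N => // k /= Nk.
pose n := (k - m.+2)%N.
have kE : k = (n + m.+1).+1 by rewrite -addnS subnK// (leq_trans _ Nk)// leq_addl.
have nN : (maxn N1 N2 <= n)%N by rewrite leq_subRL ?(leq_trans _ Nk) ?leq_addl// addnC.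
have d1 := laplace_start n m lam0 eta0.
have d2 := h2 n (leq_trans (leq_maxr _ _) nN).
have d3 := h1 n (leq_trans (leq_maxl _ _) nN).
rewrite kE; apply: (le_trans (dist_chain m_L d3 d2 _)).
  exact: (le_trans d1 (lerD slow m_tail)).
by rewrite le_eqVlt; apply/orP; left; apply/eqP; field.
Qed.

End laplace_Tstar.

(** * From Laplace transforms to distribution functions *)

Section smooth_step.
Variable R : realType.

(* For [0 <= y <= 1] this tends to the indicator function of [y < 1/2]. *)
Definition step_poly (N : nat) (y : R) : R := (1 - y ^+ N) ^+ (2 ^ N).

Lemma bernoulli_le (x : R) n : 0 <= x <= 1 -> 1 - n%:R * x <= (1 - x) ^+ n.
Proof.
move=> /andP[x0 x1]; elim: n => [|n IH]; first by rewrite mul0r subr0 expr0.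
rewrite exprS; apply: (@le_trans _ _ ((1 - x) * (1 - n%:R * x))).
  rewrite -natr1; have : 0 <= n%:R * x * x by rewrite !mulr_ge0.
  by lra.
by rewrite ler_wpM2l// subr_ge0.
Qed.

Lemma step_poly_itv N y : 0 <= y <= 1 -> 0 <= step_poly N y <= 1.
Proof.
move=> /andP[y0 y1]; have h : 0 <= 1 - y ^+ N <= 1.
  by rewrite subr_ge0 exprn_ile1//= gerBl exprn_ge0.
by have /andP[h0 h1] := h; rewrite exprn_ge0//= exprn_ile1.
Qed.

Lemma step_poly_le N y y' : 0 <= y -> y <= y' -> y' <= 1 -> step_poly N y' <= step_poly N y.
Proof.
move=> y0 yy' y1; rewrite /step_poly; apply: lerXn2r.
- by rewrite nnegrE subr_ge0 exprn_ile1// (le_trans y0).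
- by rewrite nnegrE subr_ge0 exprn_ile1// (le_trans yy').
- by rewrite lerB// lerXn2r// ?nnegrE ?(le_trans y0).
Qed.

(** Bernoulli's inequality bounds the value below by [1 - (2 * y) ^+ N]. *)
Lemma step_poly_cvg1 y : 0 <= y < 1 / 2 -> step_poly N y @[N --> \oo] --> (1 : R).
Proof.
move=> /andP[y0 y1].
apply: (@squeeze_cvgr _ _ _ _ (fun N => 1 - (2 * y) ^+ N) (fun=> 1)).
- apply: nearW => N; have /(step_poly_itv N)/andP[_ ->] : 0 <= y <= 1 by apply/andP; split; lra.
  rewrite andbT; apply: le_trans (bernoulli_le _ _); last by rewrite exprn_ge0//= exprn_ile1//; lra.
  by rewrite exprMn natrX.
- rewrite -[X in _ --> X]subr0; apply: cvgB; first exact: cvg_cst.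
  by apply: cvg_expr; rewrite ger0_norm; lra.
- exact: cvg_cst.
Qed.

(** From [1 - x <= expR (- x)] the value is at most [expR (- (2 * y) ^+ N)], hence at most the
    inverse of [(2 * y) ^+ N]. *)
Lemma step_poly_cvg0 y : 1 / 2 < y <= 1 -> step_poly N y @[N --> \oo] --> (0 : R).
Proof.
move=> /andP[y0 y1]; have y2 : 0 < 2 * y by lra.
apply: (@squeeze_cvgr _ _ _ _ (fun=> 0) (fun N => ((2 * y)^-1) ^+ N)).
- apply: nearW => N; have /(step_poly_itv N)/andP[-> _] : 0 <= y <= 1 by apply/andP; split; lra.
  have h0 : 0 <= 1 - y ^+ N by rewrite subr_ge0 exprn_ile1//; lra.
  rewrite /=; apply: (@le_trans _ _ (expR (- (y ^+ N)) ^+ (2 ^ N))).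
    by rewrite lerXn2r ?nnegrE ?expR_ge0//; have := expR_ge1Dx (- y ^+ N).
  rewrite -expRM_natl mulrN expRN exprVn lef_pV2 ?posrE ?expR_gt0 ?exprn_gt0//.
  by rewrite natrX -exprMn; have := expR_ge1Dx ((2 * y) ^+ N); lra.
- exact: cvg_cst.
- apply: cvg_expr; rewrite ger0_norm ?invr_ge0 ?(ltW y2)// invf_lt1//; lra.
Qed.

End smooth_step.

Section laplace_bounds.
Context (R : realType) (d : measure_display) (Omega : measurableType d)
  (P : probability Omega R) (Z : Omega -> R).
Hypotheses (mZ : measurable_fun setT Z) (Z0 : forall w, 0 <= Z w).
Variables (s : R) (N : nat).
Hypothesis s0 : 0 <= s.

Local Notation t w := (expR (- (s * Z w))).

Let t01 w : 0 <= t w <= 1.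
Proof. by rewrite expR_ge0/= -[leRHS]expR0 ler_expR oppr_le0 mulr_ge0. Qed.

Let mt : measurable_fun setT (fun w => t w).
Proof.
apply: (measurableT_comp (@measurable_expR R)); apply: measurableT_comp => //.
exact: measurable_funM.
Qed.

Let mq : measurable_fun setT (fun w => step_poly N (t w)).
Proof. by apply: measurable_funX; apply: measurable_funB => //; exact: measurable_funX. Qed.

Let mset a : measurable [set w | Z w <= a].
Proof. by rewrite -[A in measurable A]setTI; exact: measurable_fun_le. Qed.

Let iq (c : R) : P.-integrable setT (EFin \o (fun w => c - step_poly N (t w))).
Proof.
apply: (@integrable_bounded _ _ _ P _ (`|c| + 1)); first exact: measurable_funB.
move=> w; apply: (le_trans (ler_normB _ _)); rewrite lerD2l.
exact/normr_le1/step_poly_itv.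
Qed.

Let Pset a : fine (P [set w | Z w <= a]) = \int[P]_w \1_[set w | Z w <= a] w.
Proof. by rewrite /Rintegral integral_indic// setIT. Qed.

Let iset a : P.-integrable setT (EFin \o (fun w => \1_[set w | Z w <= a] w : R)).
Proof.
apply: (@integrable_bounded _ _ _ P _ 1); first exact: measurable_indic.
by move=> w; rewrite indicE; case: (_ \in _); rewrite ?normr1 ?normr0.
Qed.

Let Eq (c : R) : \int[P]_w (c - step_poly N (t w)) = c - \int[P]_w step_poly N (t w).
Proof.
rewrite RintegralB//; first by rewrite Rintegral_prob_cst.
- by apply: (@integrable_bounded _ _ _ P _ `|c|).
- apply: (@integrable_bounded _ _ _ P _ 1) => // w; exact/normr_le1/step_poly_itv.
Qed.

(** As a function of [Z], the composed step is nondecreasing, so on [Z <= a] it is at most its value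
    at [a], the error term. *)
Lemma prob_le_step a : 0 <= a -> fine (P [set w | Z w <= a]) <=
  1 - \int[P]_w step_poly N (t w) + step_poly N (expR (- (s * a))).
Proof.
move=> a0; set e := step_poly N (expR _).
rewrite Pset addrAC -Eq; apply: le_Rintegral => // w _.
have /andP[q0 q1] := step_poly_itv N (t01 w).
have ta : 0 <= expR (- (s * a)) <= 1 by rewrite expR_ge0/= -[leRHS]expR0 ler_expR oppr_le0 mulr_ge0.
have /andP[e0 _] := step_poly_itv N ta; rewrite -/e in e0.
rewrite indicE; case: (boolP (w \in _)) => [|_] /=; last lra.
rewrite inE /= => Za; have : step_poly N (t w) <= e; last lra.
apply: step_poly_le; rewrite ?expR_ge0//.
  by rewrite ler_expR lerN2 ler_wpM2l.
by have /andP[] := t01 w.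
Qed.

Lemma prob_ge_step b : 0 <= b ->
  1 - \int[P]_w step_poly N (t w) - (1 - step_poly N (expR (- (s * b)))) <=
  fine (P [set w | Z w <= b]).
Proof.
move=> b0; set e := step_poly N (expR _).
rewrite Pset addrAC -Eq; apply: le_Rintegral => // w _.
have tb : 0 <= expR (- (s * b)) <= 1 by rewrite expR_ge0/= -[leRHS]expR0 ler_expR oppr_le0 mulr_ge0.
have /andP[q0 q1] := step_poly_itv N (t01 w).
have /andP[e0 e1] := step_poly_itv N tb; rewrite -/e in e0 e1.
rewrite indicE; case: (boolP (w \in _)) => [_|] /=; first lra.
move/negP; rewrite inE /= => /negP; rewrite -ltNge => bZ.
have : e <= step_poly N (t w); last lra.
apply: step_poly_le; rewrite ?expR_ge0//.
  by rewrite ler_expR lerN2 ler_wpM2l// ltW.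
by have /andP[] := tb.
Qed.

End laplace_bounds.

Section laplace_poly.
Context (R : realType) (d : measure_display) (Omega : measurableType d)
  (P : probability Omega R) (Z : Omega -> R).
Hypotheses (mZ : measurable_fun setT Z) (Z0 : forall w, 0 <= Z w).
Variable s : R.
Hypothesis s0 : 0 <= s.

Lemma Rintegral_poly (p : {poly R}) :
  \int[P]_w p.[expR (- (s * Z w))] =
  \sum_(i < size p) p`_i * \int[P]_w expR (- ((i%:R * s) * Z w)).
Proof.
have mt i : measurable_fun setT (fun w => expR (- ((i%:R * s) * Z w))).
  apply: (measurableT_comp (@measurable_expR R)); apply: measurableT_comp => //.
  exact: measurable_funM.
have it i : P.-integrable setT (EFin \o (fun w => expR (- ((i%:R * s) * Z w)))).
  apply: (@integrable_bounded _ _ _ P _ 1) => // w.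
  by rewrite ger0_norm ?expR_ge0// -[leRHS]expR0 ler_expR oppr_le0 !mulr_ge0.
have hp w : p.[expR (- (s * Z w))] = \sum_(i < size p) p`_i * expR (- ((i%:R * s) * Z w)).
  rewrite horner_coef; apply: eq_bigr => i _.
  by rewrite -expRM_natl mulrN mulrA.
under eq_Rintegral do rewrite hp.
have iterm i : P.-integrable setT (EFin \o (fun w => p`_i * expR (- ((i%:R * s) * Z w)))).
  exact: (integrableZl measurableT p`_i (it i)).
elim: (size p) => [|n IH].
  by rewrite big_ord0; under eq_Rintegral do rewrite big_ord0; rewrite Rintegral_prob_cst.
rewrite big_ord_recr /= -IH -RintegralZl// -RintegralD//.
  by apply: eq_Rintegral => w _; rewrite big_ord_recr.
rewrite (_ : EFin \o _ = (fun w => \sum_(i < n) (p`_i * expR (- ((i%:R * s) * Z w)))%:E)%E).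
  apply: integrable_sum => // i _; exact: iterm.
by apply/funext => w; rewrite sumEFin.
Qed.

End laplace_poly.

Section laplace_continuity.
Context (R : realType) (d d' : measure_display) (Omega : measurableType d)
  (Omega' : measurableType d') (P : probability Omega R) (Q : probability Omega' R).
Variables (Z : nat -> Omega -> R) (S : {RV Q >-> R}).
Hypotheses (mZ : forall k, measurable_fun setT (Z k)) (Z0 : forall k w, 0 <= Z k w).
Hypothesis S0 : forall w, 0 <= S w.
Hypothesis ZS : forall lam : R, 0 <= lam ->
  \int[P]_w expR (- (lam * Z k w)) @[k --> \oo] --> \int[Q]_w expR (- (lam * S w)).

Let mS : measurable_fun setT S. Proof. exact: measurable_funPT. Qed.

Lemma step_poly_integral_cvg s N : 0 <= s ->
  \int[P]_w step_poly N (expR (- (s * Z k w))) @[k --> \oo] -->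
  \int[Q]_w step_poly N (expR (- (s * S w))).
Proof.
move=> s0; pose p : {poly R} := (1 - 'X^N) ^+ (2 ^ N).
have pE y : step_poly N y = p.[y] by rewrite /p horner_exp !hornerE.
under eq_Rintegral do rewrite pE.
rewrite (_ : (fun k => _) = (fun k => \int[P]_w p.[expR (- (s * Z k w))])); last first.
  by apply/funext => k; apply: eq_Rintegral => w _; rewrite pE.
rewrite Rintegral_poly//.
rewrite (_ : (fun k => _) =
    (fun k => \sum_(i < size p) p`_i * \int[P]_w expR (- ((i%:R * s) * Z k w)))); last first.
  by apply/funext => k; rewrite Rintegral_poly.
elim: (size p) => [|n IH].
  rewrite (_ : (fun k => _) = (fun=> 0)); last by apply/funext => k; rewrite big_ord0.
  by rewrite big_ord0; exact: cvg_cst.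
rewrite (_ : (fun k => _) =
    (fun k => \sum_(i < n) p`_i * \int[P]_w expR (- ((i%:R * s) * Z k w)) +
              p`_n * \int[P]_w expR (- ((n%:R * s) * Z k w)))); last first.
  by apply/funext => k; rewrite big_ord_recr.
rewrite big_ord_recr /=.
apply: cvgD => //; apply: cvgM; first exact: cvg_cst.
by apply: ZS; rewrite mulr_ge0.
Qed.

Lemma laplace_sandwich (a b e : R) : 0 <= a < b -> 0 < e -> \forall k \near \oo,
  fine (P [set w | Z k w <= a]) <= fine (Q [set w | S w <= b]) + e /\
  fine (Q [set w | S w <= a]) <= fine (P [set w | Z k w <= b]) + e.
Proof.
(* The rate [s] puts the jump of the step at the midpoint [c], as [expR (- (s * c)) = 1 / 2]; then
   [a] and [b] lie strictly on opposite sides of it. *)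
move=> /andP[a0 ab] e0; pose c := (a + b) / 2; pose s := ln 2 / c.
have c0 : 0 < c by rewrite /c; lra.
have s0 : 0 < s by rewrite divr_gt0// ln_gt0//; lra.
have sc : expR (- (s * c)) = 1 / 2 by rewrite /s divfK ?gt_eqF// expRN lnK ?posrE// mul1r.
have sa : 1 / 2 < expR (- (s * a)) <= 1.
  rewrite -sc ltr_expR ltrN2 ltr_pM2l// -[X in _ && (_ <= X)]expR0 ler_expR oppr_le0 mulr_ge0// ?ltW// andbT /c; lra.
have sb : 0 <= expR (- (s * b)) < 1 / 2.
  by rewrite expR_ge0/= -sc ltr_expR ltrN2 ltr_pM2l// /c; lra.
have e3 : 0 < e / 3 by rewrite divr_gt0.
have [N [Na Nb]] : exists N, step_poly N (expR (- (s * a))) <= e / 3 /\ 1 - step_poly N (expR (- (s * b))) <= e / 3.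
  have [N1 _ h1] := cvgr0_norm_le _ (step_poly_cvg0 sa) _ e3.
  have [N2 _ h2] := proj1 (cvgrPdist_le _ _) (step_poly_cvg1 sb) _ e3.
  exists (maxn N1 N2); split.
    by apply: le_trans (ler_norm _) (h1 _ (leq_maxl _ _)).
  by apply: le_trans (ler_norm _) (h2 _ (leq_maxr _ _)).
have b0 : 0 <= b by apply: (le_trans a0); exact: ltW.
have Pa k := @prob_le_step _ _ _ P (Z k) (mZ k) (Z0 k) s N (ltW s0) a a0.
have Pb k := @prob_ge_step _ _ _ P (Z k) (mZ k) (Z0 k) s N (ltW s0) b b0.
have Qa := @prob_le_step _ _ _ Q S mS S0 s N (ltW s0) a a0.
have Qb := @prob_ge_step _ _ _ Q S mS S0 s N (ltW s0) b b0.
have cl : \forall k \near \oo, `|\int[Q]_w step_poly N (expR (- (s * S w))) - \int[P]_w step_poly N (expR (- (s * Z k w)))| <= e / 3.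
  exact: (proj1 (cvgrPdist_le _ _) (step_poly_integral_cvg (ltW s0)) _ e3).
near=> k.
have : `|\int[Q]_w step_poly N (expR (- (s * S w))) - \int[P]_w step_poly N (expR (- (s * Z k w)))| <= e / 3.
  by near: k.
rewrite ler_norml => /andP[h1 h2].
move: (Pa k) (Pb k) Qa Qb h1 h2 Na Nb.
by move=> *; split; lra.
Unshelve. all: by end_near. Qed.

Lemma laplace_cdf_cvg x : {for x, continuous (cdf S)} ->
  P [set w | Z k w <= x] @[k --> \oo] --> cdf S x.
Proof.
pose G y := fine (Q [set w | S w <= y]).
have cdfE y : cdf S y = (G y)%:E.
  have mSy : measurable [set w | S w <= y].
    by rewrite -[X in measurable X]setTI; exact: measurable_fun_le.
  by rewrite /G fineK ?fin_num_measure//; congr (Q _); apply/seteqP; split=> w; rewrite /= in_itv.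
move=> cx; have {}cx : G y @[y --> x] --> G x.
  rewrite (_ : G = fine \o cdf S); last by apply/funext => y; rewrite /= cdfE.
  by apply: fine_cvg; rewrite /= cdfE /= -cdfE; exact: cx.
rewrite cdfE; apply: cvg_EFin.
  apply: nearW => k; rewrite fin_num_measure//.
  by rewrite -[X in measurable X]setTI; exact: measurable_fun_le.
rewrite (_ : fine \o _ = (fun k => fine (P [set w | Z k w <= x])))//.
have G0 y : y < 0 -> G y = 0.
  move=> y0; rewrite /G (_ : [set w | _] = set0) ?measure0//.
  by apply/seteqP; split=> // w /=; rewrite leNgt (lt_le_trans y0).
have p0 k y : 0 <= fine (P [set w | Z k w <= y]) by rewrite fine_ge0.
apply/cvgrPdist_le => e e0; have e2 : 0 < e / 2 by rewrite divr_gt0.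
have : \forall y \near x, `|G x - G y| <= e / 2 := proj1 (cvgrPdist_le _ _) cx _ e2.
rewrite -nbhs_ballE => -[dl /= dl0 hd].
have dist y : `|x - y| < dl -> `|G x - G y| <= e / 2 by move=> h; apply: hd; rewrite /ball/=.
have [x0|x0] := ltP x 0.
  apply: nearW => k; rewrite G0// (_ : [set w | _] = set0) ?measure0 ?subrr ?normr0 ?ltW//.
  by apply/seteqP; split=> // w /=; rewrite leNgt (lt_le_trans x0).
have up : \forall k \near \oo, fine (P [set w | Z k w <= x]) <= G (x + dl / 2) + e / 2.
  have xd : 0 <= x < x + dl / 2 by apply/andP; split; lra.
  by have := laplace_sandwich xd e2; apply: filterS => k [].
have Gup : G (x + dl / 2) <= G x + e / 2.
  have := dist (x + dl / 2); rewrite opprD addrA subrr sub0r normrN ger0_norm; last lra.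
  have h : dl / 2 < dl by lra.
  by move=> /(_ h); rewrite ler_norml => /andP[? ?]; lra.
have low : \forall k \near \oo, G x <= fine (P [set w | Z k w <= x]) + e.
  move: x0; rewrite le_eqVlt => /predU1P[x0|x0].
    (* At [x = 0] there is no nonnegative point to the left; continuity and the vanishing of [G] on
       negative numbers make [G 0] small directly. *)
    apply: nearW => k; have := dist (- (dl / 2)); rewrite -x0 sub0r opprK ger0_norm; last lra.
    have h : dl / 2 < dl by lra.
    move=> /(_ h); rewrite (G0 (- (dl / 2))); last lra.
    by have := p0 k 0; rewrite ler_norml => ? /andP[? ?]; lra.
  (* Cut off at 0, because the sandwich compares nonnegative points only. *)
  pose a := Num.max 0 (x - dl / 2).
  have ax : a < x by rewrite /a gt_max x0/=; lra.
  have xa : x - a <= dl / 2 by rewrite lerBlDr -lerBlDl le_max; apply/orP; right; lra.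
  have a0 : 0 <= a by rewrite le_max lexx.
  have := dist a; rewrite ger0_norm; last lra.
  have h : x - a < dl by lra.
  move=> /(_ h); rewrite ler_norml => /andP[? ?].
  have a0x : 0 <= a < x by rewrite a0.
  by have := laplace_sandwich a0x e2; apply: filterS => k [_]; rewrite -/(G a); lra.
near=> k; rewrite ler_norml; apply/andP; split.
  have : fine (P [set w | Z k w <= x]) <= G (x + dl / 2) + e / 2 by near: k.
  lra.
have : G x <= fine (P [set w | Z k w <= x]) + e by near: k.
lra.
Unshelve. all: by end_near. Qed.

End laplace_continuity.

(** * The limiting sum *)

Section exponential_integral.
Context (R : realType).

(** One antiderivative serves two purposes: [q = 0] represents [expR (- (lam * a))] as a tail
    integral, and [q = 1], [a = 0] integrates the exponential distribution function to
    [r / (lam + r)]. *)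
Lemma integral_exp_mixture (lam r q a : R) : 0 < lam -> 0 <= r -> 0 <= q <= 1 -> 0 <= a ->
  (\int[lebesgue_measure]_(s in `[a, +oo[)
     (lam * expR (- (lam * s)) * (1 - q * expR (- (r * s))))%:E =
   (expR (- (lam * a)) - q * (lam / (lam + r)) * expR (- ((lam + r) * a)))%:E)%E.
Proof.
move=> lam0 r0 /andP[q0 q1] a0; have lr : 0 < lam + r by rewrite ltr_pwDl.
pose G (s : R) := - expR (- (lam * s)) + q * (lam / (lam + r)) * expR (- ((lam + r) * s)).
have dG (s : R) : is_derive s 1 G (lam * expR (- (lam * s)) * (1 - q * expR (- (r * s)))).
  rewrite /G; apply: is_derive_eq.
  rewrite !scaler1.
  rewrite (_ : - ((lam + r) * s) = - (lam * s) + - (r * s)) ?expRD; last by ring.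
  rewrite /GRing.scale/=; field; exact: lt0r_neq0.
have cexp (c : R) : 0 < c -> expR (- (c * x)) @[x --> +oo] --> (0 : R).
  move=> c0; apply: (@cvg_comp _ _ _ (fun x => c * x) (fun z => expR (- z)) _ (pinfty_nbhs R));
    last exact: cvgr_expR.
  exact: gt0_cvgMry.
have cf : continuous (fun s : R => lam * expR (- (lam * s)) * (1 - q * expR (- (r * s)))).
  by move=> x; apply: differentiable_continuous; apply/derivable1_diffP; exact: ex_derive.
rewrite (@ge0_continuous_FTC2y _ _ G _ 0).
- by rewrite sub0e /G -EFinN; congr (_%:E); ring.
- move=> x ax; have x0 := le_trans a0 ax.
  apply: mulr_ge0; first by rewrite mulr_ge0 ?expR_ge0// ltW.
  rewrite subr_ge0 mulr_ile1 ?expR_ge0//.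
  by rewrite -[leRHS]expR0 ler_expR oppr_le0 mulr_ge0.
- exact: continuous_subspaceT.
- rewrite -[X in _ --> X]addr0 -[X in X + _](oppr0) -[X in _ + X](mulr0 (q * (lam / (lam + r)))).
  by apply: cvgD; [apply: cvgN; exact: cexp|apply: cvgMr; exact: cexp].
- by move=> x _; exact: ex_derive.
- apply: cvg_at_right_filter; apply: differentiable_continuous.
  by apply/derivable1_diffP; exact: ex_derive.
- by move=> x _; rewrite derive1E; exact: derive_val.
Qed.

End exponential_integral.

Section exponential_mixture.
Context (R : realType) (d : measure_display) (Omega : measurableType d)
  (P : probability Omega R).
Notation mu := (@lebesgue_measure R).

(* Integrates the survival identity against the exponential density
   [lam * expR (- lam s)], using [expR (- lam z) = \int_(s >= z) lam expR (- lam s)]. *)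
Lemma exponential_mixture (lam : R) (Z rate A B : Omega -> R) : 0 < lam ->
  measurable_fun setT Z -> measurable_fun setT rate ->
  measurable_fun setT A -> measurable_fun setT B ->
  (forall w, 0 <= rate w) -> (forall w, 0 <= A w) -> (forall w, 0 <= B w) ->
  (forall s : R, (0 <= s)%R -> \int[P]_w (A w * \1_(`[0, s] : set R) (Z w))%:E =
                       \int[P]_w (B w * (1 - expR (- (rate w * s))))%:E)%E ->
  (\int[P]_w (A w * (\1_(`[0, +oo[ : set R) (Z w) * expR (- (lam * Z w))))%:E =
   \int[P]_w (B w * (rate w / (lam + rate w)))%:E)%E.
Proof.
move=> lam0 mZ mrate mA mB rate0 A0 B0 hAB.
pose dens (s : R) : R := \1_(`[0, +oo[ : set R) s * (lam * expR (- (lam * s))).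
have mdens : measurable_fun setT dens.
  apply: measurable_funM; first exact: measurable_indic.
  apply: measurable_funM => //; apply: (measurableT_comp (@measurable_expR R)).
  by apply: measurableT_comp => //; exact: measurable_funM.
have dens0 s : 0 <= dens s.
  apply: mulr_ge0; first by rewrite indicE.
  by apply: mulr_ge0; [exact: ltW|exact: expR_ge0].
pose D : set (Omega * R) := [set z | 0 <= Z z.1] `&` [set z | Z z.1 <= z.2].
have mZ1 : measurable_fun [set: Omega * R] (fun z => Z z.1) by exact: measurableT_comp.
have mD : measurable D.
  apply: measurableI; rewrite -[X in measurable X]setTI; exact: measurable_fun_le.
pose f (z : Omega * R) := (A z.1 * (dens z.2 * \1_D z))%:E.
pose g (z : Omega * R) := (B z.1 * (dens z.2 * (1 - expR (- (rate z.1 * z.2)))))%:E.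
have mf : measurable_fun setT f.
  apply/measurable_EFinP; apply: measurable_funM; first exact: measurableT_comp.
  apply: measurable_funM; first exact: measurableT_comp.
  exact: measurable_indic.
have f0 z : (0 <= f z)%E.
  by rewrite lee_fin; apply: mulr_ge0 => //; apply: mulr_ge0 => //; rewrite indicE.
have mg : measurable_fun setT g.
  apply/measurable_EFinP; apply: measurable_funM; first exact: measurableT_comp.
  apply: measurable_funM; first exact: measurableT_comp.
  apply: measurable_funB => //; apply: (measurableT_comp (@measurable_expR R)).
  by apply: measurableT_comp => //; apply: measurable_funM => //; exact: measurableT_comp.
have g0 z : (0 <= g z)%E.
  rewrite lee_fin; apply: mulr_ge0 => //.
  have [z0|z0] := ltP z.2 0.
    by rewrite /dens indicE memNset ?mul0r//= in_itv/= andbT leNgt z0.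
  apply: mulr_ge0 => //; rewrite subr_ge0 -[leRHS]expR0 ler_expR oppr_le0.
  exact: mulr_ge0.
have -> : (\int[P]_w (A w * (\1_(`[0, +oo[ : set R) (Z w) * expR (- (lam * Z w))))%:E =
           \int[P]_w \int[mu]_s f (w, s))%E.
  apply: eq_integral => w _; rewrite /f /=.
  under eq_integral do rewrite EFinM.
  rewrite ge0_integralZl//; last 3 first.
  - by apply/measurable_EFinP; apply: measurable_funM => //; apply: (measurable_fun_pair2 (f := (\1_D : Omega * R -> R))); exact: measurable_indic.
  - by move=> s _; rewrite lee_fin; apply: mulr_ge0 => //; rewrite indicE.
  - by rewrite lee_fin.
  rewrite EFinM; congr (_ * _)%E.
  have [Zw|Zw] := ltP (Z w) 0.
    rewrite indicE memNset/= ?mul0r; last by rewrite /= in_itv/= andbT leNgt Zw.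
    rewrite integral0_eq// => s _; rewrite [\1_D _]indicE memNset ?mulr0//.
    by case=> /=; rewrite leNgt Zw.
  rewrite indicE mem_set/= ?in_itv/= ?Zw// mul1r.
  have := @integral_exp_mixture R lam 0 0 (Z w) lam0 (lexx _) _ Zw.
  rewrite lexx ler01 !mul0r subr0 => /(_ isT) <-.
  rewrite [LHS]integral_mkcond; apply: eq_integral => s _; rewrite patchE.
  rewrite /dens !indicE; case: ifPn.
    rewrite inE/= in_itv/= andbT => Zs.
    rewrite [_ \in _]mem_set/= ?in_itv/= ?andbT ?(le_trans Zw)//.
    by rewrite mem_set// !mul0r !mul1r subr0 !mulr1.
  rewrite notin_setE/= in_itv/= andbT => Zs.
  by rewrite [(w, s) \in D]memNset ?mulr0// => -[_ /=]; exact: Zs.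
have -> : (\int[P]_w (B w * (rate w / (lam + rate w)))%:E =
           \int[P]_w \int[mu]_s g (w, s))%E.
  apply: eq_integral => w _; rewrite /g /=.
  have -> : rate w / (lam + rate w) = 1 - lam / (lam + rate w).
    by have := rate0 w => ?; field; rewrite gt_eqF// ltr_pwDl.
  under eq_integral do rewrite EFinM.
  rewrite ge0_integralZl//; last 3 first.
  - apply/measurable_EFinP; apply: measurable_funM => //; apply: measurable_funB => //.
    apply: (measurableT_comp (@measurable_expR R)).
    by apply: measurableT_comp => //; exact: measurable_funM.
  - move=> s _; have [s0|s0] := ltP s 0.
      by rewrite lee_fin /dens indicE memNset ?mul0r//= in_itv/= andbT leNgt s0.
    rewrite lee_fin; apply: mulr_ge0 => //; rewrite subr_ge0 -[leRHS]expR0 ler_expR oppr_le0.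
    exact: mulr_ge0.
  - by rewrite lee_fin.
  rewrite EFinM; congr (_ * _)%E.
  have := @integral_exp_mixture R lam (rate w) 1 0 lam0 (rate0 w) _ (lexx _).
  rewrite ler01 lexx !mulr0 oppr0 expR0 mul1r mulr1 => /(_ isT) <-.
  rewrite [LHS]integral_mkcond; apply: eq_integral => s _; rewrite patchE.
  rewrite /dens indicE; by case: ifPn => _; rewrite ?mul0r// !mul1r.
(* With [s] outermost, the inner integrals are the two sides of the assumed identity multiplied by
   [dens s]. *)
rewrite fubini_tonelli// [RHS]fubini_tonelli//.
apply: eq_integral => s _; rewrite /f /g /=.
have [s0|s0] := ltP s 0.
  rewrite !integral0_eq// => w _; rewrite /dens indicE memNset/= ?mul0r ?mulr0//=.
    by rewrite in_itv/= andbT leNgt s0.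
  by rewrite in_itv/= andbT leNgt s0.
rewrite (eq_integral (fun w => ((dens s)%:E * (A w * \1_(`[0, s] : set R) (Z w))%:E)%E)); last first.
  move=> w _; rewrite -EFinM mulrCA; congr ((_ * (_ * _))%:E).
  rewrite !indicE; congr ((_ : bool)%:R); apply/idP/idP; rewrite !inE/= in_itv/=.
    by case=> /= -> ->.
  by move=> /andP[].
rewrite [RHS](eq_integral (fun w => ((dens s)%:E * (B w * (1 - expR (- (rate w * s))))%:E)%E)); last first.
  by move=> w _; rewrite -EFinM mulrCA.
rewrite ge0_integralZl//; last 3 first.
- apply/measurable_EFinP; apply: measurable_funM => //.
  by apply: measurableT_comp => //; exact: measurable_indic.
- by move=> w _; rewrite lee_fin mulr_ge0// indicE.
- by rewrite lee_fin.
rewrite ge0_integralZl//; last 3 first.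
- apply/measurable_EFinP; apply: measurable_funM => //; apply: measurable_funB => //.
  apply: (measurableT_comp (@measurable_expR R)).
  by apply: measurableT_comp => //; exact: measurable_funM.
- move=> w _; rewrite lee_fin mulr_ge0// subr_ge0 -[leRHS]expR0 ler_expR oppr_le0.
  exact: mulr_ge0.
- by rewrite lee_fin.
by rewrite hAB.
Qed.

End exponential_mixture.

Lemma prod_bool (R : comPzSemiRingType) (I : Type) (s : seq I) (b : pred I) :
  \prod_(i <- s) (b i)%:R = (all b s)%:R :> R.
Proof. by elim: s => [|i s IH]; rewrite ?big_nil// big_cons IH -natrM mulnb. Qed.

Section conditionally_exponential.
Context (R : realType) (d : measure_display) (Omega : measurableType d)
  (P : probability Omega R) (V : {RV P >-> R}) (Z : nat -> {RV P >-> R})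
  (mu : nat -> R -> R).
Hypotheses (mu_ge0 : forall j v, 0 <= mu j v)
  (mmu : forall j, measurable_fun setT (mu j)).
Hypothesis condZ : cond_indep_exponential V Z mu.

Let rate j w := (mu j (V w))^-1.

Let rate_ge0 j w : 0 <= rate j w. Proof. by rewrite invr_ge0. Qed.

Let mrate j : measurable_fun setT (rate j).
Proof.
apply: (measurableT_comp (@measurable_invr R)).
by apply: (measurableT_comp (mmu j)); exact: measurable_funPT.
Qed.

Lemma integral_exponential_boxes (s : nat -> R) n : (forall j, 0 <= s j) ->
  (\int[P]_w (\prod_(1 <= j < n.+1) \1_(`[0%R, s j] : set R) (Z j w))%:E =
   \int[P]_w (\prod_(1 <= j < n.+1) (1 - expR (- (rate j w * s j))))%:E)%E.
Proof.
move=> s0.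
have box j v : exponential_prob (mu j v)^-1 `[0, s j] =
    (1 - expR (- ((mu j v)^-1 * s j)))%:E.
  have := s0 j; rewrite le_eqVlt => /predU1P[<-|sj].
    by rewrite set_itv1 /exponential_prob integral_set1 mulr0 oppr0 expR0 subrr.
  by rewrite exponential_prob_itv0c// EFinB mulNr.
pose B j : set R := `[0, s j]%classic.
have := @condZ n setT B measurableT (fun j => measurable_itv _); rewrite /B.
under eq_integral do under eq_bigr do rewrite box.
set E := _ `&` _ => hE.
have mE : measurable E.
  apply: measurableI; first by rewrite -[X in measurable X]setTI; exact: measurable_funP.
  apply: bigcap_measurableType.
  by move=> j _; rewrite -[X in measurable X]setTI; exact: measurable_funP.
transitivity (P E).
  rewrite -[E in P E]setIT -integral_indic//; apply: eq_integral => w _; congr (_%:E).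
  rewrite (eq_bigr (fun j => ((0 <= Z j w <= s j)%R : bool)%:R)); last first.
    by move=> j _; rewrite indicE; congr (_ : bool)%:R; apply/idP/idP; rewrite inE/= in_itv.
  rewrite prod_bool indicE; congr (_ : bool)%:R; apply/idP/idP.
    move=> /allP h; rewrite inE; split=> // j /= jn; have := h j.
    by rewrite mem_index_iota ltnS jn in_itv => /(_ isT).
  rewrite inE => -[_ h]; apply/allP => j; rewrite mem_index_iota ltnS => jn.
  by have := h j jn; rewrite /= in_itv.
rewrite hE ge0_integral_distribution.
- by apply: eq_integral => w _ /=; rewrite prodEFin.
- under eq_fun do rewrite prodEFin.
  apply/measurable_EFinP; apply: measurable_prod => j _.
  apply: measurable_funB => //; apply: (measurableT_comp (@measurable_expR R)).
  apply: measurableT_comp => //; apply: measurable_funM => //.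
  exact: (measurableT_comp (@measurable_invr R)).
- move=> v; rewrite prodEFin lee_fin; apply: prodr_ge0 => j _.
  by rewrite subr_ge0 -[leRHS]expR0 ler_expR oppr_le0 mulr_ge0 ?invr_ge0.
Qed.

Section laplace.
Variable lam : R.
Hypothesis lam0 : 0 < lam.

(** The indicator confines the value to the half-line on which the tail integral against [dens]
    represents the exponential. *)
Let T j w := \1_(`[0, +oo[ : set R) (Z j w) * expR (- (lam * Z j w)).
Let phi j w := rate j w / (lam + rate j w).

Let mindic j (D : interval R) :
  measurable_fun setT (fun w => \1_([set` D] : set R) (Z j w) : R).
Proof. exact: (measurableT_comp (measurable_indic (measurable_itv D)) (measurable_funPT (Z j))). Qed.

(** Coordinates are converted one at a time from boxes to exponentials: the first [m] are converted,
    the others still boxed. The induction hypothesis, for all upper ends of box [m + 1], is the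
    identity that [exponential_mixture] integrates. *)
Let integral_mixed (s : nat -> R) m n : (forall j, 0 <= s j) -> (m <= n)%N ->
  (\int[P]_w (\prod_(1 <= j < m.+1) T j w *
     \prod_(m.+1 <= j < n.+1) \1_(`[0%R, s j] : set R) (Z j w))%:E =
   \int[P]_w (\prod_(1 <= j < m.+1) phi j w *
     \prod_(m.+1 <= j < n.+1) (1 - expR (- (rate j w * s j))))%:E)%E.
Proof.
elim: m s => [|m IH] s s0 mn.
  under eq_integral do rewrite big_geq// mul1r.
  under [RHS]eq_integral do rewrite big_geq// mul1r.
  exact: integral_exponential_boxes.
pose A w := \prod_(1 <= j < m.+1) T j w *
     \prod_(m.+2 <= j < n.+1) \1_(`[0%R, s j] : set R) (Z j w).
pose B w := \prod_(1 <= j < m.+1) phi j w *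
     \prod_(m.+2 <= j < n.+1) (1 - expR (- (rate j w * s j))).
transitivity (\int[P]_w (A w * T m.+1 w)%:E)%E.
  by apply: eq_integral => w _; rewrite big_nat_recr//= /A mulrAC.
transitivity (\int[P]_w (B w * phi m.+1 w)%:E)%E; last first.
  by apply: eq_integral => w _; rewrite big_nat_recr//= /B mulrAC.
have mA : measurable_fun setT A.
  apply: measurable_funM; apply: measurable_prod => j _; last first.
    exact: mindic.
  apply: measurable_funM.
    exact: mindic.
  apply: (measurableT_comp (@measurable_expR R)); apply: measurableT_comp => //.
  by apply: measurable_funM => //; exact: (measurable_funPT (Z j)).
have mB : measurable_fun setT B.
  apply: measurable_funM; apply: measurable_prod => j _.
    apply: measurable_funM => //; apply: (measurableT_comp (@measurable_invr R)).
    exact: measurable_funD.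
  apply: measurable_funB => //; apply: (measurableT_comp (@measurable_expR R)).
  by apply: measurableT_comp => //; exact: measurable_funM.
have A0 w : 0 <= A w.
  apply: mulr_ge0; apply: prodr_ge0 => j _; last by rewrite indicE.
  by apply: mulr_ge0; [rewrite indicE|exact: expR_ge0].
have B0 w : 0 <= B w.
  apply: mulr_ge0; apply: prodr_ge0 => j _.
    by apply: mulr_ge0 => //; rewrite invr_ge0 addr_ge0// ltW.
  by rewrite subr_ge0 -[leRHS]expR0 ler_expR oppr_le0 mulr_ge0.
have mZ : measurable_fun setT (Z m.+1) := measurable_funPT _.
apply: exponential_mixture => //.
(* Only the upper end of box [m + 1] is varied. *)
move=> t t0; pose s' j := if j == m.+1 then t else s j.
have s'0 j : 0 <= s' j by rewrite /s'; case: ifP.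
have s't : s' m.+1 = t by rewrite /s' eqxx.
have s'E j : (m.+1 < j)%N -> s' j = s j by rewrite /s'; case: eqP => // ->; rewrite ltnn.
have := IH s' s'0 (ltnW mn).
have hL w : \prod_(1 <= j < m.+1) T j w *
     \prod_(m.+1 <= j < n.+1) \1_(`[0%R, s' j] : set R) (Z j w) =
     A w * \1_(`[0, t] : set R) (Z m.+1 w).
  rewrite (@big_ltn _ _ _ m.+1)// s't /A -mulrA; congr (_ * _); rewrite mulrC; congr (_ * _).
  by apply: eq_big_nat => j /andP[mj _]; rewrite s'E.
have hR w : \prod_(1 <= j < m.+1) phi j w *
     \prod_(m.+1 <= j < n.+1) (1 - expR (- (rate j w * s' j))) =
     B w * (1 - expR (- (rate m.+1 w * t))).
  rewrite (@big_ltn _ _ _ m.+1)// s't /B -mulrA; congr (_ * _); rewrite mulrC; congr (_ * _).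
  by apply: eq_big_nat => j /andP[mj _]; rewrite s'E.
under eq_integral do rewrite hL; move=> ->.
by under eq_integral do rewrite hR.
Qed.

Lemma integral_exponential_transform n :
  (\int[P]_w (\prod_(1 <= j < n.+1) T j w)%:E =
   \int[P]_w (\prod_(1 <= j < n.+1) phi j w)%:E)%E.
Proof.
have := @integral_mixed (fun=> 0) n n (fun=> lexx _) (leqnn _).
under eq_integral do rewrite (big_geq (leqnn _)) mulr1.
by under [in X in _ = X -> _]eq_integral do rewrite (big_geq (leqnn _)) mulr1.
Qed.

End laplace.

End conditionally_exponential.

(** * Almost sure convergence of the series and its transform *)

Section conditionally_exponential_sum.
Context (R : realType) (d : measure_display) (Omega : measurableType d)
  (P : probability Omega R) (V : {RV P >-> R}) (Z : nat -> {RV P >-> R})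
  (mu : nat -> R -> R).
Hypotheses (mu_ge0 : forall j v, 0 <= mu j v)
  (mmu : forall j, measurable_fun setT (mu j))
  (mu_sum : forall n v, \sum_(1 <= j < n.+1) mu j v <= 1)
  (mu_gt0 : {ae P, forall w, forall j, 0 < mu j (V w)}).
Hypothesis condZ : cond_indep_exponential V Z mu.

Let mZ j : measurable_fun setT (Z j). Proof. exact: measurable_funPT. Qed.

Lemma ae_exponential_ge0 : {ae P, forall w, forall j, 0 <= Z j.+1 w}.
Proof.
apply: ae_foralln => j.
pose B i : set R := if i == j.+1 then `]-oo, 0[%classic else setT.
have mB i : measurable (B i) by rewrite /B; case: ifP.
have hP : P (Z j.+1 @^-1` `]-oo, 0[) = 0%E.
  have := @condZ j.+1 setT B measurableT mB.
  have -> : V @^-1` setT `&` \bigcap_(i in [set i | (0 < i <= j.+1)%N]) (Z i @^-1` B i) =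
      Z j.+1 @^-1` `]-oo, 0[.
    apply/seteqP; split=> w.
      by move=> [_ h]; have := h j.+1; rewrite /B /= eqxx leqnn; apply.
    by move=> h; split=> // i /= _; rewrite /B; case: eqP => // ->.
  move=> ->; rewrite integral0_eq// => v _; rewrite big_nat_recr//= /B eqxx.
  rewrite [X in (_ * X)%E](_ : _ = 0%E) ?mule0// /exponential_prob integral0_eq// => x.
  by rewrite /= in_itv/= => x0; rewrite lt0_exponential_pdf.
exists (Z j.+1 @^-1` `]-oo, 0[); split=> //.
  by rewrite -[X in measurable X]setTI; exact: measurable_funP.
by move=> w /= /negP; rewrite -ltNge in_itv.
Qed.

Let Sn n w := \sum_(1 <= j < n.+1) Z j w.

Let mSn n : measurable_fun setT (Sn n).
Proof. by apply: measurable_sum => j. Qed.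

Lemma laplace_partial_sum (lam : R) n : 0 <= lam ->
  \int[P]_w expR (- (lam * \sum_(1 <= j < n.+1) Z j w)) =
  \int[P]_w \prod_(1 <= j < n.+1) (1 + lam * mu j (V w))^-1.
Proof.
rewrite le_eqVlt => /predU1P[<-|lam0].
  apply: eq_Rintegral => w _; rewrite mul0r oppr0 expR0 big1// => j _.
  by rewrite mul0r addr0 invr1.
have mV j : measurable_fun setT (fun w => mu j (V w)).
  by apply: (measurableT_comp (mmu j)); exact: measurable_funPT.
transitivity (\int[P]_w \prod_(1 <= j < n.+1)
    (\1_(`[0, +oo[ : set R) (Z j w) * expR (- (lam * Z j w)))).
  apply: ae_eq_Rintegral.
  - apply: (measurableT_comp (@measurable_expR R)); apply: measurableT_comp => //.
    by apply: measurable_funM => //; exact: mSn.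
  - apply: measurable_prod => j _; apply: measurable_funM.
      exact: (measurableT_comp (measurable_indic (measurable_itv _)) (mZ j)).
    apply: (measurableT_comp (@measurable_expR R)); apply: measurableT_comp => //.
    exact: measurable_funM.
  - apply: filterS ae_exponential_ge0 => w Z0.
    rewrite mulr_sumr -sumrN expR_sum; apply: eq_big_nat => -[//|j] _.
    by rewrite indicE mem_set ?mul1r//= in_itv/= Z0.
rewrite /Rintegral (integral_exponential_transform mu_ge0 mmu condZ lam0) -/(Rintegral _ _ _).
apply: ae_eq_Rintegral.
- apply: measurable_prod => j _; apply: measurable_funM.
    exact: (measurableT_comp (@measurable_invr R)).
  apply: (measurableT_comp (@measurable_invr R)); apply: measurable_funD => //.
  exact: (measurableT_comp (@measurable_invr R)).
- apply: measurable_prod => j _.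
  apply: (measurableT_comp (@measurable_invr R)); apply: measurable_funD => //.
  exact: measurable_funM.
- apply: filterS mu_gt0 => w mu0; apply: eq_bigr => j _.
  have := mu0 j; move: (mu j (V w)) => m m0; field.
  by rewrite !lt0r_neq0// addr_gt0// mulr_gt0.
Qed.

(** Factor by factor [1 + x <= expR x], and the means add up to at most 1; the bound is uniform in
    [n], so no mass can escape to infinity. *)
Lemma laplace_partial_sum_ge (lam : R) n : 0 <= lam ->
  expR (- lam) <= \int[P]_w expR (- (lam * \sum_(1 <= j < n.+1) Z j w)).
Proof.
move=> lam0; rewrite laplace_partial_sum//.
have mu1 j w : 0 < 1 + lam * mu j (V w) by rewrite ltr_pwDl// mulr_ge0.
have p0 j w : 0 <= (1 + lam * mu j (V w))^-1 by rewrite invr_ge0 ltW.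
rewrite -[leLHS](Rintegral_prob_cst P); apply: le_Rintegral => //.
- exact: (@integrable_bounded _ _ _ P _ `|expR (- lam)|).
- apply: (@integrable_bounded _ _ _ P _ 1).
    apply: measurable_prod => j _.
    apply: (measurableT_comp (@measurable_invr R)); apply: measurable_funD => //.
    by apply: measurable_funM => //; apply: (measurableT_comp (mmu j)); exact: measurable_funPT.
  move=> w; rewrite ger0_norm ?prodr_ge0//; apply: prodr_ile1 => j _.
  by rewrite p0 invf_le1// lerDl mulr_ge0.
move=> w _; apply: (@le_trans _ _ (expR (- (lam * \sum_(1 <= j < n.+1) mu j (V w))))).
  by rewrite ler_expR lerN2 ler_piMr.
rewrite mulr_sumr -sumrN expR_sum; apply: ler_prod => j _.
rewrite expR_ge0/= expRN lef_pV2 ?posrE ?expR_gt0//; exact: expR_ge1Dx.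
Qed.

Let partial_sum_nondecreasing : {ae P, forall w, (forall n, 0 <= Sn n w) /\
  {homo Sn ^~ w : m n / (m <= n)%N >-> m <= n}}.
Proof.
apply: filterS ae_exponential_ge0 => w Z0; split.
  by move=> n; rewrite /Sn big_nat; apply: sumr_ge0 => -[].
by apply/nondecreasing_seqP => n; rewrite /Sn [leRHS]big_nat_recr//= lerDl.
Qed.

(** Almost surely the plain exponential; the minimum provides a bound at every point, negative
    partial sums included. *)
Let damped (lam : R) n w := Num.min 1 (expR (- (lam * Sn n w))).

Let mdamped (lam : R) n : measurable_fun setT (damped lam n).
Proof.
apply: measurable_minr => //; apply: (measurableT_comp (@measurable_expR R)).
by apply: measurableT_comp => //; exact: measurable_funM.
Qed.

Let damped_itv (lam : R) n w : 0 <= damped lam n w <= 1.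
Proof. by rewrite /damped le_min ler01 expR_ge0 ge_min lexx. Qed.

Let dampedE (lam : R) n w : 0 <= lam -> 0 <= Sn n w -> damped lam n w = expR (- (lam * Sn n w)).
Proof.
move=> l0 s0; apply/min_idPr; rewrite -[leRHS]expR0 ler_expR oppr_le0.
exact: mulr_ge0.
Qed.

Let integral_damped (lam : R) n : 0 <= lam ->
  \int[P]_w expR (- (lam * \sum_(1 <= j < n.+1) Z j w)) = \int[P]_w damped lam n w.
Proof.
move=> lam0; apply: ae_eq_Rintegral => //.
  apply: (measurableT_comp (@measurable_expR R)); apply: measurableT_comp => //.
  by apply: measurable_funM => //; exact: mSn.
by apply: filterS partial_sum_nondecreasing => w [s0 _]; rewrite dampedE.
Qed.

(** On the event [N] of unbounded partial sums the transform tends to 0, so the uniform lower bound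
    gives [expR (- lam)] as a lower bound for the probability of the complement. Small [lam] then
    excludes a positive probability of [N]. *)
Lemma ae_cvg_partial_sum : {ae P, forall w, cvgn (fun n => \sum_(1 <= j < n.+1) Z j w)}.
Proof.
pose N : set Omega := \bigcap_K \bigcup_n [set w | K%:R < Sn n w].
have mN : measurable N.
  apply: bigcapT_measurable => K; apply: bigcupT_measurable => n.
  rewrite -[X in measurable X]setTI; exact: measurable_fun_ltr.
have key (lam : R) : 0 < lam -> expR (- lam) <= fine (P (~` N)).
  move=> lam0.
  have cvg0 : \int[P]_w (damped lam n w * \1_N w) @[n --> \oo] --> (0 : R).
    rewrite -[X in _ --> X](Rintegral_prob_cst P 0).
    apply: (@bounded_Rconvergence _ _ _ _ _ _ 1) => //.
    - by move=> n; apply: measurable_funM => //; exact: measurable_indic.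
    - apply: filterS partial_sum_nondecreasing => w [s0 sm].
      rewrite indicE; case: (boolP (w \in N)) => [|_]; last first.
        by under eq_fun do rewrite mulr0; exact: cvg_cst.
      rewrite inE => Nw; apply/cvgr0Pnorm_le => e e0.
      have [n0 _ Kn0] := Nw (Num.bound (`|- ln e / lam|)) I.
      near=> n; rewrite mulr1 ger0_norm; last by have /andP[] := damped_itv lam n w.
      rewrite dampedE//; last exact: ltW.
      rewrite -[X in _ <= X](@lnK R)// ler_expR lerNl -ler_pdivrMl// mulrC.
      apply: (le_trans (ler_norm _)); apply: (le_trans (ltW (archi_boundP _))) => //.
      apply: (le_trans (ltW Kn0)); apply: sm; near: n; exact: nbhs_infty_ge.
    - move=> n w; apply: normr_le1; have /andP[h0 h1] := damped_itv lam n w.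
      by rewrite indicE; case: (_ \in _); rewrite ?mulr1 ?mulr0 ?h0 ?h1 ?lexx ?ler01.
  have le n : expR (- lam) <= \int[P]_w (damped lam n w * \1_N w) + fine (P (~` N)).
    apply: (le_trans (laplace_partial_sum_ge n (ltW lam0))); rewrite integral_damped; last exact: ltW.
    have -> : fine (P (~` N)) = \int[P]_w \1_(~` N) w.
      by rewrite /Rintegral integral_indic ?setIT//; exact: measurableC.
    have i1 : P.-integrable setT (EFin \o (fun w => damped lam n w * \1_N w)).
      apply: (@integrable_bounded _ _ _ P _ 1).
        by apply: measurable_funM => //; exact: measurable_indic.
      move=> w; apply: normr_le1; have /andP[h0 h1] := damped_itv lam n w.
      by rewrite indicE; case: (_ \in _); rewrite ?mulr1 ?mulr0 ?h0 ?h1 ?lexx ?ler01.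
    have i2 : P.-integrable setT (EFin \o (\1_(~` N) : Omega -> R)).
      apply: (@integrable_bounded _ _ _ P _ 1).
        by apply: measurable_indic; exact: measurableC.
      by move=> w; rewrite indicE; case: (_ \in _); rewrite ?normr1 ?normr0.
    rewrite -RintegralD//; apply: le_Rintegral => //.
    - apply: (@integrable_bounded _ _ _ P _ 1) => // w; apply: normr_le1.
      exact: damped_itv.
    - exact: (integrableD measurableT i1 i2).
    move=> w _; have /andP[h0 h1] := damped_itv lam n w.
    rewrite indicC !indicE; case: (_ \in _) => /=; first by rewrite mulr1 lerDl.
    by rewrite mulr0 add0r.
  have cl : \int[P]_w (damped lam n w * \1_N w) + fine (P (~` N)) @[n --> \oo] -->
      0 + fine (P (~` N)) by apply: cvgD => //; exact: cvg_cst.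
  rewrite -[leRHS]add0r -(cvg_lim _ cl)//; apply: limr_ge; first exact: cvgP cl.
  exact: nearW.
have PN : P N = 0%E.
  have PNC : fine (P N) = 1 - fine (P (~` N)).
    by rewrite probability_setC// fineB ?fin_num_measure//= opprB addrC subrK.
  rewrite -[LHS]fineK ?fin_num_measure//; congr (_%:E).
  apply/eqP; rewrite eq_le fine_ge0// andbT leNgt; apply/negP => p0.
  (* Taking [lam] to be half the probability of [N], [expR (- lam)] is at least [1 - lam], which
     exceeds the probability of the complement. *)
  have p2 : 0 < fine (P N) / 2 by rewrite divr_gt0.
  have := key _ p2; have := expR_ge1Dx (- (fine (P N) / 2)).
  by rewrite PNC in p0 p2 *; lra.
have aeN : {ae P, forall w, ~ N w}.
  by exists N; split=> // w /= /contrapT.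
apply: filterS2 aeN partial_sum_nondecreasing => w Nw [s0 sm].
have [K hK] : exists K : nat, forall n, Sn n w <= K%:R.
  apply: contrapT => h; apply: Nw => K _; apply: contrapT => hn; apply: h; exists K => n.
  by rewrite leNgt; apply/negP => ?; apply: hn; exists n.
apply: nondecreasing_is_cvgn; first exact: sm.
by exists K%:R => _ [n _ <-]; exact: hK.
Unshelve. all: by end_near. Qed.

Lemma conditional_sum_transform : exists S : {RV P >-> R}, [/\ forall w, 0 <= S w,
  {ae P, forall w, (\sum_(1 <= j < n.+1) Z j w) @[n --> \oo] --> S w} &
  forall lam : R, 0 <= lam ->
    \int[P]_w \prod_(1 <= j < n.+1) (1 + lam * mu j (V w))^-1 @[n --> \oo] -->
    \int[P]_w expR (- (lam * S w))].
Proof.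
(* Truncation makes the sum nonnegative everywhere, as the passage from transforms to distribution
   functions requires. *)
pose S0 w := Num.max 0 (limit_fun Sn w).
have mS0 : measurable_fun setT S0.
  by apply: measurable_maxr => //; exact: measurable_limit_fun.
pose S : {RV P >-> R} := HB.pack S0 (isMeasurableFun.Build _ _ _ _ _ mS0).
have S_ge0 w : 0 <= S w by rewrite /= /S0 le_max lexx.
have SnS : {ae P, forall w, Sn n w @[n --> \oo] --> S w}.
  apply: filterS2 ae_cvg_partial_sum partial_sum_nondecreasing => w cS [s0 sm].
  have cS' : Sn n w @[n --> \oo] --> limn (fun n => Sn n w) := cS.
  suff -> : S w = limn (fun n => Sn n w) by [].
  rewrite /= /S0 (limit_funE cS'); apply/max_idPr.
  by apply: limr_ge => //; exact: nearW.
exists S; split=> // lam lam0.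
under eq_fun do rewrite -laplace_partial_sum// integral_damped//.
apply: (@bounded_Rconvergence _ _ _ _ _ _ 1) => //.
- apply: (measurableT_comp (@measurable_expR R)); apply: measurableT_comp => //.
  exact: measurable_funM.
- apply: filterS2 SnS partial_sum_nondecreasing => w cS [s0 sm].
  under eq_fun do rewrite dampedE//.
  by apply: cvg_expR_seq; apply: cvgN; exact: cvgMr.
- by move=> n w; exact: normr_le1.
Qed.

End conditionally_exponential_sum.

(** Mean number [j] is the difference of [expR (- ((j - 1) * v))] and [expR (- (j * v))], so the sum
    telescopes. *)
Lemma sum_exp_mean_le1 (R : realType) n (v : R) : \sum_(1 <= j < n.+1) exp_mean j v <= 1.
Proof.
suff -> : \sum_(1 <= j < n.+1) exp_mean j v = 1 - (expR (n%:R * v))^-1.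
  by rewrite lerBlDr lerDl invr_ge0 expR_ge0.
elim: n => [|n IH]; first by rewrite big_geq// mul0r expR0 invr1 subrr.
have nv : n.+1%:R * v = n%:R * v + v by rewrite -natr1 mulrDl mul1r.
rewrite big_nat_recr//= IH /exp_mean nv expRD.
by field; rewrite !lt0r_neq0 ?expR_gt0.
Qed.

(** * Matching the limits on the two probability spaces *)

Lemma eq_law_Rintegral (R : realType) (d d' : measure_display) (Omega : measurableType d)
    (Omega' : measurableType d') (P : probability Omega R) (Q : probability Omega' R)
    (W : {RV P >-> R}) (W' : {RV Q >-> R}) (h : R -> R) :
  (forall A : set R, measurable A -> distribution Q W' A = distribution P W A) ->
  measurable_fun setT h -> (forall x, 0 <= h x) ->
  \int[P]_w h (W w) = \int[Q]_w h (W' w).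
Proof.
move=> WW' mh h0; rewrite /Rintegral; congr fine.
have mEh : measurable_fun setT (EFin \o h) by exact/measurable_EFinP.
have Eh0 x : (0 <= (EFin \o h) x)%E by rewrite lee_fin.
transitivity (\int[distribution P W]_x (EFin \o h) x)%E.
  by rewrite ge0_integral_distribution.
rewrite (eq_measure_integral (distribution Q W')) ?ge0_integral_distribution//.
by move=> A mA _; have := WW' _ mA.
Qed.

Theorem theorem5p3 (R : realType) (d : measure_display)
    (Omega : measurableType d) (P : probability Omega R)
    (alpha beta : R) (F : R -> R) (X : nat -> {RV P >-> R}) :
  0 < alpha ->
  beta = 1 + 1 / alpha ->
  mutually_independent (fun i => X i.+1) ->
  (forall i : nat, (0 < i)%N -> {ae P, forall w, 0 <= X i w}) ->
  (forall (i : nat) (x : R), (0 < i)%N -> cdf (X i) x = (F x)%:E) ->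
  (forall x : R, 0 <= x -> 1 - F x = expR (- (x `^ alpha))) ->
  exists W : {RV P >-> R},
    {ae P, forall w,
       (Ybar beta (fun i => X i w) k / k%:R `^ (1 / alpha) @[k --> \oo]
          --> W w) /\ 0 < W w} /\
    forall (d' : measure_display) (Omega' : measurableType d')
      (Q : probability Omega' R)
      (W' : {RV Q >-> R}) (Rj : nat -> {RV Q >-> R}),
      (forall A : set R, measurable A ->
         distribution Q W' A = distribution P W A) ->
      cond_indep_exponential W' Rj
        (fun j w => (expR ((beta * w) `^ alpha) - 1)
                    / expR (j%:R * (beta * w) `^ alpha)) ->
      exists S : {RV Q >-> R},
        {ae Q, forall w,
           (\sum_(1 <= j < n.+1) Rj j w) @[n --> \oo] --> S w} /\
        cvg_in_distribution P
          (fun k w => Tstar beta F (fun i => X i w) k) S.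
Proof.
move=> alpha0 betaE indepX X_ge0 cdfX tailF.
have beta0 : 0 < beta by rewrite betaE addr_gt0// divr_gt0.
pose v := Vlim X alpha beta.
have mv : measurable_fun setT v := @measurable_Vlim _ _ _ _ X alpha beta.
have reg := ae_regular alpha0 betaE indepX X_ge0 cdfX tailF.
(* Obtained by solving v = (beta w)^alpha for w. *)
pose W0 w := v w `^ (1 / alpha) / beta.
have mW0 : measurable_fun setT W0.
  by apply: measurable_funM => //; exact: (measurableT_comp (@measurable_powR R _) mv).
pose W : {RV P >-> R} := HB.pack W0 (isMeasurableFun.Build _ _ _ _ _ mW0).
have W_gt0 : {ae P, forall w, 0 < W w}.
  by apply: filterS reg => w [_ _ _ _ v0 _ _]; rewrite divr_gt0// powR_gt0.
have WV : {ae P, forall w, (beta * W w) `^ alpha = v w}.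
  by apply: filterS reg => w [_ _ _ _ v0 _ _]; exact: level_of_limit.
exists W; split.
  apply: filterS2 reg W_gt0 => w [_ Yb0 _ _ v0 ratio _] W0w; split=> //.
  exact: mean_cvg.
move=> d' Omega' Q W' Rj WW'.
pose theta x := (beta * x) `^ alpha.
have mtheta : measurable_fun setT theta.
  apply: (measurableT_comp (@measurable_powR R _)); exact: measurable_funM.
have mmean j : measurable_fun setT (fun x => exp_mean j (theta x)).
  exact: (measurableT_comp (@measurable_exp_mean R j)).
have mean_gt0 : {ae Q, forall w, forall j, 0 < exp_mean j (theta (W' w))}.
  (* Only the value 0 must be excluded: [powR] is positive at every nonzero base, negative ones
     included. *)
  exists (W' @^-1` [set 0]); split.
  - by rewrite -[X in measurable X]setTI; exact: measurable_funP.
  - have -> : Q (W' @^-1` [set 0]) = P (W @^-1` [set 0]) := WW' _ (measurable_set1 0).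
    case: W_gt0 => N [mN PN0 hN]; apply/eqP; rewrite -measure_le0 -PN0.
    have mW00 : measurable (W @^-1` [set 0]).
      by rewrite -[X in measurable X]setTI; exact: measurable_funP.
    rewrite le_measure ?inE//.
    by move=> w /= W0w; apply: hN; rewrite /= -/(W w) W0w ltxx.
  - move=> w; apply: contra_notP => /= W'0 j.
    have bW0 : beta * W' w != 0 by apply: mulf_neq0; [exact: lt0r_neq0|exact/eqP].
    have t0 : 0 < theta (W' w) by rewrite lt0r powR_ge0 powR_eq0 (negbTE bW0).
    by rewrite divr_gt0 ?expR_gt0// subr_gt0 -[ltLHS]expR0 ltr_expR.
move=> /(conditional_sum_transform (fun j x => exp_mean_ge0 j (powR_ge0 _ _)) mmean
  (fun n x => sum_exp_mean_le1 n _) mean_gt0) [S [S0 SnS ES]].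
exists S; split=> //; split=> [k|x]; first exact: measurable_Tstar.
apply: laplace_cdf_cvg => //.
- by move=> k; exact: measurable_Tstar.
- by move=> k w; exact: (Tstar_ge0 beta cdfX tailF).
move=> lam lam0; apply: (laplace_Tstar alpha0 betaE indepX X_ge0 cdfX tailF lam0).
rewrite (_ : (fun m => _) =
    (fun m => \int[Q]_w \prod_(1 <= j < m.+1) (1 + lam * exp_mean j (theta (W' w)))^-1)).
  exact: ES.
apply/funext => m; pose h x := \prod_(1 <= j < m.+1) exp_transform lam j (theta x).
have mh : measurable_fun setT h.
  apply: measurable_prod => j _.
  exact: (measurableT_comp (@measurable_exp_transform R lam j)).
rewrite -[RHS](eq_law_Rintegral (h := h) WW') //.
  apply: ae_eq_Rintegral.
  - apply: measurable_prod => j _.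
    exact: (measurableT_comp (@measurable_exp_transform R lam (m - j))).
  - exact: (measurableT_comp mh (measurable_funPT W)).
  - apply: filterS WV => w Wv.
    (* Peeling lists the means backwards, from number [m] down to 1; the product is reversed to
       agree with the partial sums of the series. *)
    rewrite /h /theta Wv big_add1/= big_nat_rev/= add0n.
    by apply: eq_big_nat => j /andP[_ jm]; rewrite subKn.
by move=> y; apply: prodr_ge0 => j _; have /andP[] := exp_transform_itv j lam0 (powR_ge0 (beta * y) alpha).
Qed.
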